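(* Fix $t_0\ge0$, $q\in\,]6,\infty[$ and $p\in\,]\frac{4q}{q-2},q[$. Let $\omega:=\sup_{s\in[0,t_0]}\operatorname{osc}(H_s)$, and let $\tilde p$ and $r$ be determined by $\tilde p^{-1}=q^{-1}+2p^{-1}$ and $p^{-1}=q^{-1}+r^{-1}$. Put $$a(p,q):=\log\max\Big(\frac{2r-1}{p-1},\ \frac{2p-2}{p-2},\ \frac{p-1}{\tilde p-1},\ \frac{2\tilde p-2}{\tilde p-2}\Big).$$ Suppose that $$N\ \ge\ 40\,\max(K_{t_0}(q),1)$$ and $$\lambda_s\ \ge\ \max\Big(\frac{pA_s}{4}+\frac{p(p+3)}{4}\,t_0B_s,\ \ \frac{17}{4}\,a(p,q)\,\omega\,\gamma_s\Big)\qquad\text{for all }s\in[0,t_0].$$ Then, for every $t\in[0,t_0]$, $$\varepsilon_t^{N,p}\ \le\ (2+8K_t(2))\,N^{-1}\,\big(1+16K_t(q)N^{-1}\big).$$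
   Context: Setting. $S$ is a finite set and $\langle f,\nu\rangle=\sum_{x\in S}f(x)\nu(x)$ for $f:S\to\mathbb R$ and a measure $\nu$ on $S$. $(\mu_t)_{t\ge0}$ are strictly positive probability measures on $S$ of the form $\mu_t(x)=Z_t^{-1}\exp(-\mathcal U_t(x))\mu_0(x)$, with $t\mapsto\mathcal U_t(x)$ continuously differentiable for each $x$, and $H_t(x):=-\frac{\partial}{\partial t}\log\mu_t(x)$ (so $\langle H_t,\mu_t\rangle=0$). For each $t\ge0$, $\mathcal L_t$ is a generator ($Q$-matrix) on $S$, with $t\mapsto\mathcal L_t(x,y)$ continuous, satisfying detailed balance $\mu_t(x)\mathcal L_t(x,y)=\mu_t(y)\mathcal L_t(y,x)$; $(\mathcal L_tf)(x)=\sum_y\mathcal L_t(x,y)f(y)$. The constants $\lambda_t\ge0$ depend continuously on $t$. Particle system. For $N\in\mathbb N$, $X^N_t=(X^N_{t,1},\dots,X^N_{t,N})$ is, under $\mathbb P$, a right-continuous time-inhomogeneous Markov process on $S^N$ with initial distribution the $N$-fold product $\mu_0^N$ and generator at time $t$ $$\mathcal L_t^N\varphi(x)=\lambda_t\sum_{i=1}^N\mathcal L_t^{(i)}\varphi(x)+\frac1N\sum_{i,j=1}^N(H_t(x_i)-H_t(x_j))^+\big(\varphi(x^{i\to j})-\varphi(x)\big),$$ where $\mathcal L_t^{(i)}$ is $\mathcal L_t$ acting on the $i$-th component and $x^{i\to j}$ is $x$ with its $i$-th component replaced by $x_j$. Set $\eta_t^N=\frac1N\sum_{i=1}^N\delta_{X^N_{t,i}}$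 and $\nu_t^N=\exp\big(-\int_0^t\langle H_s,\eta_s^N\rangle ds\big)\eta_t^N$. Notation. $\operatorname{osc}(g)=\sup g-\inf g$; $$\varepsilon_t^{N,p}=\sup\big\{\mathbb E[|\langle f,\nu_s^N\rangle-\langle f,\mu_s\rangle|^2]\ :\ s\in[0,t],\ f:S\to\mathbb R,\ \|f\|_{L^p(\mu_s)}\le1\big\};$$ $K_t(q)=\int_0^t\|H_s\|_{L^q(\mu_s)}\,ds$. The Dirichlet form is $\mathcal E_t(f)=-\int f\mathcal L_tf\,d\mu_t=\frac12\sum_{x,y\in S}(f(y)-f(x))^2\mathcal L_t(x,y)\mu_t(x)$. With $\mathcal S_0=\{f:S\to\mathbb R:\langle f,\mu_t\rangle=0,\ f\not\equiv0\}$ and $\mathcal S_1=\{f:S\to\mathbb R:\langle f^2,\mu_t\rangle=1,\ f\not\equiv1\}$, $$A_t=\sup_{f\in\mathcal S_0}\frac{-\int H_tf^2\,d\mu_t}{\mathcal E_t(f)},\qquad B_t=\sup_{f\in\mathcal S_0}\frac{|\int H_tf\,d\mu_t|^2}{\mathcal E_t(f)},\qquad \gamma_t=\sup_{f\in\mathcal S_1}\frac{\int f^2\log|f|\,d\mu_t}{\mathcal E_t(f)}.$$ Conventions: $0\cdot\log0=0$; a quotient with $\mathcal E_t(f)=0$ is read as $+\infty$ if its numerator is positive and is disregarded otherwise; an empty supremum is $0$. *)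

(* Defs.v *)
From HB Require Import structures.
From mathcomp Require Import all_boot all_order all_algebra.
From mathcomp Require Import all_classical all_reals all_analysis.

Set Implicit Arguments.
Unset Strict Implicit.
Unset Printing Implicit Defensive.

Import Order.TTheory GRing.Theory Num.Theory.
Import numFieldNormedType.Exports.

Local Open Scope classical_set_scope.
Local Open Scope ring_scope.

(* Time-dependent objects are functions on R, of which only the restriction to
   [0, +oo[ is meaningful. *)
Section Calculus.
Variable R : realType.

(* The derivative at t of the restriction of f to D; at an endpoint of an
   interval D it is the one-sided derivative. *)
Definition has_derivative_within (D : set R) (f : R -> R) (t l : R) : Prop :=
  (f s - f t) / (s - t) @[s --> within D t^'] --> l.

Definition derivative_within (D : set R) (f : R -> R) (t : R) : R :=
  lim ((f s - f t) / (s - t) @[s --> within D t^']).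

Definition C1_nonneg (f : R -> R) : Prop :=
  exists2 f' : R -> R,
    (forall t, 0 <= t -> has_derivative_within `[0, +oo[ f t (f' t)) &
    {within `[0, +oo[, continuous f'}.

End Calculus.

Section FiniteSpace.
Variables (R : realType) (S : finType).

Definition pairing (f nu : S -> R) : R := \sum_x f x * nu x.

Definition osc (g : S -> R) : R := sup (range g) - inf (range g).

Definition Lp_norm (p : R) (nu f : S -> R) : R :=
  (pairing (fun x => `|f x| `^ p) nu) `^ p^-1.

Definition strictly_positive_probability (nu : S -> R) : Prop :=
  (forall x, 0 < nu x) /\ \sum_x nu x = 1.

Definition Qmatrix (Q : S -> S -> R) : Prop :=
  (forall x y, x != y -> 0 <= Q x y) /\ (forall x, \sum_y Q x y = 0).

Definition detailed_balance (nu : S -> R) (Q : S -> S -> R) : Prop :=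
  forall x y, nu x * Q x y = nu y * Q y x.

Definition gen_apply (Q : S -> S -> R) (f : S -> R) (x : S) : R :=
  \sum_y Q x y * f y.

Definition dirichlet (nu : S -> R) (Q : S -> S -> R) (f : S -> R) : R :=
  - pairing (fun x => f x * gen_apply Q f x) nu.

(* The supremum over f in D of num f / den f, for den >= 0: a quotient with zero
   denominator is +oo if its numerator is positive and is left out otherwise;
   the supremum of the empty set is 0. *)
Definition quotients (D : set (S -> R)) (num den : (S -> R) -> R) :
    set (\bar R) :=
  [set v | exists2 f, D f &
     (den f != 0 /\ v = (num f / den f)%:E) \/
     [/\ den f = 0, 0 < num f & v = +oo%E]].

Definition sup_quotient (D : set (S -> R)) (num den : (S -> R) -> R) : \bar R :=
  if `[< quotients D num den = set0 >] then 0%E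
  else ereal_sup (quotients D num den).

Definition S0 (nu : S -> R) : set (S -> R) :=
  [set f | pairing f nu = 0 /\ f <> cst 0].

Definition S1 (nu : S -> R) : set (S -> R) :=
  [set f | pairing (fun x => f x ^+ 2) nu = 1 /\ f <> cst 1].

Definition constA (nu : S -> R) (Q : S -> S -> R) (h : S -> R) : \bar R :=
  sup_quotient (S0 nu)
    (fun f => - pairing (fun x => h x * f x ^+ 2) nu) (dirichlet nu Q).

Definition constB (nu : S -> R) (Q : S -> S -> R) (h : S -> R) : \bar R :=
  sup_quotient (S0 nu)
    (fun f => `|pairing (fun x => h x * f x) nu| ^+ 2) (dirichlet nu Q).

(* ln 0 = 0, so the summand vanishes where f does. *)
Definition const_gamma (nu : S -> R) (Q : S -> S -> R) : \bar R :=
  sup_quotient (S1 nu)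
    (fun f => pairing (fun x => f x ^+ 2 * ln `|f x|) nu) (dirichlet nu Q).

End FiniteSpace.

Section Flow.
Variables (R : realType) (S : finType) (mu : R -> S -> R).

Definition Hfun (t : R) (x : S) : R :=
  - derivative_within `[0, +oo[ (fun s => ln (mu s x)) t.

Definition Kfun (t q : R) : R :=
  \int[lebesgue_measure]_(s in `[0, t]) Lp_norm q (mu s) (Hfun s).

Definition sup_osc (t0 : R) : R := sup [set osc (Hfun s) | s in `[0, t0]].

End Flow.

Section Markov.
Variables (R : realType) (E : finType).

(* p s t x y is the probability of being in y at time t when starting from x at
   time s. The last clause is Kolmogorov's forward equation
   d/dt (p_{s,t} f) = p_{s,t} (G_t f); with t = s it says that G_s is the
   infinitesimal generator at time s. *)
Definition transition_function (G : R -> (E -> R) -> E -> R)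
    (p : R -> R -> E -> E -> R) : Prop :=
  [/\ forall s t x y, 0 <= s -> s <= t -> 0 <= p s t x y,
      forall s t x, 0 <= s -> s <= t -> \sum_y p s t x y = 1,
      forall s x y, 0 <= s -> p s s x y = (x == y)%:R,
      forall s t u x z, 0 <= s -> s <= t -> t <= u ->
        p s u x z = \sum_y p s t x y * p t u y z &
      forall (f : E -> R) s t x, 0 <= s -> s <= t ->
        has_derivative_within `[s, +oo[
          (fun u => \sum_y p s u x y * f y) t
          (\sum_y p s t x y * G t f y)].

Context {d : measure_display} {Omega : measurableType d}.
Variables (P : probability Omega R) (X : R -> Omega -> E).

Definition natural_filtration (s : R) : set (set Omega) :=
  <<s [set A | exists u x, [/\ 0 <= u, u <= s & A = X u @^-1` [set x] ] ] >>.

(* A right-continuous (for the discrete topology on E) Markov process, with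
   generator G t at time t and initial distribution m0. *)
Definition markov_process (G : R -> (E -> R) -> E -> R) (m0 : E -> R) : Prop :=
  [/\ forall t x, 0 <= t -> measurable (X t @^-1` [set x]),
      forall w t, 0 <= t -> \forall s \near t^'+, X s w = X t w,
      forall x, P (X 0 @^-1` [set x]) = (m0 x)%:E &
      exists2 p, transition_function G p &
        forall s t A y, 0 <= s -> s <= t -> natural_filtration s A ->
          P (A `&` X t @^-1` [set y]) =
          (\sum_x (p s t x y)%:E * P (A `&` X s @^-1` [set x]))%E].

End Markov.

Section Particles.
Variables (R : realType) (S : finType) (N : nat).

Notation config := {ffun 'I_N -> S}.

Definition replace (x : config) (i : 'I_N) (y : S) : config :=
  [ffun k => if k == i then y else x k].

Definition product_law (nu : S -> R) (x : config) : R := \prod_i nu (x i).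

Definition gen_component (Q : S -> S -> R) (i : 'I_N)
    (phi : config -> R) (x : config) : R :=
  gen_apply Q (fun y => phi (replace x i y)) (x i).

Definition particle_generator (lam : R) (Q : S -> S -> R) (h : S -> R)
    (phi : config -> R) (x : config) : R :=
  lam * (\sum_i gen_component Q i phi x) +
  N%:R^-1 * \sum_i \sum_j
    Num.max (h (x i) - h (x j)) 0 * (phi (replace x i (x j)) - phi x).

Definition empirical (x : config) (y : S) : R :=
  N%:R^-1 * \sum_i (x i == y)%:R.

Variable mu : R -> S -> R.
Context {d : measure_display} {Omega : measurableType d}.
Variables (P : probability Omega R) (X : R -> Omega -> config).

Definition nu_process (t : R) (w : Omega) (y : S) : R :=
  expR (- \int[lebesgue_measure]_(s in `[0, t])
            pairing (Hfun mu s) (empirical (X s w)))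
  * empirical (X t w) y.

Definition epsilon (t p : R) : \bar R :=
  ereal_sup [set v | exists s (f : S -> R),
    [/\ 0 <= s <= t, Lp_norm p (mu s) f <= 1 &
        v = expectation P (fun w =>
              `|pairing f (nu_process s w) - pairing f (mu s)| ^+ 2)]].

End Particles.

Definition a_const (R : realType) (p ptilde r : R) : R :=
  ln (Num.max ((2 * r - 1) / (p - 1))
     (Num.max ((2 * p - 2) / (p - 2))
     (Num.max ((p - 1) / (ptilde - 1))
              ((2 * ptilde - 2) / (ptilde - 2))))).

(* Main.v *)
Require Import Defs.
From HB Require Import structures.
From mathcomp Require Import all_boot all_order all_algebra.
From mathcomp Require Import all_classical all_reals all_analysis.
From mathcomp Require Import ring lra measurable_realfun.

Set Implicit Arguments.
Unset Strict Implicit.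
Unset Printing Implicit Defensive.

Import Order.TTheory GRing.Theory Num.Theory.
Import numFieldNormedType.Exports.

Local Open Scope classical_set_scope.
Local Open Scope ring_scope.

(* Write E_u for the expectation of the unnormalized empirical measure and let
   (g_s) solve the backward equation g_s' = H_s g_s - lambda_s L_s g_s with g_t = f.
   Then s |-> <g_s, mu_s> and s |-> E <g_s, nu_s> are constant, so nu_t is unbiased,
   and N^2 times the variance of <f, nu_t> is controlled by following
   exp (-2 int <H, eta>) sum_(i <> j) g_s(x_i) g_s(x_j) along the process: the
   mutation terms cancel, and what is left is a resampling term, quadratic in g_s
   and linear in H_s.  Its expectation is estimated by a product of means under
   mu_s, up to the error eps which is to be bounded.  The means are controlled by
   two contraction properties of the backward equation: the Poincare type bound on
   lambda makes it stable in L^p, and the log-Sobolev type bound makes it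
   hypercontractive after a time of order 1/omega, which compensates for the loss of
   integrability in g^2 and in the covariances.  The outcome is a linear inequality
   N eps <= c_1 + c_2 K(2) + eps (c_3 + c_4 K(q)), and the condition on N absorbs the
   last term.

   On the probabilistic side only the weighted laws
   u_k(t, x) = E[exp (-k int_0^t <H, eta>); X_t = x], for k = 1 and 2, are used; they
   solve a linear forward equation, by the Markov property. *)

(** * Real derivatives and primitives *)

(** The obstacle is integrability near the terminal time: there g is only known in L^p, so g^2 is
    only in L^(p/2), while eps controls covariances of functions in L^p. Time is therefore cut at
    distance 2/(17 omega) from t. On the last stretch the resampling rate is bounded by omega, and
    integrating omega over a time 2/(17 omega) leaves a pure number; before it g has reached L^(2r),
    and the L^2 and L^q norms of H take over. The factor 17/4 in the bound on lambda is fixed by 2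
    (17/4) a omega 2/(17 omega) = a: during that time an exponent p_1 improves to p_2 with (p_2 - 1)
    / (p_1 - 1) = exp a. Each such step costs exp (2/17) <= 17/15, and stability in L^p costs exp
    (3/14) <= 14/11 on squared norms; most numerical constants are built from these two. Since eps
    stands on both sides of the final inequality, it must be known to be finite before it can be
    absorbed. Finally, derivatives are one-sided at time 0 and, at first, for the laws of the
    process; extensions to negative times make them two-sided, so that a single calculus
    suffices. *)

Section DerivativeRules.
Variable R : realType.
Implicit Types (f g : R -> R) (t c l : R).

Lemma is_derive_continuous f t l : is_derive t 1 f l -> {for t, continuous f}.
Proof.
by move=> [df _]; exact/differentiable_continuous/derivable1_diffP.
Qed.

Lemma dvD f g t (df dg : R) : is_derive t 1 f df -> is_derive t 1 g dg ->
  is_derive t 1 (fun s => f s + g s) (df + dg).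
Proof. by move=> hf hg; exact: is_deriveD. Qed.

Lemma dvN f t (df : R) : is_derive t 1 f df -> is_derive t 1 (fun s => - f s) (- df).
Proof. by move=> hf; exact: is_deriveN. Qed.

Lemma dvB f g t (df dg : R) : is_derive t 1 f df -> is_derive t 1 g dg ->
  is_derive t 1 (fun s => f s - g s) (df - dg).
Proof. by move=> hf hg; exact: is_deriveB. Qed.

Lemma dvM f g t (df dg : R) : is_derive t 1 f df -> is_derive t 1 g dg ->
  is_derive t 1 (fun s => f s * g s) (df * g t + f t * dg).
Proof.
move=> hf hg; have := @is_deriveM R R f g t 1 df dg hf hg.
by rewrite /GRing.scale /= addrC [g t * _]mulrC.
Qed.

Lemma dvZ c f t (df : R) : is_derive t 1 f df ->
  is_derive t 1 (fun s => c * f s) (c * df).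
Proof. by move=> hf; exact: (is_deriveZ (f := f)). Qed.

Lemma dv_cst c t : is_derive t 1 (fun=> c) 0.
Proof. exact: is_derive_cst. Qed.

Lemma dv_id t : is_derive t 1 (fun s => s) 1.
Proof. exact: is_derive_id. Qed.

Lemma dv_comp f g t (a b : R) : is_derive (g t) 1 f a -> is_derive t 1 g b ->
  is_derive t 1 (fun s => f (g s)) (a * b).
Proof. by move=> hf hg; exact: (is_derive1_comp (f := f) (g := g)). Qed.

Lemma dv_sum (I : Type) (r : seq I) (P : pred I) (F dF : I -> R -> R) t :
  (forall i, is_derive t 1 (F i) (dF i t)) ->
  is_derive t 1 (fun s => \sum_(i <- r | P i) F i s)
    (\sum_(i <- r | P i) dF i t).
Proof.
move=> h; elim: r => [|i r IH].
  rewrite (_ : (fun _ => _) = fun=> 0); last by apply/funext => s; rewrite big_nil.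
  by rewrite big_nil; exact: dv_cst.
rewrite (_ : (fun _ => _) = if P i
    then (fun s => F i s + \sum_(j <- r | P j) F j s)
    else (fun s => \sum_(j <- r | P j) F j s)); last first.
  by apply/funext => s; rewrite big_cons; case: ifP.
by rewrite big_cons; case: ifP => // _; exact: dvD.
Qed.

Lemma dv_exp f t (df : R) : is_derive t 1 f df ->
  is_derive t 1 (fun s => expR (f s)) (expR (f t) * df).
Proof. by move=> hf; apply: (dv_comp (f := expR)). Qed.

Lemma dv_ln f t (df : R) : 0 < f t -> is_derive t 1 f df ->
  is_derive t 1 (fun s => ln (f s)) (df / f t).
Proof.
move=> f0 hf; rewrite [_ / _]mulrC.
by apply: (dv_comp (f := @ln R)) => //; exact: is_derive1_ln.
Qed.

Lemma dv_powR f p t (df : R) : 0 < f t -> is_derive t 1 f df ->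
  is_derive t 1 (fun s => f s `^ p) (p * f t `^ (p - 1) * df).
Proof.
move=> f0 hf.
by apply: (dv_comp (f := fun x => x `^ p)) => //; exact: is_derive1_powR.
Qed.

Lemma dv_powRvar f p t (df dp : R) : 0 < f t ->
  is_derive t 1 f df -> is_derive t 1 p dp ->
  (\forall s \near t, 0 < f s) ->
  is_derive t 1 (fun s => f s `^ p s)
    (f t `^ p t * (dp * ln (f t) + p t * (df / f t))).
Proof.
move=> f0 hf hp nf.
apply: (@near_eq_is_derive _ _ _ (fun s => expR (p s * ln (f s)))).
  by near=> s; rewrite /powR gt_eqF//; near: s.
rewrite {1}/powR gt_eqF//; apply: dv_exp; apply: dvM => //.
exact: dv_ln.
Unshelve. all: by end_near. Qed.

Lemma dv_inv f t (df : R) : f t != 0 -> is_derive t 1 f df ->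
  is_derive t 1 (fun s => (f s)^-1) (- (f t ^- 2) * df).
Proof.
by move=> f0 hf; exact: (@is_deriveV _ f t df 1 f0 hf).
Qed.

Lemma dv_ext f g t (df dg : R) : (forall s, f s = g s) -> df = dg ->
  is_derive t 1 f df -> is_derive t 1 g dg.
Proof. by move=> /funext -> ->. Qed.

Lemma dvX f n t (df : R) : is_derive t 1 f df ->
  is_derive t 1 (fun s => f s ^+ n.+1) (n.+1%:R * f t ^+ n * df).
Proof.
move=> hf; elim: n => [|n IH].
  by apply: (dv_ext _ _ hf) => [s|]; rewrite ?expr1// expr0; ring.
apply: (dv_ext _ _ (dvM hf IH)) => [s|]; first by rewrite [RHS]exprS.
by rewrite [in RHS]mulrS exprS; ring.
Qed.

Lemma dv_sqr f t (df : R) : is_derive t 1 f df ->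
  is_derive t 1 (fun s => f s ^+ 2) (2 * f t * df).
Proof.
move=> h; apply: (dv_ext _ _ (dvM h h)) => [s|]; first by rewrite expr2.
ring.
Qed.

(** The square of the negative part is C^1, unlike the negative part itself; this is why
    [backward_comparison] works with its energy. At 0 the slope function is x for x < 0 and 0
    otherwise. *)
Lemma dv_min0_sqr t :
  is_derive t 1 (fun x : R => Num.min x 0 ^+ 2) (2 * Num.min t 0).
Proof.
have [t0|t0|->] := ltgtP t 0.
- apply: (@near_eq_is_derive R R R (fun x : R => x ^+ 2)).
    near=> s; rewrite min_l//; apply/ltW; near: s; exact: lt_nbhsl.
  by apply: (dv_ext _ _ (dv_sqr (dv_id t))) => //; rewrite mulr1.
- rewrite mulr0.
  apply: (@near_eq_is_derive R R R (fun=> 0)).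
  near=> s; rewrite min_r ?expr0n//; apply/ltW; near: s; exact: lt_nbhsr.
rewrite mulr0; apply: (@is_derive1_caratheodory R _ 0 0).2.
exists (fun x => if x < 0 then x else 0); split=> //=.
- move=> x; rewrite minxx expr0n/= !subr0.
  by case: ltP => x0; [rewrite expr2|rewrite expr0n mul0r].
- apply/cvgrPdist_le => e e0; near=> x; rewrite ltxx sub0r normrN.
  have: `|x| < e by near: x; exact: (@cvgr0_norm_lt R R R (nbhs 0) _ id _ e e0).
  by case: ifP; rewrite ?normr0 => *; rewrite ltW.
- by rewrite ltxx.
Unshelve. all: by end_near. Qed.

Lemma dv_derivable f t (df : R) : is_derive t 1 f df -> derivable f t 1.
Proof. by case. Qed.

Lemma dv_derive1 f t (df : R) : is_derive t 1 f df -> derive1 f t = df.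
Proof. by move=> h; rewrite derive1E; case: h. Qed.

Lemma le_of_derive_ge0 f (df : R -> R) (a b : R) : a <= b ->
  (forall t, a <= t <= b -> is_derive t 1 f (df t)) ->
  (forall t, a < t < b -> 0 <= df t) -> f a <= f b.
Proof.
move=> ab hf h0; apply: (@ger0_derive1_ndecr R f a b) => //.
- move=> x; rewrite in_itv/= => /andP[ax xb].
  by have [] := hf x _; rewrite ?(ltW ax) ?(ltW xb).
- move=> x; rewrite in_itv/= => /andP[ax xb].
  by rewrite (dv_derive1 (hf x _)) ?h0 ?(ltW ax) ?(ltW xb) ?ax.
- apply: derivable_within_continuous => x; rewrite in_itv/= => axb.
  exact: dv_derivable (hf x axb).
Qed.

Lemma le_of_derive_le f g (df dg : R -> R) (a b : R) : a <= b ->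
  (forall t, a <= t <= b -> is_derive t 1 f (df t)) ->
  (forall t, a <= t <= b -> is_derive t 1 g (dg t)) ->
  (forall t, a < t < b -> df t <= dg t) -> f b - f a <= g b - g a.
Proof.
move=> ab hf hg h.
have := @le_of_derive_ge0 (fun t => g t - f t) (fun t => dg t - df t) a b ab.
rewrite lerBlDr lerBrDr -lerBlDr => H.
suff: g a - f a <= g b - f b by move=> ?; lra.
by apply: H => t tab; [apply: dvB; auto | rewrite subr_ge0; exact: h].
Qed.

Lemma norm_diff_le_of_derive f g (df dg : R -> R) (a b : R) : a <= b ->
  (forall t, a <= t <= b -> is_derive t 1 f (df t)) ->
  (forall t, a <= t <= b -> is_derive t 1 g (dg t)) ->
  (forall t, a < t < b -> `|df t| <= dg t) -> `|f b - f a| <= g b - g a.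
Proof.
move=> ab hf hg h; rewrite ler_norml; apply/andP; split; last first.
  by apply: (le_of_derive_le ab hf hg) => t /h; rewrite ler_norml => /andP[].
have := @le_of_derive_le (fun t => - f t) g (fun t => - df t) dg a b ab.
move=> H.
have {}H : - f b - - f a <= g b - g a.
  apply: H => // t; first by move=> /hf /dvN.
  by move=> /h; rewrite ler_norml => /andP[? ?]; rewrite lerNl.
lra.
Qed.

Lemma gronwall f (df : R -> R) c (a b : R) : a <= b ->
  (forall t, a <= t <= b -> is_derive t 1 f (df t)) ->
  (forall t, a < t < b -> df t <= c * f t) ->
  f b <= expR (c * (b - a)) * f a.
Proof.
move=> ab hf h.
have H (t : R) : a <= t <= b -> is_derive t 1
    (fun t => - (expR (- c * (t - a)) * f t))
    (expR (- c * (t - a)) * (c * f t - df t)).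
  move=> /hf ht.
  have h1 : is_derive t 1 (fun t => - c * (t - a)) (- c).
    apply: (dv_ext _ _ (dvZ (- c) (dvB (dv_id t) (dv_cst a t)))) => //.
    by rewrite subr0 mulr1.
  apply: (dv_ext _ _ (dvN (dvM (dv_exp h1) ht))) => //; lra.
have := le_of_derive_ge0 ab H; rewrite subrr mulr0 expR0 mul1r lerN2 => {}H.
rewrite -[leLHS]mul1r -expR0 -(subrr (c * (b - a))) expRD -mulrA.
rewrite ler_pM2l ?expR_gt0// -mulNr; apply: H => t tab.
by rewrite mulr_ge0 ?expR_ge0// subr_ge0 h.
Qed.

(** Reflection t |-> - t of [gronwall]. *)
Lemma gronwall_backward f (df : R -> R) c (a b : R) : a <= b ->
  (forall t, a <= t <= b -> is_derive t 1 f (df t)) ->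
  (forall t, a < t < b -> - df t <= c * f t) ->
  f a <= expR (c * (b - a)) * f b.
Proof.
move=> ab hf h.
have := @gronwall (fun t => f (- t)) (fun t => - df (- t)) c (- b) (- a).
rewrite lerN2 !opprK [- a + b]addrC => H; apply: H => // t.
  move=> /andP[t1 t2].
  have ht : is_derive (- t) 1 f (df (- t)) by apply: hf; apply/andP; split; lra.
  by apply: (dv_ext _ _ (dv_comp ht (dvN (dv_id t)))); rewrite ?mulrN1.
by move=> /andP[t1 t2]; apply: h; apply/andP; split; lra.
Qed.

End DerivativeRules.

Lemma expR_lip (R : realType) (a b M : R) : expR a <= M -> expR b <= M ->
  `|expR a - expR b| <= M * `|a - b|.
Proof.
move=> aM bM; wlog ab : a b aM bM / b <= a.
  move=> H; have [/H|/ltW /H] := leP b a; first exact.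
  by rewrite distrC [`|a - b|]distrC; apply.
rewrite !ger0_norm ?subr_ge0 ?ler_expR//.
apply: (@le_trans _ _ (expR a * (a - b))); last by rewrite ler_wpM2r ?subr_ge0.
have := @expR_ge1Dx R (b - a); rewrite expRD expRN ler_pdivlMr ?expR_gt0//; lra.
Qed.

Section Primitive.
Variable R : realType.
Implicit Types (f : R -> R).
Local Notation leb := (@lebesgue_measure R).

Lemma continuous_integrable_itv f (a b : R) : continuous f ->
  leb.-integrable `[a, b] (EFin \o f).
Proof.
move=> cf; apply: continuous_compact_integrable; first exact: segment_compact.
exact: continuous_subspaceT.
Qed.

(** Integration starts at -1 and is recentred at 0, so that 0 is an interior point and the
    derivative there is two-sided. *)
Definition primitive f (t : R) : R :=
  \int[leb]_(s in `[-1, t]) f s - \int[leb]_(s in `[-1, 0]) f s.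

Lemma dv_primitive f (t : R) : continuous f -> -1 < t ->
  is_derive t 1 (primitive f) (f t).
Proof.
move=> cf t1.
have [d1 d2] := @continuous_FTC1_closed R f (-1) t (t + 1)
  ltac:(lra) (@continuous_integrable_itv f (-1) (t + 1) cf) t1 (cf t).
have hd : is_derive t 1 (fun t => \int[leb]_(s in `[-1, t]) f s) (f t).
  by apply: DeriveDef d1 _; rewrite -derive1E.
have := dvB hd (dv_cst (\int[leb]_(s in `[-1, 0]) f s) t).
by rewrite subr0.
Qed.

Lemma primitive0 f : primitive f 0 = 0.
Proof. by rewrite /primitive subrr. Qed.

Lemma Rintegral_split f (a b c : R) : a <= b -> b <= c -> continuous f ->
  \int[leb]_(s in `[a, c]) f s =
  \int[leb]_(s in `[a, b]) f s + \int[leb]_(s in `[b, c]) f s.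
Proof.
move=> ab bc cf.
have H := @Rintegral_itvB R f (BLeft a) (BRight c) b.
have -> : \int[leb]_(s in `[b, c]) f s = \int[leb]_(s in `]b, c]) f s.
  rewrite Rintegral_itv_obnd_cbnd//.
  apply: (integrableS _ _ _ (continuous_integrable_itv b c cf)) => //.
  exact: subset_itv_oc_cc.
rewrite -H ?bnd_simp//; first by rewrite addrC subrK.
exact: continuous_integrable_itv.
Qed.

Lemma primitiveE f (t : R) : continuous f -> 0 <= t ->
  primitive f t = \int[leb]_(s in `[0, t]) f s.
Proof.
move=> cf t0; rewrite /primitive (@Rintegral_split f (-1) 0 t) ?lerN10//.
by rewrite addrC addKr.
Qed.

End Primitive.

(** * Linear differential equations *)

Section ContinuousBound.
Variable R : realType.
Implicit Types f g : R -> R.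

Lemma cont_cst (c : R) : continuous (fun _ : R => c).
Proof. by move=> s; exact: cst_continuous. Qed.

Lemma cont_id : continuous (fun s : R => s).
Proof. by move=> s; exact: cvg_id. Qed.

Lemma contD f g : continuous f -> continuous g -> continuous (fun s => f s + g s).
Proof. by move=> cf cg s; exact: (@continuousD R R R f g s (cf s) (cg s)). Qed.

Lemma contB f g : continuous f -> continuous g -> continuous (fun s => f s - g s).
Proof. by move=> cf cg s; exact: (@continuousB R R R f g s (cf s) (cg s)). Qed.

Lemma contM f g : continuous f -> continuous g -> continuous (fun s => f s * g s).
Proof. by move=> cf cg s; exact: (@continuousM R R f g s (cf s) (cg s)). Qed.

Lemma cont_norm f : continuous f -> continuous (fun s => `|f s|).
Proof.
by move=> cf s; apply: (continuous_comp (cf s)); exact: norm_continuous.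
Qed.

Lemma cont_max f g : continuous f -> continuous g ->
  continuous (fun s => Num.max (f s) (g s)).
Proof. by move=> cf cg s; exact: (@continuous_max R R f g s (cf s) (cg s)). Qed.

Lemma cont_comp f g : continuous f -> continuous g -> continuous (fun s => f (g s)).
Proof.
by move=> cf cg s; apply: (@continuous_comp _ _ _ g f); [exact: cg|exact: cf].
Qed.

Lemma continuous_bounded_itv (f : R -> R) (a b : R) : continuous f ->
  exists2 C : R, 0 <= C & forall t : R, a <= t <= b -> `|f t| <= C.
Proof.
move=> cf; have [ab|ba] := leP a b; last first.
  by exists 0 => // t /andP[h1 h2]; have := le_trans h1 h2; rewrite leNgt ba.
have cnf : {within `[a, b], continuous (fun t => `|f t|)}.
  apply: continuous_subspaceT => t.
  by apply: (continuous_comp (cf t)); exact: norm_continuous.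
have [c _ cmax] := EVT_max ab cnf.
by exists `|f c| => // t tab; apply: cmax; rewrite in_itv.
Qed.

Lemma continuous_sum (I : Type) (r : seq I) (P : pred I) (F : I -> R -> R) t :
  (forall i, {for t, continuous (F i)}) ->
  {for t, continuous (fun s => \sum_(i <- r | P i) F i s)}.
Proof.
move=> cF; elim: r => [|i r IH].
  rewrite (_ : (fun _ => _) = fun=> 0); first exact: cst_continuous.
  by apply/funext => s; rewrite big_nil.
rewrite (_ : (fun _ => _) = if P i
    then (fun s => F i s + \sum_(j <- r | P j) F j s)
    else (fun s => \sum_(j <- r | P j) F j s)); last first.
  by apply/funext => s; rewrite big_cons; case: ifP.
by case: ifP => // _; apply: continuousD => //; exact: cF.
Qed.

Lemma cont_sum (I : Type) (r : seq I) (P : pred I) (F : I -> R -> R) :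
  (forall i, continuous (F i)) ->
  continuous (fun s => \sum_(i <- r | P i) F i s).
Proof. by move=> cF s; apply: continuous_sum => i; exact: cF. Qed.

(** Weierstrass test with remainder: telescoping bounds u m - u n by a block of the dominating
    series, and the bound passes to the limit in m. *)
Lemma series_dominated_cvg (u b : R^nat) :
  (forall n, `|u n.+1 - u n| <= b n) -> cvgn (series b) ->
  u @ \oo --> limn u /\
  forall n, `|limn u - u n| <= limn (series b) - series b n.
Proof.
move=> ub cb.
have b0 n : 0 <= b n by apply: le_trans (ub n).
have uE n : u n = u 0%N + series (fun k => u k.+1 - u k) n.
  rewrite /series /= telescope_sumr//; first by rewrite addrC subrK.
have cu : cvgn u.
  rewrite (_ : u = fun n => u 0%N + series (fun k => u k.+1 - u k) n).
    apply: is_cvgD; first exact: is_cvg_cst.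
    apply: normed_cvg; apply: (series_le_cvg _ _ ub cb) => n //.
  by apply/funext => n; rewrite -uE.
split=> // n.
have nd : nondecreasing_seq (series b).
  by apply/nondecreasing_seqP => k; rewrite /series /= big_nat_recr//= lerDl.
have mn m : (n <= m)%N -> `|u m - u n| <= limn (series b) - series b n.
  move=> nm; apply: (@le_trans _ _ (series b m - series b n)); last first.
    by rewrite lerB//; exact: nondecreasing_cvgn_le.
  rewrite -(subnK nm) addnC; elim: (m - n)%N => [|k IH].
    by rewrite addn0 !subrr normr0.
  rewrite addnS /series /= big_nat_recr//= -/(series b (n + k)).
  rewrite (_ : u (n + k).+1 - u n =
    (u (n + k).+1 - u (n + k)%N) + (u (n + k)%N - u n)); last by ring.
  rewrite [leRHS](_ : _ = b (n + k)%N + (series b (n + k)%N - series b n)).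
    by rewrite (le_trans (ler_normD _ _))// lerD.
  by rewrite /series /=; ring.
have h : `|u m - u n| @[m --> \oo] --> `|limn u - u n|.
  by apply: cvg_norm; apply: cvgB => //; exact: cvg_cst.
apply: (ler_cvg_to h (cvg_cst _)); exists n => // m /= nm; exact: mn.
Qed.

End ContinuousBound.

(** * Existence of solutions by Picard iteration *)

Section LinearODE.
Variables (R : realType) (S : finType) (A : R -> S -> S -> R).
Hypothesis A_cont : forall x z, continuous (fun s => A s x z).
Variables (y0 : S -> R) (T : R).
Hypothesis T_ge0 : 0 <= T.

(** Candidate solutions are controlled on [0, T] only. Freezing time outside this interval makes the
    right-hand side continuous on R, and its primitive is then differentiable on both sides at 0 and
    T. *)
Definition clamp (s : R) : R := Num.min (Num.max s 0) T.

Lemma clamp_itv (s : R) : 0 <= clamp s <= T.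
Proof.
by rewrite /clamp le_min ge_min T_ge0 le_max !lexx !orbT.
Qed.

Lemma clamp_id (s : R) : 0 <= s <= T -> clamp s = s.
Proof. by rewrite /clamp => /andP[s0 sT]; rewrite max_l// min_l. Qed.

Lemma clamp_continuous : continuous clamp.
Proof.
move=> s; apply: (@continuous_min R R (fun s => Num.max s 0) (fun=> T)) => //.
  by apply: (@continuous_max R R id (fun=> 0)) => //; exact: cst_continuous.
exact: cst_continuous.
Qed.

Definition ode_rhs (Y : R -> S -> R) (x : S) (s : R) : R :=
  \sum_z A (clamp s) x z * Y (clamp s) z.

Definition picard_map (Y : R -> S -> R) (t : R) (x : S) : R :=
  y0 x + primitive (ode_rhs Y x) t.

Definition clamp_cont (Y : R -> S -> R) :=
  forall x, continuous (fun s => Y (clamp s) x).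

Lemma ode_rhs_continuous Y x : clamp_cont Y -> continuous (ode_rhs Y x).
Proof.
move=> cY s; apply: continuous_sum => z; apply: continuousM; last exact: cY.
apply: (@continuous_comp _ _ _ clamp (fun s => A s x z)).
  exact: clamp_continuous.
exact: A_cont.
Qed.

Lemma dv_picard Y (x : S) (t : R) : clamp_cont Y -> -1 < t ->
  is_derive t 1 (fun s => picard_map Y s x) (ode_rhs Y x t).
Proof.
move=> cY t1; rewrite -[ode_rhs _ _ _]add0r; exact: (dvD (dv_cst (y0 x) t) (dv_primitive (ode_rhs_continuous cY) t1)).
Qed.

Lemma picard_cont Y : clamp_cont Y -> clamp_cont (picard_map Y).
Proof.
move=> cY x s; apply: (@continuous_comp _ _ _ clamp (fun s => picard_map Y s x)).
  exact: clamp_continuous.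
apply: (is_derive_continuous (dv_picard x cY _)).
by have /andP[h _] := clamp_itv s; lra.
Qed.

Lemma picard0 Y x : picard_map Y 0 x = y0 x.
Proof. by rewrite /picard_map primitive0 addr0. Qed.

(** C bounds the row sums of |A|, so inputs at distance [db] have images whose difference grows at
    rate at most C db. The primitive b is left to the caller: a term of the exponential series for
    the iterates, a linear function for their limit. *)
Lemma picard_diff (Y Y' : R -> S -> R) (C t : R) (b db : R -> R) x :
  clamp_cont Y -> clamp_cont Y' -> 0 <= t <= T ->
  (forall s : R, 0 <= s <= T -> forall x, \sum_z `|A s x z| <= C) ->
  (forall s : R, 0 <= s <= t -> forall z, `|Y s z - Y' s z| <= db s) ->
  (forall s : R, 0 <= s <= t -> is_derive s 1 b (C * db s)) ->
  `|picard_map Y t x - picard_map Y' t x| <= b t - b 0.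
Proof.
move=> cY cY' /andP[t0 tT] hC hY hb.
have d1 s : 0 <= s <= t -> is_derive s 1
    (fun s => picard_map Y s x - picard_map Y' s x)
    (ode_rhs Y x s - ode_rhs Y' x s).
  by move=> /andP[s0 _]; apply: dvB; apply: dv_picard => //; lra.
have := norm_diff_le_of_derive t0 d1 hb.
rewrite !picard0 subrr subr0; apply => s /andP[s0 st].
have sT : 0 <= s <= T by apply/andP; split; lra.
have st' : 0 <= s <= t by apply/andP; split; lra.
rewrite /ode_rhs clamp_id// -sumrB.
apply: (le_trans (ler_norm_sum _ _ _)).
have db0 : 0 <= db s by apply: le_trans (hY s st' x).
apply: (@le_trans _ _ (\sum_z `|A s x z| * db s)).
  apply: ler_sum => z _; rewrite -mulrBr normrM ler_wpM2l//; exact: hY.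
by rewrite -mulr_suml ler_wpM2r// hC.
Qed.

Definition picard_iter (n : nat) : R -> S -> R := iter n picard_map (fun=> y0).

Lemma picard_iter_cont n : clamp_cont (picard_iter n).
Proof.
elim: n => [x s|n IH]; first exact: cst_continuous.
exact: picard_cont.
Qed.

Lemma linear_ode_exists : exists2 y : R -> S -> R, y 0 = y0 &
  forall (t : R) x, 0 <= t <= T ->
    is_derive t 1 (fun s => y s x) (\sum_z A t x z * y t z).
Proof.
have [C C0 hC] : exists2 C : R, 0 <= C &
    forall s : R, 0 <= s <= T -> forall x, \sum_z `|A s x z| <= C.
  have c : continuous (fun s => \sum_x \sum_z `|A s x z|).
    move=> s; apply: continuous_sum => x; apply: continuous_sum => z.
    by apply: (continuous_comp (@A_cont x z s)); exact: norm_continuous.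
  have [C C0 hC] := continuous_bounded_itv 0 T c.
  exists C => // s /hC; rewrite ger0_norm; last first.
    by apply: sumr_ge0 => x _; apply: sumr_ge0.
  move=> h x; apply: le_trans h.
  by rewrite [leRHS](bigD1 x)//= lerDl; apply: sumr_ge0 => *; apply: sumr_ge0.
pose M : R := \sum_x `|y0 x|.
have M0 : 0 <= M by apply: sumr_ge0.
(* Terms of the exponential series, related by b_(n+1)' = C b_n; they dominate the successive
   differences of the iterates. *)
pose b (n : nat) (t : R) : R := M * ((C * t) ^+ n / n`!%:R).
have db n (t : R) : is_derive t 1 (b n.+1) (C * b n t).
  have h : is_derive t 1 (fun t : R => (C * t) ^+ n.+1)
      (n.+1%:R * (C * t) ^+ n * C).
    have h1 := dvZ C (dv_id t); rewrite mulr1 in h1.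
    exact: dvX.
  apply: (dv_ext _ _ (dvZ (M / (n.+1)`!%:R) h)).
    by move=> s; rewrite /b; field; rewrite pnatr_eq0 -lt0n fact_gt0.
  rewrite /b factS natrM; field.
  by rewrite pnatr_eq0 -lt0n fact_gt0 nat1r pnatr_eq0.
have iterb n (t : R) x : 0 <= t <= T ->
    `|picard_iter n.+1 t x - picard_iter n t x| <= b n.+1 t.
  elim: n t x => [|n IH] t x tT.
    have := @norm_diff_le_of_derive R (fun s => picard_iter 1 s x) (b 1%N)
      (ode_rhs (fun=> y0) x) (fun s => C * b 0%N s) 0 t.
    rewrite /= picard0 [b 1%N 0]/b mulr0 expr0n/= mul0r mulr0 subr0; apply.
    - by case/andP: tT.
    - move=> s /andP[s0 _].
      by apply: (@dv_picard (fun=> y0) x s (@picard_iter_cont 0)); lra.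
    - move=> s /andP[s0 st]; rewrite /ode_rhs.
      apply: (le_trans (ler_norm_sum _ _ _)).
      apply: (@le_trans _ _ (\sum_z `|A (clamp s) x z| * M)).
        apply: ler_sum => z _; rewrite normrM ler_wpM2l//.
        by rewrite /M (bigD1 z)//= lerDl sumr_ge0.
      rewrite -mulr_suml /b expr0 fact0 divr1 mulr1 ler_wpM2r//.
      exact/hC/clamp_itv.
  have := @picard_diff (picard_iter n.+1) (picard_iter n) C t (b n.+2) (b n.+1) x
    (@picard_iter_cont n.+1) (@picard_iter_cont n) tT hC.
  rewrite [b _ 0]/b mulr0 expr0n/= mul0r mulr0 subr0; apply => // s /andP[s0 st] z; apply: IH.
  by apply/andP; split=> //; case/andP: tT => _; exact: le_trans.
have cb : cvgn (series (fun n => b n.+1 T)).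
  have h := is_cvg_series_exp_coeff (C * T).
  have {}h := is_cvg_seriesZ (k := M * (C * T)) h.
  apply: series_le_cvg h => n; rewrite /b /=.
  - by rewrite mulr_ge0 ?divr_ge0 ?exprn_ge0 ?mulr_ge0.
  - by rewrite mulr_ge0 ?divr_ge0 ?exprn_ge0 ?mulr_ge0.
  - rewrite /GRing.scale /= /exp_coeff /= exprS -[leRHS]mulrA ler_wpM2l//.
    rewrite -mulrA ler_wpM2l ?mulr_ge0// ler_wpM2l ?exprn_ge0 ?mulr_ge0//.
    by rewrite lef_pV2 ?posrE ?ltr0n ?fact_gt0// ler_nat factS leq_pmull.
pose e (n : nat) : R := limn (series (fun n => b n.+1 T)) - series (fun n => b n.+1 T) n.
have e0 : e n @[n --> \oo] --> 0.
  by rewrite -(subrr (limn (series (fun n => b n.+1 T)))); apply: cvgB => //; exact: cvg_cst.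
have ub (t : R) x : 0 <= t <= T -> forall n,
    `|picard_iter n.+1 t x - picard_iter n t x| <= b n.+1 T.
  move=> /andP[t0 tT] n; apply: (le_trans (iterb n t x _)); first exact/andP.
  rewrite /b ler_wpM2l// ler_wpM2r ?invr_ge0//.
  by rewrite lerXn2r ?nnegrE ?mulr_ge0 ?ler_wpM2l.
pose y (t : R) (x : S) : R := limn (fun n => picard_iter n t x).
have ye (t : R) x : 0 <= t <= T -> forall n, `|y t x - picard_iter n t x| <= e n.
  by move=> tT; have [_] := series_dominated_cvg (ub t x tT) cb.
(* A uniform limit of continuous functions is continuous, by three errors of size d / 3. *)
have cy : clamp_cont y.
  move=> x s; apply/cvgrPdist_lt => d d0.
  have [n en] : exists n, e n < d / 3.
    have d3 : 0 < d / 3 by rewrite divr_gt0.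
    have /cvgrPdist_lt /(_ _ d3) [n _ hn] := e0.
    by exists n; have := hn n (leqnn n); rewrite sub0r normrN => /(le_lt_trans (ler_norm _)).
  have d3 : 0 < d / 3 by rewrite divr_gt0.
  have /cvgrPdist_lt /(_ _ d3) := @picard_iter_cont n x s.
  apply: filterS => r hr.
  have h1 := ye (clamp s) x (clamp_itv s) n.
  have h2 := ye (clamp r) x (clamp_itv r) n.
  have -> : y (clamp s) x - y (clamp r) x =
    (y (clamp s) x - picard_iter n (clamp s) x) +
    (picard_iter n (clamp s) x - picard_iter n (clamp r) x) +
    - (y (clamp r) x - picard_iter n (clamp r) x) by ring.
  apply: (le_lt_trans (ler_normD _ _)); rewrite normrN.
  have := ler_normD (y (clamp s) x - picard_iter n (clamp s) x)
    (picard_iter n (clamp s) x - picard_iter n (clamp r) x).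
  move: hr h1 h2 en => /=; lra.
have zy (t : R) x : 0 <= t <= T -> picard_map y t x = y t x.
  move=> tT; apply/eqP; rewrite -subr_eq0 -normr_le0.
  have h : C * e n * T + e n.+1 @[n --> \oo] --> C * 0 * T + 0.
    apply: cvgD; last by rewrite (cvg_shiftS e).
    by apply: cvgM; [apply: cvgM => //|]; exact: cvg_cst.
  rewrite mulr0 mul0r addr0 in h.
  apply: (ler_cvg_to (cvg_cst _) h); near=> n.
  rewrite (_ : picard_map y t x - y t x =
    (picard_map y t x - picard_iter n.+1 t x) +
    (picard_iter n.+1 t x - y t x)); last by ring.
  apply: (le_trans (ler_normD _ _)); apply: lerD; last by rewrite distrC ye.
  have := @picard_diff y (picard_iter n) C t (fun s => C * e n * s) (fun=> e n) x
    cy (@picard_iter_cont n) tT hC.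
  rewrite mulr0 subr0 => H; apply: (@le_trans _ _ (C * e n * t)).
    apply: H => s; last by move=> _; rewrite -[X in is_derive _ _ _ X]mulr1; exact: dvZ (dv_id s).
    move=> /andP[s0 st] z; apply: ye; apply/andP; split=> //.
    by case/andP: tT => _; exact: le_trans.
  rewrite ler_wpM2l//; last by case/andP: tT.
  by rewrite mulr_ge0//; apply: le_trans (ye t x tT n).
(* [y] is a limit under control on [0, T] only; [picard_map y] equals it there and is differentiable
   on both sides at the endpoints. *)
exists (picard_map y); first by apply/funext => x; exact: picard0.
move=> t x tT; have /andP[t0 _] := tT.
rewrite (_ : \sum_z _ = ode_rhs y x t); first by apply: dv_picard => //; lra.
by rewrite /ode_rhs clamp_id//; apply: eq_bigr => z _; rewrite zy.
Unshelve. all: by end_near. Qed.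

End LinearODE.

(** * Norms on a finite probability space *)

Section PowerContinuity.
Variable R : realType.

Lemma continuous_norm_powR (q : R) : 0 < q ->
  continuous (fun x : R => `|x| `^ q).
Proof.
move=> q0 x; have [->|x0] := eqVneq x 0.
  rewrite /continuous_at normr0 powR0 ?gt_eqF//.
  apply/cvgrPdist_lt => e e0; near=> y.
  rewrite sub0r normrN ger0_norm ?powR_ge0//.
  rewrite -[ltRHS]powRr1 ?ltW// -(mulVf (lt0r_neq0 q0)) powRrM.
  rewrite gt0_ltr_powR ?nnegrE ?powR_ge0//.
  near: y; exact: (@cvgr0_norm_lt R R R (nbhs 0) _ id _ _ (powR_gt0 _ e0)).
apply: (@continuous_comp _ _ _ (fun y : R => `|y|) (fun y : R => y `^ q)).
  exact: norm_continuous.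
by apply: is_derive_continuous; apply: is_derive1_powR; rewrite normr_gt0.
Unshelve. all: by end_near. Qed.

(** Young's inequality for x / a and y / b. With the two norms for a and b, summation yields
    Hoelder's inequality with constant 1/p + 1/q = 1. *)
Lemma young_scaled (p q a b x y : R) : 0 < p -> 0 < q -> p^-1 + q^-1 = 1 ->
  0 < a -> 0 < b -> 0 <= x -> 0 <= y ->
  x * y <= a * b * ((a `^ p)^-1 / p * x `^ p + (b `^ q)^-1 / q * y `^ q).
Proof.
move=> p0 q0 pq a0 b0 x0 y0.
have pV (c s : R) : 0 < c -> c^-1 `^ s = (c `^ s)^-1.
  by move=> c0; rewrite -[in LHS]powR_inv1 ?(ltW c0)// -powRrM mulN1r powRN.
have := @conjugate_powR R (x / a) (y / b) p q (divr_ge0 x0 (ltW a0))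
  (divr_ge0 y0 (ltW b0)) p0 q0 pq.
rewrite powRM ?invr_ge0 ?(ltW a0)// [X in _ + X / _]powRM ?invr_ge0 ?(ltW b0)//.
rewrite !pV// => h.
rewrite -ler_pdivrMl ?mulr_gt0//.
rewrite [leLHS](_ : _ = x / a * (y / b)); last first.
  by field; rewrite !gt_eqF.
apply: (le_trans h); rewrite le_eqVlt; apply/orP; left; apply/eqP; ring.
Qed.

(* Cauchy-Schwarz for the integral of t^(p/2-1) over [y, x] is obtained without
   integration: t |-> tau^2 t + p^2/(4(p-1)) t^(p-1) - 2 tau t^(p/2) is
   nondecreasing for every tau, since its derivative is a square. *)
Lemma stroock_varopoulos (p x y : R) : 1 < p -> 0 < x -> 0 < y ->
  4 * (p - 1) / p ^+ 2 * (x `^ (p / 2) - y `^ (p / 2)) ^+ 2 <=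
  (x `^ (p - 1) - y `^ (p - 1)) * (x - y).
Proof.
move=> p1; wlog yx : x y / y <= x.
  move=> h x0 y0; have [yx|xy] := leP y x; first exact: h.
  have := h y x (ltW xy) y0 x0; rewrite -(opprB (y `^ (p / 2))) sqrrN.
  by rewrite -(opprB y) -(opprB (y `^ (p - 1))) mulrNN.
move=> x0 y0; have p0 : 0 < p by lra.
have [->|xy] := eqVneq x y; first by rewrite !subrr expr0n/= !mulr0.
have {}yx : 0 < x - y by rewrite subr_gt0 lt_neqAle eq_sym xy.
(* The mean slope of t^(p/2) is the best choice of tau; k is the inverse of the constant in the
   statement. *)
pose tau := (x `^ (p / 2) - y `^ (p / 2)) / (x - y).
pose k := p ^+ 2 / (4 * (p - 1)).
have := @le_of_derive_ge0 R
  (fun t => tau ^+ 2 * t + k * t `^ (p - 1) - 2 * tau * t `^ (p / 2))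
  (fun t => tau ^+ 2 * 1 + k * ((p - 1) * t `^ (p - 1 - 1) * 1)
     - 2 * tau * (p / 2 * t `^ (p / 2 - 1) * 1)) y x.
have tauE : x `^ (p / 2) - y `^ (p / 2) = tau * (x - y).
  by rewrite /tau divfK ?gt_eqF.
have H : forall a b : R, tau ^+ 2 * y + k * b - 2 * tau * y `^ (p / 2) <=
   tau ^+ 2 * x + k * a - 2 * tau * x `^ (p / 2) ->
   tau ^+ 2 * (x - y) <= k * (a - b).
  move=> a b h.
  have : 2 * tau * (x `^ (p / 2) - y `^ (p / 2)) = 2 * tau ^+ 2 * (x - y).
    by rewrite tauE; ring.
  move: h; lra.
move=> h; have {h}/H : tau ^+ 2 * y + k * y `^ (p - 1) - 2 * tau * y `^ (p / 2)
   <= tau ^+ 2 * x + k * x `^ (p - 1) - 2 * tau * x `^ (p / 2).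
  apply: h; first lra.
    move=> t /andP[yt tx]; have t0 : 0 < t by exact: lt_le_trans yt.
    exact: (dvB (dvD (dvZ (tau ^+ 2) (dv_id t))
      (dvZ k (dv_powR (p - 1) (f := id) t0 (dv_id t))))
      (dvZ (2 * tau) (dv_powR (p / 2) (f := id) t0 (dv_id t)))).
  move=> t /andP[yt tx]; have t0 : 0 < t by exact: lt_trans yt.
  have -> : t `^ (p - 1 - 1) = t `^ (p / 2 - 1) ^+ 2.
    rewrite -powR_mulrn ?powR_ge0// -powRrM; congr (_ `^ _); lra.
  rewrite (_ : _ - _ = (tau - p / 2 * t `^ (p / 2 - 1)) ^+ 2) ?sqr_ge0//.
  rewrite /k; field; lra.
rewrite tauE => h; clearbody tau; rewrite exprMn.
have -> : 4 * (p - 1) / p ^+ 2 * (tau ^+ 2 * (x - y) ^+ 2) =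
   k^-1 * (tau ^+ 2 * (x - y)) * (x - y).
  rewrite /k; field; lra.
have k0 : 0 < k by rewrite /k divr_gt0 ?exprn_gt0// mulr_gt0//; lra.
by rewrite ler_wpM2r ?(ltW yx)// ler_pdivrMl.
Qed.

End PowerContinuity.

(** * Norms and Hoelder inequalities for a positive probability *)

Section FiniteLp.
Variables (R : realType) (S : finType) (nu : S -> R).
Hypothesis nu_prob : strictly_positive_probability nu.
Implicit Types (f g : S -> R).

Let nu_gt0 x : 0 < nu x. Proof. by case: nu_prob. Qed.
Let nu_ge0 x : 0 <= nu x. Proof. exact: ltW. Qed.
Let nu_sum : \sum_x nu x = 1. Proof. by case: nu_prob. Qed.

Lemma pairing_ge0 f : (forall x, 0 <= f x) -> 0 <= pairing f nu.
Proof. by move=> f0; apply: sumr_ge0 => x _; rewrite mulr_ge0. Qed.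

Lemma ler_pairing f g : (forall x, f x <= g x) -> pairing f nu <= pairing g nu.
Proof. by move=> fg; apply: ler_sum => x _; rewrite ler_wpM2r. Qed.

Lemma pairing_gt0 f : (forall x, 0 < f x) -> 0 < pairing f nu.
Proof.
move=> f0; rewrite lt_neqAle pairing_ge0 ?andbT; last by move=> x; exact: ltW.
apply/negP => /eqP h; have /psumr_eq0P h' := esym h.
have : \sum_x nu x = 0.
  apply: big1 => x _; have /eqP : f x * nu x = 0.
    by apply: h' => // y _; rewrite mulr_ge0 ?(ltW (f0 y)).
  by rewrite mulf_eq0 !gt_eqF.
by rewrite nu_sum => /eqP; rewrite oner_eq0.
Qed.

Lemma pairing_eq0 f : (forall x, 0 <= f x) -> pairing f nu = 0 -> f = fun=> 0.
Proof.
move=> f0 /psumr_eq0P h; apply/funext => x.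
have /eqP : f x * nu x = 0 by apply: h => // y _; rewrite mulr_ge0.
by rewrite mulf_eq0 (gt_eqF (nu_gt0 x)) orbF => /eqP.
Qed.

Lemma pairing_cst (c : R) : pairing (fun=> c) nu = c.
Proof. by rewrite /pairing -mulr_sumr nu_sum mulr1. Qed.

Lemma pairingD f g : pairing (fun x => f x + g x) nu = pairing f nu + pairing g nu.
Proof. by rewrite /pairing -big_split; apply: eq_bigr => x _; rewrite mulrDl. Qed.

Lemma pairingZ (c : R) f : pairing (fun x => c * f x) nu = c * pairing f nu.
Proof. by rewrite /pairing mulr_sumr; apply: eq_bigr => x _; rewrite mulrA. Qed.

Lemma Lp_norm_ge0 (p : R) f : 0 <= Lp_norm p nu f.
Proof. exact: powR_ge0. Qed.

Let pw (p : R) f := pairing (fun x => `|f x| `^ p) nu.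

Let pw_ge0 p f : 0 <= pw p f.
Proof. by apply: pairing_ge0 => x; exact: powR_ge0. Qed.

Lemma Lp_norm_powR (p : R) f : p != 0 ->
  Lp_norm p nu f `^ p = pairing (fun x => `|f x| `^ p) nu.
Proof. by move=> p0; rewrite /Lp_norm -powRrM mulVf// powRr1//; exact: pw_ge0. Qed.

Lemma Lp_norm_eq0 (p : R) f : Lp_norm p nu f = 0 -> f = fun=> 0.
Proof.
move/powR_eq0_eq0 => h; apply/funext => x.
have /(congr1 (@^~ x)) /= := pairing_eq0 (fun x => powR_ge0 _ _) h.
by move/powR_eq0_eq0/eqP; rewrite normr_eq0 => /eqP.
Qed.

Lemma Lp_norm_le (p : R) f g : 0 < p -> (forall x, `|f x| <= `|g x|) ->
  Lp_norm p nu f <= Lp_norm p nu g.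
Proof.
move=> p0 fg; rewrite /Lp_norm ge0_ler_powR ?invr_ge0 ?nnegrE ?(ltW p0)//.
- exact: pw_ge0.
- exact: pw_ge0.
- by apply: ler_pairing => x; rewrite ge0_ler_powR ?nnegrE ?(ltW p0).
Qed.

Lemma Lp_normZ (p c : R) f : 0 < p ->
  Lp_norm p nu (fun x => c * f x) = `|c| * Lp_norm p nu f.
Proof.
move=> p0; rewrite /Lp_norm.
have -> : pairing (fun x => `|c * f x| `^ p) nu = `|c| `^ p * pw p f.
  by rewrite -pairingZ; congr (pairing _ _); apply/funext => x; rewrite normrM powRM.
rewrite powRM ?powR_ge0 ?pw_ge0// -powRrM mulfV ?gt_eqF// powRr1//.
Qed.

Lemma Lp_norm_cst (p c : R) : 0 < p -> Lp_norm p nu (fun=> c) = `|c|.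
Proof.
by move=> p0; rewrite /Lp_norm pairing_cst -powRrM mulfV ?gt_eqF// powRr1.
Qed.

Lemma finite_hoelder (p q : R) f g : 0 < p -> 0 < q -> p^-1 + q^-1 = 1 ->
  (forall x, 0 <= f x) -> (forall x, 0 <= g x) ->
  pairing (fun x => f x * g x) nu <= Lp_norm p nu f * Lp_norm q nu g.
Proof.
move=> p0 q0 pq f0 g0.
have [fz|fz] := eqVneq (Lp_norm p nu f) 0.
  rewrite fz mul0r (Lp_norm_eq0 fz) (_ : (fun _ => _) = fun=> 0) ?pairing_cst//.
  by apply/funext => x; rewrite mul0r.
have [gz|gz] := eqVneq (Lp_norm q nu g) 0.
  rewrite gz mulr0 (Lp_norm_eq0 gz) (_ : (fun _ => _) = fun=> 0) ?pairing_cst//.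
  by apply/funext => x; rewrite mulr0.
set a := Lp_norm p nu f in fz *; set b := Lp_norm q nu g in gz *.
have a0 : 0 < a by rewrite lt_neqAle eq_sym fz Lp_norm_ge0.
have b0 : 0 < b by rewrite lt_neqAle eq_sym gz Lp_norm_ge0.
have h x : f x * g x <= a * b *
    ((a `^ p)^-1 / p * `|f x| `^ p + (b `^ q)^-1 / q * `|g x| `^ q).
  by rewrite !ger0_norm//; exact: young_scaled.
apply: (le_trans (ler_pairing h)).
rewrite pairingZ pairingD !pairingZ -!Lp_norm_powR ?gt_eqF// -/a -/b.
move: a b a0 b0 {fz gz h} => a b a0 b0.
have -> : a * b * ((a `^ p)^-1 / p * a `^ p + (b `^ q)^-1 / q * b `^ q) =
    a * b * (p^-1 + q^-1) by field; rewrite !gt_eqF ?powR_gt0.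
by rewrite pq mulr1.
Qed.

(** Hoelder's inequality for |f|^p and |g|^p with the conjugate exponents q / p and r / p. *)
Lemma Lp_normM (p q r : R) f g : 0 < p -> 0 < q -> 0 < r ->
  p^-1 = q^-1 + r^-1 ->
  Lp_norm p nu (fun x => f x * g x) <= Lp_norm q nu f * Lp_norm r nu g.
Proof.
move=> p0 q0 r0 pqr.
have p1 : p / q + p / r = 1 by rewrite -mulrDr -pqr mulfV ?gt_eqF.
have hq (s : R) h : 0 < s -> Lp_norm (s / p) nu (fun x => `|h x| `^ p) = Lp_norm s nu h `^ p.
  move=> s0; rewrite /Lp_norm -powRrM; congr (_ `^ _); last by field; rewrite !gt_eqF.
  congr (pairing _ _); apply/funext => x.
  by rewrite ger0_norm ?powR_ge0// -powRrM mulrC divfK ?gt_eqF.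
have := @finite_hoelder (q / p) (r / p) (fun x => `|f x| `^ p) (fun x => `|g x| `^ p).
rewrite !hq// !invf_div => /(_ _ _ p1) H.
rewrite {1}/Lp_norm -[leRHS]powRr1 ?mulr_ge0 ?Lp_norm_ge0//.
rewrite -[in leRHS](mulfV (lt0r_neq0 p0)) powRrM ge0_ler_powR ?invr_ge0 ?(ltW p0)//.
- by rewrite nnegrE; exact: pw_ge0.
- by rewrite nnegrE powR_ge0.
rewrite powRM ?Lp_norm_ge0//.
under [X in pairing X _]eq_fun do rewrite normrM powRM//.
by apply: H; rewrite ?divr_gt0// => x; exact: powR_ge0.
Qed.

(** [Lp_normM] with second factor 1, which has norm 1 because nu has mass one. *)
Lemma Lp_norm_mono (p q : R) f : 0 < p -> p <= q -> Lp_norm p nu f <= Lp_norm q nu f.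
Proof.
move=> p0; rewrite le_eqVlt => /predU1P[->//|pq].
have q0 : 0 < q by exact: lt_trans pq.
have r0 : 0 < (p^-1 - q^-1)^-1 by rewrite invr_gt0 subr_gt0 ltf_pV2.
have h := @Lp_normM p q _ f (fun=> 1) p0 q0 r0.
have {}h := h (etrans (esym (subrK q^-1 p^-1)) (etrans (addrC _ _)
  (congr1 (+%R q^-1) (esym (invrK _))))).
move: h; rewrite (Lp_norm_cst 1 r0) normr1.
have -> : (fun x => f x * 1) = f by apply/funext => x; rewrite mulr1.
by move: (Lp_norm p nu f) (Lp_norm q nu f) => a b; rewrite mulr1.
Qed.

Lemma Lp_norm_sqr (p : R) f : 0 < p ->
  Lp_norm p nu (fun x => f x ^+ 2) = Lp_norm (2 * p) nu f ^+ 2.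
Proof.
move=> p0; rewrite -powR_mulrn ?Lp_norm_ge0// /Lp_norm -powRrM.
congr (_ `^ _); last by field; rewrite gt_eqF.
congr (pairing _ _); apply/funext => x.
by rewrite normrX -powR_mulrn// -powRrM.
Qed.

Lemma pairing_norm_le (p : R) f : 1 <= p -> pairing (fun x => `|f x|) nu <= Lp_norm p nu f.
Proof.
move=> p1; apply: le_trans (Lp_norm_mono f ltr01 p1).
rewrite /Lp_norm invr1 powRr1; last exact: pw_ge0.
by apply: ler_pairing => x; rewrite powRr1.
Qed.

Lemma pairing_cauchy_schwarz f g :
  pairing (fun x => f x * g x) nu <= Lp_norm 2 nu f * Lp_norm 2 nu g.
Proof.
have h := @finite_hoelder 2 2 (fun x => `|f x|) (fun x => `|g x|).
have hn k : Lp_norm 2 nu (fun x => `|k x|) = Lp_norm 2 nu k.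
  by rewrite /Lp_norm; congr (pairing _ _ `^ _); apply/funext => x; rewrite normr_id.
rewrite (hn f) (hn g) in h.
have h0 : (2 : R)^-1 + 2^-1 = 1 by rewrite [RHS]splitr mul1r.
apply: le_trans (h (ltr0Sn _ _) (ltr0Sn _ _) h0 (fun=> normr_ge0 _) (fun=> normr_ge0 _)).
by apply: ler_pairing => x; rewrite -normrM ler_norm.
Qed.

Lemma Lp_norm_sqr_half (p : R) f : 0 < p ->
  Lp_norm (p / 2) nu (fun x => f x ^+ 2) = Lp_norm p nu f ^+ 2.
Proof.
move=> p0; have h := @Lp_norm_sqr (p / 2) f (divr_gt0 p0 (ltr0Sn _ 1)).
by rewrite h; congr (Lp_norm _ _ _ ^+ 2); field.
Qed.

Lemma Lp_norm_sqr_le (p v : R) f : 0 < p -> 2 * p <= v ->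
  Lp_norm p nu (fun x => f x ^+ 2) <= Lp_norm v nu f ^+ 2.
Proof.
move=> p0 pv; have h := @Lp_norm_mono (2 * p) v f (mulr_gt0 (ltr0Sn _ 1) p0) pv.
have e := @Lp_norm_sqr p f p0; rewrite e.
have h0 := @Lp_norm_ge0 (2 * p) f; move: h h0.
move: (Lp_norm (2 * p) nu f) (Lp_norm v nu f) => a b ab a0.
by rewrite lerXn2r// nnegrE (le_trans a0).
Qed.

Lemma pairing_sqr_le (v : R) f : 2 <= v ->
  pairing (fun x => f x ^+ 2) nu <= Lp_norm v nu f ^+ 2.
Proof.
move=> v2; have v2' : 2 * 1 <= v by rewrite mulr1.
apply: le_trans (Lp_norm_sqr_le f ltr01 v2').
apply: le_trans (pairing_norm_le _ (lexx 1)).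
by apply: ler_pairing => x; rewrite ger0_norm ?sqr_ge0.
Qed.

End FiniteLp.

(** * The backward equation *)

Section DirichletForm.
Variables (R : realType) (S : finType) (nu : S -> R) (Q : S -> S -> R).
Hypothesis nu_prob : strictly_positive_probability nu.
Hypothesis Q_gen : Qmatrix Q.
Hypothesis Q_rev : detailed_balance nu Q.
Implicit Types (f g : S -> R).

Let nu_gt0 x : 0 < nu x. Proof. by case: nu_prob. Qed.

(** Expanding the product gives four sums. The two with both functions at the same point vanish
    since the rows of Q sum to zero, after an exchange by detailed balance for the one at y; the two
    mixed sums coincide, again by detailed balance. *)
Lemma dirichlet_polar f g :
  - pairing (fun x => f x * gen_apply Q g x) nu =
  2^-1 * \sum_x \sum_y nu x * Q x y * ((f y - f x) * (g y - g x)).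
Proof.
have e1 : \sum_x \sum_y nu x * Q x y * (f y * g y) = 0.
  rewrite exchange_big big1// => y _.
  rewrite (eq_bigr (fun x => nu y * f y * g y * Q y x)); last first.
    by move=> x _; rewrite Q_rev; ring.
  by rewrite -mulr_sumr Q_gen.2 mulr0.
have e2 : \sum_x \sum_y nu x * Q x y * (f x * g x) = 0.
  rewrite big1// => x _; rewrite (eq_bigr (fun y => nu x * f x * g x * Q x y)).
    by rewrite -mulr_sumr Q_gen.2 mulr0.
  by move=> y _; ring.
have e3 : \sum_x \sum_y nu x * Q x y * (f x * g y) =
    pairing (fun x => f x * gen_apply Q g x) nu.
  apply: eq_bigr => x _; rewrite /gen_apply mulr_sumr mulr_suml.
  by apply: eq_bigr => y _; ring.
have e4 : \sum_x \sum_y nu x * Q x y * (f y * g x) =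
    pairing (fun x => f x * gen_apply Q g x) nu.
  rewrite -e3 exchange_big; apply: eq_bigr => x _; apply: eq_bigr => y _.
  by rewrite Q_rev.
have -> : \sum_x \sum_y nu x * Q x y * ((f y - f x) * (g y - g x)) =
  \sum_x \sum_y nu x * Q x y * (f y * g y) + \sum_x \sum_y nu x * Q x y * (f x * g x)
  - \sum_x \sum_y nu x * Q x y * (f x * g y) - \sum_x \sum_y nu x * Q x y * (f y * g x).
  rewrite -!sumrN -!big_split; apply: eq_bigr => x _ /=.
  by rewrite -!sumrN -!big_split; apply: eq_bigr => y _ /=; ring.
by rewrite e1 e2 e3 e4; field.
Qed.

Lemma pairing_gen_apply g : pairing (gen_apply Q g) nu = 0.
Proof.
have /eqP := dirichlet_polar (fun=> 1) g.
under [X in pairing X _]eq_fun do rewrite mul1r.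
rewrite [X in _ == _ * X]big1; first by rewrite mulr0 oppr_eq0 => /eqP.
by move=> x _; rewrite big1// => y _; rewrite subrr mul0r mulr0.
Qed.

(** Only the diagonal entries of Q can be negative, and F vanishes there. *)
Lemma offdiag_sum_ge0 (F : S -> S -> R) : (forall x y, 0 <= F x y) ->
  (forall x, F x x = 0) -> 0 <= \sum_x \sum_y nu x * Q x y * F x y.
Proof.
move=> F0 Fx; apply: sumr_ge0 => x _; apply: sumr_ge0 => y _.
have [->|xy] := eqVneq x y; first by rewrite Fx mulr0.
by rewrite !mulr_ge0 ?(ltW (nu_gt0 x)) ?F0// Q_gen.1.
Qed.

Lemma dirichletE f : dirichlet nu Q f =
  2^-1 * \sum_x \sum_y nu x * Q x y * (f y - f x) ^+ 2.
Proof. by rewrite /dirichlet dirichlet_polar. Qed.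

Lemma dirichlet_ge0 f : 0 <= dirichlet nu Q f.
Proof.
rewrite dirichletE mulr_ge0// offdiag_sum_ge0// => [x y|x].
  exact: sqr_ge0.
by rewrite subrr expr0n.
Qed.

Lemma dirichletZ (c : R) f :
  dirichlet nu Q (fun x => c * f x) = c ^+ 2 * dirichlet nu Q f.
Proof.
rewrite !dirichletE [RHS]mulrCA; congr (_ * _); rewrite mulr_sumr.
apply: eq_bigr => x _; rewrite mulr_sumr; apply: eq_bigr => y _; ring.
Qed.

Lemma dirichletD (c : R) f :
  dirichlet nu Q (fun x => f x + c) = dirichlet nu Q f.
Proof.
rewrite !dirichletE; congr (_ * _); apply: eq_bigr => x _; apply: eq_bigr => y _.
ring.
Qed.

(** [stroock_varopoulos] for each pair of states. It turns the dissipation of the p-th moment into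
    an energy of g^(p/2), to which Poincare and log-Sobolev inequalities apply. *)
Lemma dirichlet_powR (p : R) g : 1 < p -> (forall x, 0 < g x) ->
  4 * (p - 1) / p ^+ 2 * dirichlet nu Q (fun x => g x `^ (p / 2)) <=
  - pairing (fun x => g x `^ (p - 1) * gen_apply Q g x) nu.
Proof.
move=> p1 g0; rewrite dirichletE dirichlet_polar mulrCA ler_wpM2l ?invr_ge0//.
rewrite mulr_sumr -subr_ge0 -sumrB.
rewrite (eq_bigr (fun x => \sum_y nu x * Q x y *
   ((g y `^ (p - 1) - g x `^ (p - 1)) * (g y - g x)
     - 4 * (p - 1) / p ^+ 2 * (g y `^ (p / 2) - g x `^ (p / 2)) ^+ 2))); last first.
  move=> x _; rewrite mulr_sumr -sumrB; apply: eq_bigr => y _; ring.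
apply: offdiag_sum_ge0 => [x y|x]; first by rewrite subr_ge0 stroock_varopoulos.
by rewrite !subrr expr0n mulr0 mulr0 subrr.
Qed.

(** Truncation at 0 is nondecreasing, so in the polarised form the increments of f and of its
    truncation have the same sign. *)
Lemma pairing_min0_gen f :
  pairing (fun x => Num.min (f x) 0 * gen_apply Q f x) nu <= 0.
Proof.
rewrite -oppr_ge0 dirichlet_polar mulr_ge0// offdiag_sum_ge0// => [x y|x]; last first.
  by rewrite !subrr mul0r.
have mono (u v : R) : u <= v -> Num.min u 0 <= Num.min v 0.
  by move=> uv; rewrite le_min !ge_min uv lexx orbT.
have [h|/ltW h] := leP (f x) (f y).
  by rewrite mulr_ge0 ?subr_ge0 ?mono.
by rewrite mulr_le0 ?subr_le0 ?mono.
Qed.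

End DirichletForm.

(** * Mass, positivity and comparison for the backward equation *)

Section Propagator.
Variables (R : realType) (S : finType) (mu H : R -> S -> R).
Variables (L : R -> S -> S -> R) (lam : R -> R) (T w : R).
Implicit Types (a b c s u : R) (x y : S) (f g : R -> S -> R).
Hypothesis mu_prob : forall s, 0 <= s <= T -> strictly_positive_probability (mu s).
Hypothesis dmu : forall s x, 0 <= s <= T ->
  is_derive s 1 (fun u => mu u x) (- H s x * mu s x).
Hypothesis H_mean : forall s, 0 <= s <= T -> pairing (H s) (mu s) = 0.
Hypothesis L_gen : forall s, 0 <= s <= T -> Qmatrix (L s).
Hypothesis L_rev : forall s, 0 <= s <= T -> detailed_balance (mu s) (L s).
Hypothesis lam_ge0 : forall s, 0 <= s <= T -> 0 <= lam s.
Hypothesis H_osc : forall s x y, 0 <= s <= T -> H s x - H s y <= w.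

Definition backward (a b : R) (g : R -> S -> R) := forall s x, a <= s <= b ->
  is_derive s 1 (fun u => g u x)
    (H s x * g s x - lam s * gen_apply (L s) (g s) x).

Lemma backward_sub a b a' b' g : a <= a' -> b' <= b ->
  backward a b g -> backward a' b' g.
Proof.
move=> aa bb hg s x /andP[h1 h2]; apply: hg; apply/andP; split; lra.
Qed.

(** The mean of H is 0 and lies within an oscillation of every value of H. *)
Lemma H_norm_le s x : 0 <= s <= T -> `|H s x| <= w.
Proof.
move=> sT; have [mu0 mu1] := mu_prob sT.
have e c : pairing (fun y => H s y - c) (mu s) = - c.
  by rewrite (pairingD (mu s) (H s) (fun=> - c)) (H_mean sT) add0r pairing_cst.
rewrite ler_norml; apply/andP; split.
  rewrite -(e w); have -> : H s x = pairing (fun=> H s x) (mu s) by rewrite pairing_cst.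
  by apply: ler_pairing => // y; have := H_osc y x sT; lra.
have -> : H s x = - pairing (fun y => H s y - H s x) (mu s) by rewrite e opprK.
rewrite lerNl -(pairing_cst (mu_prob sT) (- w)).
by apply: ler_pairing => // y; have := H_osc x y sT; lra.
Qed.

Lemma pairing_H_le s (f : S -> R) : 0 <= s <= T -> (forall x, 0 <= f x) ->
  `|pairing (fun x => H s x * f x) (mu s)| <= w * pairing f (mu s).
Proof.
move=> sT f0; have [mu0 _] := mu_prob sT.
apply: (le_trans (ler_norm_sum _ _ _)); rewrite -pairingZ.
apply: ler_sum => x _; rewrite !normrM (ger0_norm (f0 x)) (gtr0_norm (mu0 x)).
by rewrite ler_wpM2r ?(ltW (mu0 x))// ler_wpM2r// H_norm_le.
Qed.

Lemma dv_pairing (f df : R -> S -> R) s : 0 <= s <= T ->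
  (forall x, is_derive s 1 (fun u => f u x) (df s x)) ->
  is_derive s 1 (fun u => pairing (f u) (mu u))
    (pairing (df s) (mu s) - pairing (fun x => H s x * f s x) (mu s)).
Proof.
move=> sT hf.
have h := @dv_sum R S (index_enum S) predT (fun x u => f u x * mu u x)
  (fun x u => df u x * mu u x - H u x * f u x * mu u x) s _.
rewrite /pairing -sumrB; apply: h => x.
apply: (dv_ext _ _ (dvM (hf x) (dmu x sT))) => //; ring.
Qed.

(** The term H g cancels against the derivative of mu, and L g has mean zero under the reversible
    measure. *)
Lemma backward_mass a b g : 0 <= a -> a <= b -> b <= T -> backward a b g ->
  pairing (g a) (mu a) = pairing (g b) (mu b).
Proof.
move=> a0 ab bT hg.
have d s : a <= s <= b -> is_derive s 1 (fun u => pairing (g u) (mu u)) 0.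
  move=> sab; have sT : 0 <= s <= T.
    by move: sab => /andP[h1 h2]; apply/andP; split; lra.
  have e : pairing (fun x => H s x * g s x - lam s * gen_apply (L s) (g s) x) (mu s)
      - pairing (fun x => H s x * g s x) (mu s) = 0.
    rewrite /pairing -sumrB (eq_bigr (fun x =>
      - lam s * (gen_apply (L s) (g s) x * mu s x))); last by move=> x _; ring.
    by rewrite -mulr_sumr -/(pairing _ _) (pairing_gen_apply (L_gen sT) (L_rev sT)) mulr0.
  by rewrite -e; apply: (@dv_pairing g (fun s x => H s x * g s x
    - lam s * gen_apply (L s) (g s) x)) => // x; exact: hg.
have h1 := le_of_derive_ge0 ab d; have h2 := le_of_derive_ge0 ab (fun s h => dvN (d s h)).
apply/eqP; rewrite eq_le h1//=; have := h2 _; rewrite oppr0 lerN2; apply => //.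
Qed.

(* The energy of the negative part decreases backwards in time up to a factor
   exp (w (b - a)), because detailed balance makes its Dirichlet form cross term
   have a sign. *)
Lemma backward_comparison a b (g dg : R -> S -> R) :
  0 <= a -> a <= b -> b <= T ->
  (forall s x, a <= s <= b -> is_derive s 1 (fun u => g u x) (dg s x)) ->
  (forall s x, a <= s <= b ->
     dg s x <= H s x * g s x - lam s * gen_apply (L s) (g s) x) ->
  (forall x, 0 <= g b x) -> forall x, 0 <= g a x.
Proof.
move=> a0 ab bT hg hd gb x.
have sT s : a <= s <= b -> 0 <= s <= T.
  by move=> /andP[h1 h2]; apply/andP; split; lra.
pose m s x := Num.min (g s x) 0.
pose dm s x := 2 * m s x * dg s x.
have d s : a <= s <= b -> is_derive s 1 (fun u => pairing (fun x => m u x ^+ 2) (mu u))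
   (pairing (dm s) (mu s) - pairing (fun x => H s x * m s x ^+ 2) (mu s)).
  move=> sab; apply: (dv_pairing (sT _ sab)) => y.
  exact: (dv_comp (dv_min0_sqr (g s y)) (hg s y sab)).
have h s : a < s < b -> - (pairing (dm s) (mu s)
    - pairing (fun x => H s x * m s x ^+ 2) (mu s)) <=
    w * pairing (fun x => m s x ^+ 2) (mu s).
  move=> /andP[/ltW s1 /ltW s2]; have sab : a <= s <= b by rewrite s1.
  have mu0 x' := (mu_prob (sT s sab)).1 x'.
  (* Here m g = m^2, and multiplication by 2 m <= 0 reverses the differential inequality for g. *)
  have h1 : pairing (fun x => 2 * (H s x * m s x ^+ 2) +
      (- (2 * lam s)) * (m s x * gen_apply (L s) (g s) x)) (mu s) <= pairing (dm s) (mu s).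
    apply: (ler_pairing (mu_prob (sT s sab))) => y; rewrite /dm.
    have mg : m s y * g s y = m s y ^+ 2.
      by rewrite /m; case: (leP (g s y) 0) => _; rewrite ?expr2 ?mul0r.
    have m0 : m s y <= 0 by rewrite /m ge_min lexx orbT.
    have := hd s y sab; rewrite -subr_ge0 => hdy.
    rewrite -subr_ge0 (_ : _ - _ = - m s y * 2 *
       (H s y * g s y - lam s * gen_apply (L s) (g s) y - dg s y)).
      by rewrite !mulr_ge0// oppr_ge0.
    rewrite -mg; ring.
  have h2 := pairing_min0_gen (mu_prob (sT s sab)) (L_gen (sT s sab)) (L_rev (sT s sab)) (g s).
  have h3 := pairing_H_le (sT s sab) (fun x => sqr_ge0 (m s x)).
  rewrite pairingD !pairingZ in h1.
  have h4 : 0 <= 2 * lam s * - pairing (fun x => m s x * gen_apply (L s) (g s) x) (mu s).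
    by rewrite mulr_ge0 ?mulr_ge0 ?lam_ge0 ?sT// oppr_ge0.
  move: h3; rewrite ler_norml => /andP[h3 _]; move: h1 h3 h4; lra.
have := gronwall_backward ab d h.
rewrite (_ : pairing (fun x => m b x ^+ 2) (mu b) = 0); last first.
  rewrite /pairing big1// => y _; rewrite /m min_r// expr0n mul0r//.
have sa : a <= a <= b by rewrite lexx.
rewrite mulr0 => h0.
have /(congr1 (@^~ x)) /= /eqP := pairing_eq0 (mu_prob (sT a sa))
  (fun x => sqr_ge0 (m a x)) (le_anti (introT andP (conj h0
    (pairing_ge0 (mu_prob (sT a sa)) (fun x => sqr_ge0 (m a x)))))).
by rewrite sqrf_eq0 /m => /eqP h1; rewrite -[leLHS]h1 ge_min lexx.
Qed.

Lemma backward_ge0 a b g : 0 <= a -> a <= b -> b <= T -> backward a b g ->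
  (forall x, 0 <= g b x) -> forall s x, a <= s <= b -> 0 <= g s x.
Proof.
move=> a0 ab bT hg gb s x /andP[s1 s2].
apply: (@backward_comparison s b g
  (fun s x => H s x * g s x - lam s * gen_apply (L s) (g s) x)) => //.
  by lra.
by move=> u y /andP[u1 u2]; apply: hg; apply/andP; split; lra.
Qed.

Lemma gen_applyD s (f g : S -> R) x :
  gen_apply (L s) (fun y => f y + g y) x = gen_apply (L s) f x + gen_apply (L s) g x.
Proof. by rewrite /gen_apply -big_split; apply: eq_bigr => y _; rewrite mulrDr. Qed.

Lemma gen_applyZ s c (f : S -> R) x :
  gen_apply (L s) (fun y => c * f y) x = c * gen_apply (L s) f x.
Proof. by rewrite /gen_apply mulr_sumr; apply: eq_bigr => y _; ring. Qed.

Lemma backward_lin a b c f g : backward a b f -> backward a b g ->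
  backward a b (fun s x => f s x + c * g s x).
Proof.
move=> hf hg s x sab.
apply: (dv_ext _ _ (dvD (hf s x sab) (dvZ c (hg s x sab)))) => //.
by rewrite gen_applyD gen_applyZ; ring.
Qed.

Lemma backward_norm_le a b f g : 0 <= a -> a <= b -> b <= T ->
  backward a b f -> backward a b g -> (forall x, `|f b x| <= g b x) ->
  forall s x, a <= s <= b -> `|f s x| <= g s x.
Proof.
move=> a0 ab bT hf hg fg s x sab.
have fb y : - g b y <= f b y <= g b y by have := fg y; rewrite ler_norml.
have h1 : 0 <= g s x + -1 * f s x.
  apply: (backward_ge0 a0 ab bT (backward_lin (-1) hg hf)) => // y.
  by have /andP[? ?] := fb y; lra.
have h2 : 0 <= g s x + 1 * f s x.
  apply: (backward_ge0 a0 ab bT (backward_lin 1 hg hf)) => // y.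
  by have /andP[? ?] := fb y; lra.
by rewrite ler_norml; apply/andP; split; lra.
Qed.

(** Comparison with c exp (- w (b - u)), which is constant in space and hence killed by L: it lies
    below g at time b, and backwards in time it decays at the rate w, which is at least H. *)
Lemma backward_gt0 a b g : 0 <= a -> a <= b -> b <= T -> backward a b g ->
  (forall x, 0 < g b x) -> forall s x, a <= s <= b -> 0 < g s x.
Proof.
move=> a0 ab bT hg gb s x /andP[s1 s2].
have [c c0 hc] : exists2 c : R, 0 < c & forall x, c <= g b x.
  have [y _ hy] := @arg_minP _ R S x xpredT (g b) isT.
  by exists (g b y) => // z; exact: hy.
pose v (u : R) := c * expR (- w * (b - u)).
have v0 u : 0 < v u by rewrite mulr_gt0 ?expR_gt0.
have dv' u : is_derive u 1 v (w * v u).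
  have h : is_derive u 1 (fun u => - w * (b - u)) w.
    by apply: (dv_ext _ _ (dvZ (- w) (dvB (dv_cst b u) (dv_id u)))) => //; ring.
  by apply: (dv_ext _ _ (dvZ c (dv_exp h))) => //; rewrite /v; ring.
have := @backward_comparison s b (fun u x => g u x - v u)
  (fun u x => H u x * g u x - lam u * gen_apply (L u) (g u) x - w * v u)
  ltac:(lra) s2 bT _ _ _ x => h.
suff : 0 <= g s x - v s by have := v0 s; lra.
apply: h => [u y /andP[u1 u2]|u y /andP[u1 u2]|y].
- by apply: dvB => //; apply: hg; apply/andP; split; lra.
- have uT : 0 <= u <= T by apply/andP; split; lra.
  rewrite (gen_applyD u (g u) (fun=> - v u) y).
  have -> : gen_apply (L u) (fun=> - v u) y = 0.
    by rewrite /gen_apply -mulr_suml (L_gen uT).2 mul0r.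
  have := H_norm_le y uT; rewrite ler_norml => /andP[_ hw].
  have : 0 <= (w - H u y) * v u by rewrite mulr_ge0 ?subr_ge0// ltW.
  lra.
- by rewrite /v subrr mulr0 expR0 mulr1 subr_ge0.
Qed.

End Propagator.

(** * Existence, and reduction of norm estimates to positive solutions *)

Section PropagatorLp.
Variables (R : realType) (S : finType) (mu H : R -> S -> R).
Variables (L : R -> S -> S -> R) (lam : R -> R) (T w : R).
Implicit Types (a b c s u : R) (x y : S) (f g : R -> S -> R).
Hypothesis mu_prob : forall s, 0 <= s <= T -> strictly_positive_probability (mu s).
Hypothesis dmu : forall s x, 0 <= s <= T ->
  is_derive s 1 (fun u => mu u x) (- H s x * mu s x).
Hypothesis H_mean : forall s, 0 <= s <= T -> pairing (H s) (mu s) = 0.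
Hypothesis L_gen : forall s, 0 <= s <= T -> Qmatrix (L s).
Hypothesis L_rev : forall s, 0 <= s <= T -> detailed_balance (mu s) (L s).
Hypothesis lam_ge0 : forall s, 0 <= s <= T -> 0 <= lam s.
Hypothesis H_osc : forall s x y, 0 <= s <= T -> H s x - H s y <= w.
Hypothesis H_cont : forall x, continuous (fun s => H s x).
Hypothesis L_cont : forall x y, continuous (fun s => L s x y).
Hypothesis lam_cont : continuous lam.

Local Notation backward := (backward H L lam).

(** The reversal u = b - s turns the terminal value problem into an initial value problem with
    matrix A. *)
Lemma backward_exists b (h : S -> R) : 0 <= b <= T ->
  exists2 g, backward 0 b g & g b = h.
Proof.
move=> /andP[b0 bT].
pose A u x z := lam (b - u) * L (b - u) x z - (x == z)%:R * H (b - u) x.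
have csub (F : R -> R) : continuous F -> continuous (fun u => F (b - u)).
  move=> cF; apply: (@cont_comp R F (fun u => b - u)) => //.
  exact: contB (@cont_cst R b) (@cont_id R).
have A_cont x z : continuous (fun s => A s x z).
  apply: contB; apply: contM.
  - exact: (csub lam).
  - exact: (csub (fun s => L s x z) (@L_cont x z)).
  - exact: cont_cst.
  - exact: (csub (fun s => H s x) (@H_cont x)).
have [y y0 hy] := linear_ode_exists A_cont h b0.
exists (fun s => y (b - s)); last by rewrite subrr.
move=> s x /andP[s0 sb].
have bs : 0 <= b - s <= b by apply/andP; split; lra.
apply: (dv_ext _ _ (dv_comp (f := fun s => y s x) (g := fun s => b - s)
  (hy (b - s) x bs) (dvB (dv_cst b s) (dv_id s)))) => //.
rewrite sub0r mulrN1 /A /gen_apply.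
under eq_bigr do rewrite mulrBl subKr.
rewrite sumrB opprB (bigD1 x)//= eqxx mul1r big1 ?addr0; last first.
  by move=> z; rewrite eq_sym => /negPf ->; rewrite !mul0r.
by congr (_ - _); rewrite mulr_sumr; apply: eq_bigr => z _; rewrite mulrA.
Qed.

(* Strict positivity of the terminal value makes the logarithms below
   differentiable; the truncation level is removed at the end by letting it
   tend to 0. *)
Lemma le_Lp_of_truncation (k p X : R) (nu h : S -> R) : 0 < k -> 0 < p ->
  strictly_positive_probability nu -> 0 <= X ->
  (forall e : R, 0 < e -> X <= k * Lp_norm p nu (fun x => Num.max `|h x| e)) ->
  X <= k * Lp_norm p nu h.
Proof.
move=> k0 p0 nu_prob X0 hX; rewrite leNgt; apply/negP => lt.
have ltk : Lp_norm p nu h < X / k by rewrite ltr_pdivlMr// mulrC.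
have lt2 : Lp_norm p nu h `^ p < (X / k) `^ p.
  by rewrite gt0_ltr_powR// nnegrE ?Lp_norm_ge0 ?divr_ge0 ?(ltW k0).
pose d := ((X / k) `^ p - Lp_norm p nu h `^ p) / 2.
have d0 : 0 < d by rewrite divr_gt0// subr_gt0.
pose e := d `^ p^-1.
have e0 : 0 < e by rewrite powR_gt0.
have ep : e `^ p = d by rewrite /e -powRrM mulVf ?gt_eqF// powRr1// ltW.
have h1 : X / k <= Lp_norm p nu (fun x => Num.max `|h x| e).
  by rewrite ler_pdivrMr// mulrC; exact: hX.
have h2 : (X / k) `^ p <= Lp_norm p nu (fun x => Num.max `|h x| e) `^ p.
  by rewrite ge0_ler_powR ?nnegrE ?(ltW p0) ?divr_ge0 ?(ltW k0) ?Lp_norm_ge0.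
have h3 : Lp_norm p nu (fun x => Num.max `|h x| e) `^ p <= Lp_norm p nu h `^ p + d.
  rewrite [leLHS](Lp_norm_powR nu_prob _ (lt0r_neq0 p0)).
  rewrite [X in _ <= X + _](Lp_norm_powR nu_prob h (lt0r_neq0 p0)).
  rewrite -[X in _ + X](pairing_cst nu_prob d) -pairingD.
  apply: (ler_pairing nu_prob) => x.
  rewrite ger0_norm ?le_max ?normr_ge0//; case: (leP e `|h x|) => _.
    by rewrite lerDl ltW.
  by rewrite ep lerDr powR_ge0.
have : (X / k) `^ p <= Lp_norm p nu h `^ p + d by exact: le_trans h3.
rewrite /d => h4; move: h4 => {h1 h2 h3 lt ltk e ep e0 d0 d}; move: ((X / k) `^ p) (Lp_norm p nu h `^ p) lt2 => A B; lra.
Qed.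

(** The solution G with terminal value max (|g b|, e) is positive and dominates |g|, so an estimate
    for positive solutions passes to g as e tends to 0. *)
Lemma backward_Lp_reduction (k p1 p2 : R) a b g : 0 < k -> 0 < p1 -> 0 < p2 ->
  0 <= a -> a <= b -> b <= T ->
  (forall G, backward a b G -> (forall s x, a <= s <= b -> 0 < G s x) ->
     Lp_norm p2 (mu a) (G a) <= k * Lp_norm p1 (mu b) (G b)) ->
  backward a b g -> Lp_norm p2 (mu a) (g a) <= k * Lp_norm p1 (mu b) (g b).
Proof.
move=> k0 p10 p20 a0 ab bT hG hg.
have bT' : 0 <= b <= T by rewrite (le_trans a0 ab).
have aT : 0 <= a <= T by rewrite a0 (le_trans ab bT).
apply: (le_Lp_of_truncation k0 p10 (mu_prob bT')); first exact: Lp_norm_ge0.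
move=> e e0.
have [G hG0 Gb] := backward_exists (fun x => Num.max `|g b x| e) bT'.
have {}hG0 : backward a b G by apply: backward_sub hG0.
have Gpos s x : a <= s <= b -> 0 < G s x.
  apply: (backward_gt0 mu_prob dmu H_mean L_gen L_rev lam_ge0 H_osc a0 ab bT hG0) => y.
  by rewrite Gb lt_max e0 orbT.
rewrite -Gb; apply: le_trans (hG G hG0 Gpos).
apply: (Lp_norm_le (mu_prob aT) p20) => x.
rewrite [leRHS]gtr0_norm ?Gpos ?lexx//.
apply: (backward_norm_le mu_prob dmu H_mean L_gen L_rev lam_ge0 H_osc a0 ab bT hg hG0).
  by move=> y; rewrite Gb le_max lexx.
by rewrite lexx.
Qed.

(** * Stability in L^p *)

Section Stability.
Variable p : R.
Hypothesis p_ge4 : 4 <= p.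
Hypothesis poincare : forall s (h : S -> R), 0 <= s <= T -> pairing h (mu s) = 0 ->
  - (p / 4) * pairing (fun x => H s x * h x ^+ 2) (mu s) +
  p * (p + 3) / 4 * T * pairing (fun x => H s x * h x) (mu s) ^+ 2
  <= lam s * dirichlet (mu s) (L s) h.

(** [poincare] is available for centred functions. Removing the mean m creates a cross term 2 m Y
    with Y = <H h0, mu>; the B-part of the bound on lambda pays for it through the square of m + (p
    + 3) T Y. The weight (p + 3) T is such that the growth accumulated over [0, T] does not depend
    on T. *)
Lemma poincare_uncentered s (h : S -> R) : 0 < T -> 0 <= s <= T ->
  - (4 / p) * (lam s * dirichlet (mu s) (L s) h)
  - pairing (fun x => H s x * h x ^+ 2) (mu s)
  <= ((p + 3) * T)^-1 * pairing (fun x => h x ^+ 2) (mu s).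
Proof.
move=> T0 sT; have p4 := p_ge4; have pr := mu_prob sT.
have [m mE] : exists m, m = pairing h (mu s) by eexists.
pose h0 x := h x + - m.
have h0m : pairing h0 (mu s) = 0.
  by rewrite /h0 (pairingD (mu s) h (fun=> - m)) (pairing_cst pr) -mE subrr.
have e1 : pairing (fun x => H s x * h x ^+ 2) (mu s) =
    pairing (fun x => H s x * h0 x ^+ 2) (mu s)
    + 2 * m * pairing (fun x => H s x * h0 x) (mu s).
  rewrite (_ : pairing (fun x => H s x * h x ^+ 2) (mu s) =
    pairing (fun x => H s x * h0 x ^+ 2) (mu s)
    + 2 * m * pairing (fun x => H s x * h0 x) (mu s)
    + m ^+ 2 * pairing (H s) (mu s)); first by rewrite (H_mean sT) mulr0 addr0.
  rewrite /pairing !mulr_sumr -!big_split /=; apply: eq_bigr => x _.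
  by rewrite /h0; ring.
have e2 : m ^+ 2 <= pairing (fun x => h x ^+ 2) (mu s).
  have : 0 <= pairing (fun x => h0 x ^+ 2) (mu s).
    by apply: (pairing_ge0 pr) => x; exact: sqr_ge0.
  have -> : pairing (fun x => h0 x ^+ 2) (mu s) =
     pairing (fun x => h x ^+ 2) (mu s) + (- (2 * m) * m + m ^+ 2).
    rewrite -[X in _ + (_ + X)](pairing_cst pr) {2}mE.
    rewrite /pairing !mulr_sumr -!big_split /=; apply: eq_bigr => x _.
    by rewrite /h0; ring.
  lra.
have := poincare sT h0m; rewrite [dirichlet _ _ h0]dirichletD// => [||]; last 2 first.
- exact: L_gen.
- exact: L_rev.
rewrite e1.
set X := pairing (fun x => H s x * h0 x ^+ 2) (mu s).
set Y := pairing (fun x => H s x * h0 x) (mu s).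
set D := lam s * _ => hD.
have p0 : 0 < p by lra.
have hD' : - (4 / p) * D <= X - (p + 3) * T * Y ^+ 2.
  have : (4 / p) * (- (p / 4) * X + p * (p + 3) / 4 * T * Y ^+ 2) <= 4 / p * D.
    by rewrite ler_wpM2l// divr_ge0// ltW.
  rewrite (_ : _ * (_ + _) = - X + (p + 3) * T * Y ^+ 2); first lra.
  by field; rewrite gt_eqF.
apply: (@le_trans _ _ (((p + 3) * T)^-1 * m ^+ 2)); last first.
  by rewrite ler_wpM2l// invr_ge0 mulr_ge0 ?ltW//; lra.
have : 0 <= ((p + 3) * T)^-1 * (m + (p + 3) * T * Y) ^+ 2.
  by rewrite mulr_ge0 ?sqr_ge0// invr_ge0 mulr_ge0 ?(ltW T0)//; lra.
have -> : ((p + 3) * T)^-1 * (m + (p + 3) * T * Y) ^+ 2 =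
  ((p + 3) * T)^-1 * m ^+ 2 + 2 * m * Y + (p + 3) * T * Y ^+ 2.
  by field; rewrite !gt_eqF//; lra.
move: hD'; lra.
Qed.

Lemma dv_Lp_mass a b g s : (forall s, a <= s <= b -> 0 <= s <= T) ->
  backward a b g -> (forall s x, a <= s <= b -> 0 < g s x) -> a <= s <= b ->
  is_derive s 1 (fun u => pairing (fun x => g u x `^ p) (mu u))
  ((p - 1) * pairing (fun x => H s x * g s x `^ p) (mu s)
    - p * (lam s * pairing (fun x => g s x `^ (p - 1) * gen_apply (L s) (g s) x) (mu s))).
Proof.
move=> sT hg g0 sab; have p4 := p_ge4.
have hd := @dv_pairing R S mu H T dmu (fun u x => g u x `^ p) (fun s x =>
  p * g s x `^ (p - 1) * (H s x * g s x - lam s * gen_apply (L s) (g s) x)) s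
  (sT s sab) (fun x => dv_powR p (g0 s x sab) (hg s x sab)).
apply: (dv_ext _ _ hd); first by [].
- rewrite /pairing !mulr_sumr -!sumrB; apply: eq_bigr => x _.
  have -> : g s x `^ p = g s x `^ (p - 1) * g s x.
    by rewrite mulrC mulr_powRB1 ?(ltW (g0 s x sab))//; lra.
  ring.
Qed.

(** Backwards in time the p-th moment grows at a rate of at most (p - 1) / ((p + 3) T), during a
    time of at most T. *)
Lemma backward_Lp_stable_pos a b g : 0 <= a -> a <= b -> b <= T ->
  backward a b g -> (forall s x, a <= s <= b -> 0 < g s x) ->
  pairing (fun x => g a x `^ p) (mu a) <=
  expR ((p - 1) / (p + 3)) * pairing (fun x => g b x `^ p) (mu b).
Proof.
move=> a0 ab bT hg g0; have p4 := p_ge4.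
have sT s : a <= s <= b -> 0 <= s <= T.
  by move=> /andP[h1 h2]; apply/andP; split; lra.
have Wge s : a <= s <= b -> 0 <= pairing (fun x => g s x `^ p) (mu s).
  by move=> /sT /mu_prob pr; apply: (pairing_ge0 pr) => x; exact: powR_ge0.
have sb : a <= b <= b by rewrite ab lexx.
(* For T = 0 the rate is meaningless, but then a = b. *)
have [T0|T0] := leP T 0.
  have -> : a = b by lra.
  by rewrite ler_peMl ?Wge// -[leLHS]expR0 ler_expR divr_ge0//; lra.
have h s : a < s < b ->
  - ((p - 1) * pairing (fun x => H s x * g s x `^ p) (mu s)
    - p * (lam s * pairing (fun x => g s x `^ (p - 1) * gen_apply (L s) (g s) x) (mu s)))
  <= (p - 1) / ((p + 3) * T) * pairing (fun x => g s x `^ p) (mu s).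
  move=> /andP[/ltW s1 /ltW s2]; have sab : a <= s <= b by rewrite s1.
  have hs := sT s sab.
  have h1 := dirichlet_powR (mu_prob hs) (L_gen hs) (L_rev hs)
    (ltac:(lra) : 1 < p) (fun x => g0 s x sab).
  have h2 := poincare_uncentered (fun x => g s x `^ (p / 2)) T0 hs.
  have e x : g s x `^ (p / 2) ^+ 2 = g s x `^ p.
    rewrite -powR_mulrn ?powR_ge0// -powRrM; congr (_ `^ _); lra.
  have e1 : pairing (fun x => (g s x `^ (p / 2)) ^+ 2) (mu s) =
     pairing (fun x => g s x `^ p) (mu s) by apply: eq_bigr => x _; rewrite e.
  have e2 : pairing (fun x => H s x * (g s x `^ (p / 2)) ^+ 2) (mu s) =
     pairing (fun x => H s x * g s x `^ p) (mu s) by apply: eq_bigr => x _; rewrite e.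
  rewrite e1 e2 in h2; move: h1 h2.
  set D := dirichlet _ _ _; set W := pairing (fun x => g s x `^ p) _.
  set X := pairing (fun x => H s x * _) _; set Y := pairing _ _ => h1 h2.
  have p0 : 0 < p by lra.
  have h3 : p * lam s * (4 * (p - 1) / p ^+ 2 * D) <= p * lam s * - Y.
    by rewrite ler_wpM2l// mulr_ge0 ?lam_ge0// ltW.
  have h4 : (p - 1) * (- (4 / p) * (lam s * D) - X) <= (p - 1) * (((p + 3) * T)^-1 * W).
    by rewrite ler_wpM2l//; lra.
  have e5 : p * lam s * (4 * (p - 1) / p ^+ 2 * D) = (p - 1) * ((4 / p) * (lam s * D)).
    by field; rewrite gt_eqF.
  rewrite e5 in h3; rewrite -mulrA; move: h3 h4.
  set K := ((p + 3) * T)^-1 * W; set J := 4 / p * _.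
  rewrite mulNr -/J; clearbody J K; lra.
have := gronwall_backward ab (fun s => dv_Lp_mass sT hg g0) h.
move=> /le_trans; apply; rewrite ler_wpM2r ?Wge// ler_expR.
have -> : (p - 1) / ((p + 3) * T) * (b - a) = (p - 1) / (p + 3) * ((b - a) / T).
  by field; rewrite !gt_eqF//; lra.
by rewrite ler_piMr ?divr_ge0 ?ler_pdivrMr//; lra.
Qed.

Lemma backward_Lp_stable a b g : 0 <= a -> a <= b -> b <= T -> backward a b g ->
  Lp_norm p (mu a) (g a) ^+ 2 <= 14 / 11 * Lp_norm p (mu b) (g b) ^+ 2.
Proof.
move=> a0 ab bT hg; have p4 := p_ge4.
have p0 : 0 < p by lra.
pose k : R := expR ((p - 1) / (p + 3)) `^ p^-1.
have k0 : 0 < k by rewrite powR_gt0 ?expR_gt0.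
have h : Lp_norm p (mu a) (g a) <= k * Lp_norm p (mu b) (g b).
  apply: (backward_Lp_reduction k0 p0 p0 a0 ab bT _ hg) => G hG G0.
  have h := backward_Lp_stable_pos a0 ab bT hG G0.
  have bT' : 0 <= b <= T by rewrite (le_trans a0 ab).
  have aT : 0 <= a <= T by rewrite a0 (le_trans ab bT).
  have e s : a <= s <= b -> pairing (fun x => `|G s x| `^ p) (mu s) =
      pairing (fun x => G s x `^ p) (mu s).
    by move=> sab; apply: eq_bigr => x _; rewrite gtr0_norm ?G0.
  have aab : a <= a <= b by rewrite lexx.
  have bab : a <= b <= b by rewrite ab lexx.
  rewrite /k /Lp_norm (e a aab) (e b bab) -powRM ?expR_ge0//; last first.
    by apply: (pairing_ge0 (mu_prob bT')) => x; exact: powR_ge0.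
  rewrite ge0_ler_powR ?invr_ge0 ?(ltW p0) ?nnegrE//.
    by apply: (pairing_ge0 (mu_prob aT)) => x; exact: powR_ge0.
  rewrite mulr_ge0 ?expR_ge0//.
  by apply: (pairing_ge0 (mu_prob bT')) => x; exact: powR_ge0.
have k2 : k ^+ 2 <= 14 / 11.
  have -> : k ^+ 2 = expR (2 * (p^-1 * ((p - 1) / (p + 3)))).
    by rewrite /k /powR gt_eqF ?expR_gt0// expRK expr2 -expRD -mulr2n mulr_natl.
  (* 3/14 is the value of the left-hand side at p = 4, its largest for p >= 4. Then exp (3/14) <= 1
     / (1 - 3/14) = 14/11. *)
  have h1 : 2 * (p^-1 * ((p - 1) / (p + 3))) <= 3 / 14.
    rewrite -subr_ge0 (_ : _ - _ = ((p - 4) * (3 * p - 7)) / (14 * p * (p + 3))).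
      by rewrite divr_ge0 ?mulr_ge0//; lra.
    by field; rewrite !gt_eqF//; lra.
  apply: (@le_trans _ _ (expR (3 / 14))); first by rewrite ler_expR.
  have := @expR_ge1Dx R (- (3 / 14)); rewrite expRN => h2.
  rewrite -[leLHS]invrK (_ : 14 / 11 = (1 + - (3 / 14))^-1); last by field.
  by rewrite lef_pV2 ?posrE ?invr_gt0 ?expR_gt0//; lra.
apply: (@le_trans _ _ (k ^+ 2 * Lp_norm p (mu b) (g b) ^+ 2)).
  by rewrite -exprMn lerXn2r// nnegrE ?mulr_ge0 ?Lp_norm_ge0// ltW.
by rewrite ler_wpM2r// sqr_ge0.
Qed.

End Stability.

(** * Hypercontractivity *)

Section Hypercontractivity.
Variable c0 : R.
Hypothesis log_sobolev : forall s (h : S -> R), 0 <= s <= T ->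
  pairing (fun x => h x ^+ 2) (mu s) = 1 ->
  c0 * pairing (fun x => h x ^+ 2 * ln `|h x|) (mu s) <= lam s * dirichlet (mu s) (L s) h.

(** Homogeneous form of [log_sobolev]: the multiple q k^(P/2) has unit L^2 norm, and its logarithm
    splits into three terms. *)
Lemma log_sobolev_powR s (P : R) (k : S -> R) : 0 <= s <= T -> 0 < P ->
  (forall x, 0 < k x) ->
  c0 * (P / 2 * pairing (fun x => k x `^ P * ln (k x)) (mu s)
    - 2^-1 * (pairing (fun x => k x `^ P) (mu s) *
              ln (pairing (fun x => k x `^ P) (mu s))))
  <= lam s * dirichlet (mu s) (L s) (fun x => k x `^ (P / 2)).
Proof.
move=> sT P0 k0; have pr := mu_prob sT.
set W := pairing (fun x => k x `^ P) (mu s).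
have W0 : 0 < W by apply: (pairing_gt0 pr) => x; exact: powR_gt0.
pose q := W `^ (- 2^-1).
have q0 : 0 < q by rewrite powR_gt0.
have q2 : q ^+ 2 = W^-1.
  rewrite -powR_mulrn ?(ltW q0)// /q -powRrM (_ : _ * _ = -1); last by field.
  by rewrite powR_inv1 ?ltW.
have lnq : ln q = - 2^-1 * ln W by rewrite /q ln_powR.
have k2 x : k x `^ (P / 2) ^+ 2 = k x `^ P.
  rewrite -powR_mulrn ?powR_ge0// -powRrM; congr (_ `^ _); lra.
have hn : pairing (fun x => (q * k x `^ (P / 2)) ^+ 2) (mu s) = 1.
  rewrite (_ : pairing _ _ = q ^+ 2 * W); first by rewrite q2 mulVf ?gt_eqF.
  by rewrite /W -pairingZ; apply: eq_bigr => x _; rewrite exprMn k2.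
have := log_sobolev sT hn.
rewrite (dirichletZ (L_gen sT) (L_rev sT)) q2.
have -> : pairing (fun x => (q * k x `^ (P / 2)) ^+ 2 * ln `|q * k x `^ (P / 2)|) (mu s)
  = W^-1 * (P / 2 * pairing (fun x => k x `^ P * ln (k x)) (mu s) - 2^-1 * ln W * W).
  rewrite /W -!pairingZ -sumrB -/W mulr_sumr; apply: eq_bigr => x _.
  rewrite exprMn k2 q2 ger0_norm ?mulr_ge0 ?powR_ge0 ?(ltW q0)//.
  rewrite lnM ?posrE ?powR_gt0// lnq ln_powR; ring.
move=> h; have := ler_wpM2l (ltW W0) h.
have e (B D : R) : W * (B * (W^-1 * D)) = B * D by field; rewrite gt_eqF.
by rewrite !e -(mulrA 2^-1) (mulrC (ln W)).
Qed.

(** Gross's argument: the exponent solves P' = - 2 c0 (P - 1), so that the entropy term which P'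
    adds to the derivative of the P-th moment is exactly compensated by the log-Sobolev bound on the
    dissipation. The potential H contributes the factor exp (w (b - a)). *)
Lemma backward_hyper_pos (p1 p2 : R) a b g : 0 <= a -> a <= b -> b <= T ->
  1 < p1 -> 0 < p2 -> p2 - 1 <= (p1 - 1) * expR (2 * c0 * (b - a)) ->
  backward a b g -> (forall s x, a <= s <= b -> 0 < g s x) ->
  Lp_norm p2 (mu a) (g a) <= expR (w * (b - a)) * Lp_norm p1 (mu b) (g b).
Proof.
move=> a0 ab bT p11 p20 hp hg g0.
have sT s : a <= s <= b -> 0 <= s <= T.
  by move=> /andP[h1 h2]; apply/andP; split; lra.
pose P s := 1 + (p1 - 1) * expR (2 * c0 * (b - s)).
have P1 s : 1 < P s by rewrite ltrDl mulr_gt0 ?expR_gt0 ?subr_gt0.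
have P0 s : 0 < P s by apply: lt_trans (P1 s).
have dP s : is_derive s 1 P (- (2 * c0) * (P s - 1)).
  have h : is_derive s 1 (fun u => 2 * c0 * (b - u)) (- (2 * c0)).
    by apply: (dv_ext _ _ (dvZ (2 * c0) (dvB (dv_cst b s) (dv_id s)))) => //; ring.
  by apply: (dv_ext _ _ (dvD (dv_cst 1 s) (dvZ (p1 - 1) (dv_exp h)))) => //; rewrite /P; ring.
pose W s := pairing (fun x => g s x `^ P s) (mu s).
have W0 s : a <= s <= b -> 0 < W s.
  by move=> sab; apply: (pairing_gt0 (mu_prob (sT s sab))) => x; rewrite powR_gt0 ?g0.
pose A s := pairing (fun x => g s x `^ P s * ln (g s x)) (mu s).
pose X s := pairing (fun x => H s x * g s x `^ P s) (mu s).
pose Y s := pairing (fun x => g s x `^ (P s - 1) * gen_apply (L s) (g s) x) (mu s).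
pose dW s := (P s - 1) * X s - (2 * c0) * (P s - 1) * A s - P s * (lam s * Y s).
have hW s : a <= s <= b -> is_derive s 1 W (dW s).
  move=> sab.
  have hpow x : is_derive s 1 (fun u => g u x `^ P u)
    (g s x `^ P s * (- (2 * c0) * (P s - 1) * ln (g s x) + P s *
       ((H s x * g s x - lam s * gen_apply (L s) (g s) x) / g s x))).
    apply: (dv_powRvar (g0 s x sab) (hg s x sab) (dP s)).
    have := is_derive_continuous (hg s x sab) => /cvgr_gt; apply; exact: g0.
  have hd := @dv_pairing R S mu H T dmu (fun u x => g u x `^ P u) (fun s x =>
      g s x `^ P s * (- (2 * c0) * (P s - 1) * ln (g s x) + P s *
       ((H s x * g s x - lam s * gen_apply (L s) (g s) x) / g s x))) s (sT s sab) hpow.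
  apply: (dv_ext _ _ hd); first by [].
  - rewrite /dW /A /X /Y /pairing !mulr_sumr -!sumrB; apply: eq_bigr => x _.
    have gx := g0 s x sab.
    have -> : g s x `^ P s = g s x `^ (P s - 1) * g s x.
      by rewrite mulrC mulr_powRB1 ?(ltW gx).
    by field; rewrite gt_eqF.
have hdW s : a <= s <= b ->
    - w * (P s - 1) * W s - 2 * c0 * (P s - 1) / P s * (W s * ln (W s)) <= dW s.
  move=> sab; have hs := sT s sab.
  have h1 := dirichlet_powR (mu_prob hs) (L_gen hs) (L_rev hs) (P1 s) (fun x => g0 s x sab).
  have h2 := log_sobolev_powR hs (P0 s) (fun x => g0 s x sab).
  have h3 := pairing_H_le mu_prob H_mean H_osc hs (fun x => powR_ge0 (g s x) (P s)).
  rewrite -/(X s) -/(W s) ler_norml in h3; case/andP: h3 => h3 _.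
  rewrite -/(Y s) in h1; rewrite -/(A s) -/(W s) in h2; rewrite /dW.
  move: h1 h2; set D := dirichlet _ _ _ => h1 h2.
  have h4 : P s * lam s * (4 * (P s - 1) / P s ^+ 2 * D) <= P s * lam s * - Y s.
    by rewrite ler_wpM2l// mulr_ge0 ?lam_ge0// ltW.
  have e4 : P s * lam s * (4 * (P s - 1) / P s ^+ 2 * D) =
     4 * (P s - 1) / P s * (lam s * D) by field; rewrite gt_eqF.
  have h5 : 4 * (P s - 1) / P s * (c0 * (P s / 2 * A s - 2^-1 * (W s * ln (W s))))
     <= 4 * (P s - 1) / P s * (lam s * D).
    by rewrite ler_wpM2l// divr_ge0 ?mulr_ge0 ?subr_ge0 ?(ltW (P1 s)) ?(ltW (P0 s)).
  have e5 : 4 * (P s - 1) / P s * (c0 * (P s / 2 * A s - 2^-1 * (W s * ln (W s))))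
     = 2 * c0 * (P s - 1) * A s - 2 * c0 * (P s - 1) / P s * (W s * ln (W s)).
    by field; rewrite gt_eqF.
  have h6 : (P s - 1) * - (w * W s) <= (P s - 1) * X s.
    by rewrite ler_wpM2l// subr_ge0 ltW.
  rewrite e5 in h5; rewrite e4 in h4.
  move: h4 h5 h6; set J := 4 * (P s - 1) / P s * _.
  set K := 2 * c0 * (P s - 1) / P s * _; clearbody J K; lra.
(* The logarithm of the L^(P s) norm of g s. Its derivative turns out to be at least - w. *)
pose F s := (P s)^-1 * ln (W s).
have hF s : a <= s <= b -> is_derive s 1 F
    (- (P s ^- 2) * (- (2 * c0) * (P s - 1)) * ln (W s) + (P s)^-1 * (dW s / W s)).
  move=> sab; apply: dvM; last exact: dv_ln (W0 s sab) (hW s sab).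
  by apply: dv_inv => //; rewrite gt_eqF.
have FF : - w * b - - w * a <= F b - F a.
  apply: (@le_of_derive_le R (fun s => - w * s) F (fun=> - w * 1) _ a b ab
    (fun s _ => dvZ (- w) (dv_id s)) hF).
  move=> s /andP[/ltW s1 /ltW s2]; have sab : a <= s <= b by rewrite s1.
  have Ws := W0 s sab.
  have h : (P s)^-1 * ((- w * (P s - 1) * W s
     - 2 * c0 * (P s - 1) / P s * (W s * ln (W s))) / W s) <= (P s)^-1 * (dW s / W s).
    by rewrite ler_wpM2l ?invr_ge0 ?(ltW (P0 s))// ler_wpM2r ?invr_ge0 ?(ltW Ws)// hdW.
  have e : (P s)^-1 * ((- w * (P s - 1) * W s
     - 2 * c0 * (P s - 1) / P s * (W s * ln (W s))) / W s) =
     - w + w / P s - (- (P s ^- 2) * (- (2 * c0) * (P s - 1)) * ln (W s)).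
    by field; rewrite !gt_eqF.
  (* That w >= 0 follows from [H_osc] at two equal states; a state exists because W s > 0. *)
  have w0 : 0 <= w / P s.
    rewrite divr_ge0 ?(ltW (P0 s))//.
    have [x _|/= S0] := pickP (@predT S).
      by have := H_osc x x (sT s sab); rewrite subrr.
    have := Ws; rewrite /W /pairing big1 ?ltxx// => y _; by have := S0 y.
  rewrite e in h; move: h w0; set J := - (P s ^- 2) * _ * _.
  clearbody J; lra.
have LpE s : a <= s <= b -> Lp_norm (P s) (mu s) (g s) = expR (F s).
  move=> sab; rewrite /Lp_norm (_ : pairing _ _ = W s).
    by rewrite /powR gt_eqF ?W0.
  by apply: eq_bigr => x _; rewrite gtr0_norm ?g0.
have aab : a <= a <= b by rewrite lexx.
have bab : a <= b <= b by rewrite ab lexx.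
have Pb : P b = p1 by rewrite /P subrr mulr0 expR0 mulr1; lra.
rewrite -{1}Pb (LpE b bab) -expRD.
apply: (@le_trans _ _ (Lp_norm (P a) (mu a) (g a))).
  by apply: (Lp_norm_mono (mu_prob (sT a aab))) => //; rewrite /P; lra.
by rewrite (LpE a aab) ler_expR; lra.
Qed.

Lemma backward_hyper (p1 p2 : R) a b g : 0 <= a -> a <= b -> b <= T ->
  1 < p1 -> 0 < p2 -> p2 - 1 <= (p1 - 1) * expR (2 * c0 * (b - a)) ->
  backward a b g ->
  Lp_norm p2 (mu a) (g a) <= expR (w * (b - a)) * Lp_norm p1 (mu b) (g b).
Proof.
move=> a0 ab bT p11 p20 hp hg.
apply: (@backward_Lp_reduction _ p1 p2) => //; first exact: expR_gt0.
  exact: lt_trans p11.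
by move=> G hG G0; exact: backward_hyper_pos.
Qed.

End Hypercontractivity.

End PropagatorLp.

(** * Functions on configurations *)

Section ParticleAlgebra.
Variables (R : realType) (S : finType) (N : nat).
Notation config := {ffun 'I_N -> S}.
Implicit Types (f g h : S -> R) (x : config).

Definition psum f x : R := \sum_i f (x i).

Lemma pairing_empirical f x : pairing f (empirical R x) = N%:R^-1 * psum f x.
Proof.
rewrite /pairing /empirical /psum.
under eq_bigr => y _ do rewrite mulrCA.
rewrite -mulr_sumr; congr (_ * _).
under eq_bigr => y _ do rewrite mulr_sumr.
rewrite exchange_big; apply: eq_bigr => i _.
rewrite (bigD1 (x i))//= eqxx mulr1 big1 ?addr0// => y.
by rewrite eq_sym => /negPf ->; rewrite mulr0.
Qed.

Lemma psum_replace f x i y : psum f (replace x i y) = psum f x + (f y - f (x i)).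
Proof.
rewrite /psum (bigD1 i)//= [in RHS](bigD1 i)//= /replace ffunE eqxx.
under eq_bigr => k /negPf ki do rewrite ffunE ki.
ring.
Qed.

(** Adding the sum with i and j exchanged replaces the positive part of a i - a j by the difference
    itself. Hence resampling acts on additive functions as minus an empirical covariance with H,
    although its rates are one-sided. *)
Lemma sum_posdiff_antisym (a b : 'I_N -> R) :
  \sum_i \sum_j Num.max (a i - a j) 0 * (b j - b i) =
  (\sum_i a i) * (\sum_i b i) - N%:R * \sum_i a i * b i.
Proof.
set Z := LHS.
have e1 : Z + Z = \sum_i \sum_j (a i - a j) * (b j - b i).
  rewrite {2}/Z exchange_big -big_split; apply: eq_bigr => i _.
  rewrite -big_split; apply: eq_bigr => j _ /=.
  have [h|h] := leP (a i - a j) 0; have [k|k] := leP (a j - a i) 0.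
  - by rewrite (_ : a i - a j = 0); [ring|lra].
  - ring.
  - ring.
  - lra.
have e2 : \sum_i \sum_j (a i - a j) * (b j - b i) =
    2 * ((\sum_i a i) * (\sum_i b i) - N%:R * \sum_i a i * b i).
  rewrite (eq_bigr (fun i => a i * \sum_j b j - N%:R * (a i * b i)
     - (\sum_j a j * b j) + b i * \sum_j a j)).
    rewrite big_split /= sumrB sumrB -!mulr_suml -mulr_sumr sumr_const card_ord.
    by rewrite -[_ *+ N]mulr_natl; ring.
  move=> i _; rewrite (eq_bigr (fun j => a i * b j - a i * b i - a j * b j + b i * a j)).
    rewrite big_split /= sumrB sumrB -!mulr_sumr sumr_const card_ord.
    by rewrite -[_ *+ N]mulr_natl //=; ring.
  by move=> j _; ring.
by have := etrans e1 e2; clearbody Z; set W := _ - _; lra.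
Qed.

Variables (l : R) (Q : S -> S -> R).
Hypothesis Q_gen : Qmatrix Q.

Lemma gen_component_psum f i x : gen_component Q i (psum f) x = gen_apply Q f (x i).
Proof.
rewrite /gen_component /gen_apply.
under eq_bigr => y _ do rewrite psum_replace addrA addrAC mulrDr.
by rewrite big_split /= -mulr_suml Q_gen.2 mul0r add0r.
Qed.

(** The product with psum h is what the exponential weight with k = 1 removes; the last term cancels
    H g in the backward equation. *)
Lemma particle_generator_psum h f x : (0 < N)%N ->
  particle_generator l Q h (psum f) x =
  l * psum (gen_apply Q f) x + N%:R^-1 * (psum h x * psum f x)
  - psum (fun y => h y * f y) x.
Proof.
move=> N0; rewrite /particle_generator -addrA; congr (_ + _).
  by congr (_ * _); apply: eq_bigr => i _; exact: gen_component_psum.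
rewrite (eq_bigr (fun i => \sum_j Num.max (h (x i) - h (x j)) 0 * (f (x j) - f (x i)))).
  rewrite (sum_posdiff_antisym (fun i => h (x i)) (fun i => f (x i))) /psum.
  by field; rewrite pnatr_eq0 -lt0n.
by move=> i _; apply: eq_bigr => j _; rewrite psum_replace addrAC subrr add0r.
Qed.

(* The sum of g(x_i) g(x_j) over i <> j. *)
Definition pair_sum g x : R := psum g x ^+ 2 - psum (fun y => g y ^+ 2) x.

Lemma pair_sum_replace g x i y : pair_sum g (replace x i y) =
  pair_sum g x + 2 * (psum g x - g (x i)) * (g y - g (x i)).
Proof. by rewrite /pair_sum !psum_replace; ring. Qed.

Lemma gen_component_pair_sum g i x : gen_component Q i (pair_sum g) x =
  2 * (psum g x - g (x i)) * gen_apply Q g (x i).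
Proof.
rewrite /gen_component /gen_apply.
rewrite (eq_bigr (fun y => Q (x i) y * (pair_sum g x
    - 2 * (psum g x - g (x i)) * g (x i))
  + 2 * (psum g x - g (x i)) * (Q (x i) y * g y))).
  by rewrite big_split /= -mulr_suml Q_gen.2 mul0r add0r -mulr_sumr.
by move=> y _; rewrite pair_sum_replace; ring.
Qed.

(** The drift of the weighted pair sum. As g(x_j)^2 - g(x_i) g(x_j) is not antisymmetric in i and j,
    the positive part cannot be removed as in [sum_posdiff_antisym]. *)
Definition resampling_defect h g x : R :=
  2 * N%:R^-1 * \sum_i \sum_j
    Num.max (h (x i) - h (x j)) 0 * (g (x j) ^+ 2 - g (x i) * g (x j)).

(* The terms carrying the mutation rate l cancel between the generator and the
   time derivative of g, so no carre du champ survives. *)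
Lemma pair_sum_balance h g x : (0 < N)%N ->
  (2 * psum g x * psum (fun y => h y * g y - l * gen_apply Q g y) x
   - psum (fun y => 2 * g y * (h y * g y - l * gen_apply Q g y)) x)
  + particle_generator l Q h (pair_sum g) x
  - 2 * (N%:R^-1 * psum h x) * pair_sum g x = resampling_defect h g x.
Proof.
move=> N0; have N0' : (N%:R : R) != 0 by rewrite pnatr_eq0 -lt0n.
rewrite /particle_generator.
rewrite (eq_bigr (fun i => 2 * psum g x * gen_apply Q g (x i)
   - 2 * (g (x i) * gen_apply Q g (x i)))); last first.
  by move=> i _; rewrite gen_component_pair_sum; ring.
rewrite sumrB -!mulr_sumr -/(psum (gen_apply Q g) x)
  -/(psum (fun y => g y * gen_apply Q g y) x).
have -> : psum (fun y => h y * g y - l * gen_apply Q g y) x =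
   psum (fun y => h y * g y) x - l * psum (gen_apply Q g) x.
  by rewrite /psum mulr_sumr -sumrB.
have -> : psum (fun y => 2 * g y * (h y * g y - l * gen_apply Q g y)) x =
   2 * psum (fun y => h y * g y ^+ 2) x - 2 * l * psum (fun y => g y * gen_apply Q g y) x.
  by rewrite /psum !mulr_sumr -sumrB; apply: eq_bigr => i _; ring.
set A := psum (gen_apply Q g) x; set B := psum (fun y => g y * gen_apply Q g y) x.
have e1 := sum_posdiff_antisym (fun i => h (x i)) (fun i => g (x i)).
have e2 := sum_posdiff_antisym (fun i => h (x i)) (fun i => g (x i) ^+ 2).
set Z1 := \sum_i \sum_j _ in e1; set Z2 := \sum_i \sum_j _ in e2.
(* Z1 and Z2 have closed forms by antisymmetry; Z3 has none, but it occurs in the same way on both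
   sides. *)
pose Z3 := \sum_i \sum_j Num.max (h (x i) - h (x j)) 0 * (g (x i) * (g (x j) - g (x i))).
have -> : \sum_i \sum_j Num.max (h (x i) - h (x j)) 0 *
    (pair_sum g (replace x i (x j)) - pair_sum g x) = 2 * psum g x * Z1 - 2 * Z3.
  have H3 (t : R) : \sum_i \sum_j Num.max (h (x i) - h (x j)) 0 *
      (2 * (t - g (x i)) * (g (x j) - g (x i))) = 2 * t * Z1 - 2 * Z3.
    rewrite /Z1 /Z3 !mulr_sumr -sumrB; apply: eq_bigr => i _.
    by rewrite !mulr_sumr -sumrB; apply: eq_bigr => j _; ring.
  rewrite -H3; apply: eq_bigr => i _; apply: eq_bigr => j _.
  by rewrite pair_sum_replace addrAC subrr add0r.
have -> : resampling_defect h g x = 2 * N%:R^-1 * (Z2 - Z3).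
  rewrite /resampling_defect /Z2 /Z3 -sumrB; congr (_ * _); apply: eq_bigr => i _.
  by rewrite -sumrB; apply: eq_bigr => j _; ring.
rewrite e1 e2 /pair_sum -/(psum h x) -/(psum g x) -/(psum (fun y => g y ^+ 2) x).
rewrite -/(psum (fun y => h y * g y) x) -/(psum (fun y => h y * g y ^+ 2) x).
by field.
Qed.

Let sqr_comb_ge0 (a b : R) : 0 <= 3 / 2 * a ^+ 2 + 2^-1 * b ^+ 2.
Proof. by rewrite addr_ge0 // mulr_ge0 ?sqr_ge0 ?divr_ge0. Qed.

(** Uses a^2 - a b <= 3/2 a^2 + 1/2 b^2, the difference being (a + b)^2 / 2; summation over i and j
    gives 2 (3/2 + 1/2) = 4. *)
Lemma resampling_defect_le_osc (w : R) h g x : (0 < N)%N ->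
  (forall y z, h y - h z <= w) -> 0 <= w ->
  resampling_defect h g x <= 4 * w * psum (fun y => g y ^+ 2) x.
Proof.
move=> N0 hw w0; have N0' : (N%:R : R) != 0 by rewrite pnatr_eq0 -lt0n.
rewrite /resampling_defect.
apply: (@le_trans _ _ (2 * N%:R^-1 * \sum_i \sum_j
   (w * (3 / 2) * g (x j) ^+ 2 + w / 2 * g (x i) ^+ 2))).
  rewrite ler_wpM2l// ?mulr_ge0 ?invr_ge0//; apply: ler_sum => i _; apply: ler_sum => j _.
  apply: (@le_trans _ _ (Num.max (h (x i) - h (x j)) 0 *
    (3 / 2 * g (x j) ^+ 2 + 2^-1 * g (x i) ^+ 2))).
    rewrite ler_wpM2l ?le_max ?lexx ?orbT// -subr_ge0.
    rewrite (_ : _ - _ = 2^-1 * (g (x i) + g (x j)) ^+ 2); last by field.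
    by rewrite mulr_ge0 ?sqr_ge0.
  rewrite [leRHS](_ : _ = w * (3 / 2 * g (x j) ^+ 2 + 2^-1 * g (x i) ^+ 2)); last by field.
  by rewrite ler_wpM2r ?ge_max ?hw ?w0// addr_ge0 ?mulr_ge0 ?sqr_ge0.
rewrite le_eqVlt; apply/orP; left; apply/eqP.
rewrite (eq_bigr (fun i => w * (3 / 2) * psum (fun y => g y ^+ 2) x
  + N%:R * (w / 2 * g (x i) ^+ 2))).
  rewrite big_split /= sumr_const card_ord -!mulr_sumr -/(psum (fun y => g y ^+ 2) x).
  by rewrite -[_ *+ N]mulr_natl; field.
move=> i _; rewrite big_split /= -mulr_sumr sumr_const card_ord.
by rewrite -[_ *+ N]mulr_natl.
Qed.

(** In the defect the positive part of h(x_i) - h(x_j) is at most h^+(x_i) + h^-(x_j), and twice the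
    bracket is at most 3 g(x_j)^2 + g(x_i)^2. [alpha] collects the products in which h and g^2 carry
    the same index, [beta] those in which they carry independent ones. *)
Definition alpha h (y : S) : R := Num.max (h y) 0 + 3 * Num.max (- h y) 0.
Definition beta h (y : S) : R := 3 * Num.max (h y) 0 + Num.max (- h y) 0.

Lemma resampling_defect_le_alpha_beta h g x : (0 < N)%N ->
  resampling_defect h g x <= psum (fun y => alpha h y * g y ^+ 2) x
    + N%:R^-1 * (psum (beta h) x * psum (fun y => g y ^+ 2) x).
Proof.
move=> N0; have N0' : (N%:R : R) != 0 by rewrite pnatr_eq0 -lt0n.
pose hp y := Num.max (h y) 0; pose hm y := Num.max (- h y) 0.
have hp0 y : 0 <= hp y by rewrite le_max lexx orbT.
have hm0 y : 0 <= hm y by rewrite le_max lexx orbT.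
have hpm y : h y = hp y - hm y.
  by rewrite /hp /hm; case: (leP (h y) 0); case: (leP (- h y) 0) => ? ?; lra.
rewrite /resampling_defect.
apply: (@le_trans _ _ (2 * N%:R^-1 * \sum_i \sum_j
   ((hp (x i) + hm (x j)) * (3 / 2 * g (x j) ^+ 2 + 2^-1 * g (x i) ^+ 2)))).
  rewrite ler_wpM2l// ?mulr_ge0 ?invr_ge0//; apply: ler_sum => i _; apply: ler_sum => j _.
  apply: (@le_trans _ _ (Num.max (h (x i) - h (x j)) 0 *
    (3 / 2 * g (x j) ^+ 2 + 2^-1 * g (x i) ^+ 2))).
    rewrite ler_wpM2l ?le_max ?lexx ?orbT// -subr_ge0.
    rewrite (_ : _ - _ = 2^-1 * (g (x i) + g (x j)) ^+ 2); last by field.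
    by rewrite mulr_ge0 ?sqr_ge0.
  rewrite ler_wpM2r ?sqr_comb_ge0// ge_max addr_ge0// andbT.
  by rewrite !hpm; have := hp0 (x j); have := hm0 (x i); lra.
rewrite le_eqVlt; apply/orP; left; apply/eqP.
pose G2 := psum (fun y => g y ^+ 2) x.
rewrite (eq_bigr (fun i => 3 / 2 * G2 * hp (x i)
  + N%:R / 2 * (hp (x i) * g (x i) ^+ 2)
  + 3 / 2 * psum (fun y => hm y * g y ^+ 2) x + 2^-1 * psum hm x * g (x i) ^+ 2)).
  rewrite big_split /= big_split /= big_split /= sumr_const card_ord -!mulr_sumr.
  rewrite -/(psum hp x) -/G2 -/(psum (fun y => hp y * g y ^+ 2) x).
  have -> : psum (fun y => alpha h y * g y ^+ 2) x =
    psum (fun y => hp y * g y ^+ 2) x + 3 * psum (fun y => hm y * g y ^+ 2) x.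
    by rewrite /psum mulr_sumr -big_split; apply: eq_bigr => i _; rewrite /alpha -/(hp _) -/(hm _) /=; ring.
  have -> : psum (beta h) x = 3 * psum hp x + psum hm x.
    by rewrite /psum mulr_sumr -big_split.
  rewrite -(mulr_natl (3 / 2 * psum _ x)) -/(psum (fun y => g y ^+ 2) x) -/G2.
  by field.
move=> i _.
rewrite (eq_bigr (fun j => 3 / 2 * hp (x i) * g (x j) ^+ 2 + 2^-1 * (hp (x i) * g (x i) ^+ 2)
   + 3 / 2 * (hm (x j) * g (x j) ^+ 2) + 2^-1 * g (x i) ^+ 2 * hm (x j))).
  rewrite big_split /= big_split /= big_split /= sumr_const card_ord -!mulr_sumr.
  rewrite -(mulr_natl (2^-1 * (hp (x i) * g (x i) ^+ 2))).
  rewrite -/(psum (fun y => g y ^+ 2) x) -/(psum hm x).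
  by rewrite -/(psum (fun y => hm y * g y ^+ 2) x) -/G2; field.
by move=> j _; ring.
Qed.

Lemma product_law_psum (nu : S -> R) f : \sum_y nu y = 1 ->
  \sum_x product_law nu x * psum f x = N%:R * pairing f nu.
Proof.
move=> nu1; rewrite /psum.
under eq_bigr do rewrite mulr_sumr.
rewrite exchange_big /= (eq_bigr (fun=> pairing f nu)).
  by rewrite sumr_const card_ord mulr_natl.
move=> i _.
rewrite (eq_bigr (fun x : config => \prod_k (nu (x k) * (if k == i then f (x k) else 1)))).
  rewrite -(bigA_distr_bigA (fun k y => nu y * (if k == i then f y else 1))).
  rewrite (bigD1 i)//= eqxx [X in _ * X]big1 ?mulr1.
    by apply: eq_bigr => y _; rewrite mulrC.
  by move=> k /negPf ->; under eq_bigr do rewrite mulr1.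
move=> x _; rewrite big_split; congr (_ * _).
by rewrite (bigD1 i)//= eqxx big1 ?mulr1// => k /negPf ->.
Qed.

(** The N (N - 1) pairs of distinct indices are independent under the product law, so each
    contributes the square of the mean. *)
Lemma product_law_pair_sum (nu : S -> R) g : \sum_y nu y = 1 ->
  \sum_x product_law nu x * pair_sum g x = N%:R * (N%:R - 1) * pairing g nu ^+ 2.
Proof.
move=> nu1.
have psE x : pair_sum g x = \sum_i \sum_(j | j != i) g (x i) * g (x j).
  rewrite /pair_sum expr2 {1}/psum mulr_suml /psum -sumrB; apply: eq_bigr => i _.
  by rewrite (bigD1 i)//= mulrDr expr2 addrAC subrr add0r mulr_sumr.
under eq_bigr do rewrite psE mulr_sumr.
rewrite exchange_big /= (eq_bigr (fun=> (N%:R - 1) * pairing g nu ^+ 2)).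
  by rewrite sumr_const card_ord -[_ *+ N]mulr_natl mulrA.
move=> i _; under eq_bigr do rewrite mulr_sumr.
rewrite exchange_big /= (eq_bigr (fun=> pairing g nu ^+ 2)).
  rewrite sumr_const cardC1 card_ord -[LHS]mulr_natl; congr (_ * _).
  by rewrite -subn1 natrB// (leq_ltn_trans _ (ltn_ord i)).
move=> j ji.
rewrite (eq_bigr (fun x : config => \prod_k (nu (x k) *
   (if (k == i) || (k == j) then g (x k) else 1)))).
  rewrite -(bigA_distr_bigA (fun k y => nu y * (if (k == i) || (k == j) then g y else 1))).
  rewrite (bigD1 i)//= (bigD1 j)//= !eqxx orbT /= [X in _ * (_ * X)]big1 ?mulr1.
    by rewrite expr2; congr (_ * _); apply: eq_bigr => y _; rewrite mulrC.
  by move=> k /andP[/negPf -> /negPf ->]; under eq_bigr do rewrite mulr1.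
move=> x _; rewrite big_split; congr (_ * _).
rewrite (bigD1 i)//= (bigD1 j)//= !eqxx orbT big1 ?mulr1// => k.
by move=> /andP[/negPf -> /negPf ->].
Qed.

End ParticleAlgebra.

(** * The variance recursion *)

Section VarianceRecursion.
Variables (R : realType) (S : finType) (N : nat) (mu H : R -> S -> R).
Variables (L : R -> S -> S -> R) (lam : R -> R) (T w : R).
Implicit Types (a b c s u k : R) (f g : R -> S -> R).
Notation config := {ffun 'I_N -> S}.
Hypothesis N_gt0 : (0 < N)%N.
Hypothesis mu_prob : forall s, 0 <= s <= T -> strictly_positive_probability (mu s).
Hypothesis dmu : forall s x, 0 <= s <= T ->
  is_derive s 1 (fun u => mu u x) (- H s x * mu s x).
Hypothesis H_mean : forall s, 0 <= s <= T -> pairing (H s) (mu s) = 0.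
Hypothesis L_gen : forall s, 0 <= s <= T -> Qmatrix (L s).
Hypothesis L_rev : forall s, 0 <= s <= T -> detailed_balance (mu s) (L s).
Hypothesis lam_ge0 : forall s, 0 <= s <= T -> 0 <= lam s.
Hypothesis H_osc : forall s x y, 0 <= s <= T -> H s x - H s y <= w.
Hypothesis H_cont : forall x, continuous (fun s => H s x).
Hypothesis L_cont : forall x y, continuous (fun s => L s x y).
Hypothesis lam_cont : continuous lam.
Hypothesis w_ge0 : 0 <= w.

Local Notation backward := (backward H L lam).
Local Notation generator s := (particle_generator (lam s) (L s) (H s)).
Local Notation mean h x := (pairing h (empirical R x)).

(* u s x stands for E[exp(-k int_0^s <H,eta>); X_s = x]. *)
Definition weighted_forward k (u : R -> config -> R) :=
  forall s (phi : config -> R), 0 <= s <= T ->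
  is_derive s 1 (fun r => \sum_x u r x * phi x)
    (\sum_x u s x * (generator s phi x - k * mean (H s) x * phi x)).

(** [weighted_forward] speaks of fixed test functions. Indicators give the derivative of each u y,
    and the product rule then lets phi move in time. *)
Lemma dv_weighted k (u : R -> config -> R) s (phi : R -> config -> R)
    (dphi : config -> R) : weighted_forward k u -> 0 <= s <= T ->
  (forall x, is_derive s 1 (fun r => phi r x) (dphi x)) ->
  is_derive s 1 (fun r => \sum_x u r x * phi r x)
    (\sum_x u s x * (dphi x + generator s (phi s) x - k * mean (H s) x * phi s x)).
Proof.
move=> hu sT hphi.
pose v y := \sum_x u s x * (generator s (fun z : config => (z == y)%:R) x
  - k * mean (H s) x * (x == y)%:R).
have hv y : is_derive s 1 (fun r => u r y) (v y).
  apply: (dv_ext _ _ (hu s (fun z : config => (z == y)%:R) sT)) => // r.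
  rewrite (bigD1 y)//= eqxx mulr1 big1 ?addr0// => z /negPf ->.
  by rewrite mulr0.
have h1 := @dv_sum R _ (index_enum config) predT (fun x r => u r x * phi s x)
  (fun x r => v x * phi s x) s.
have {}h1 : is_derive s 1 (fun r => \sum_x u r x * phi s x) (\sum_x v x * phi s x).
  apply: h1 => x; apply: (dv_ext _ _ (dvM (hv x) (dv_cst (phi s x) s))) => //.
  by rewrite mulr0 addr0.
have e := etrans (esym (dv_derive1 h1)) (dv_derive1 (hu s (phi s) sT)).
have h2 := @dv_sum R _ (index_enum config) predT (fun x r => u r x * phi r x)
  (fun x r => v x * phi s x + u s x * dphi x) s (fun x => dvM (hv x) (hphi x)).
apply: (dv_ext _ _ h2) => //.
rewrite big_split /= e -big_split; apply: eq_bigr => x _ /=; ring.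
Qed.

Lemma dv_psum s (g dg : R -> S -> R) (x : config) :
  (forall y, is_derive s 1 (fun r => g r y) (dg s y)) ->
  is_derive s 1 (fun r => psum (g r) x) (psum (dg s) x).
Proof.
move=> hg; exact: (@dv_sum R _ (index_enum 'I_N) predT (fun i r => g r (x i))
  (fun i r => dg r (x i)) s (fun i => hg (x i))).
Qed.

(** For k = 1 the derivative vanishes, whence unbiasedness; for k = 2 a factor - <H, eta> is left,
    of absolute value at most w. *)
Lemma dv_weighted_psum k (u : R -> config -> R) s g : weighted_forward k u ->
  0 <= s <= T ->
  (forall y, is_derive s 1 (fun r => g r y)
     (H s y * g s y - lam s * gen_apply (L s) (g s) y)) ->
  is_derive s 1 (fun r => \sum_x u r x * psum (g r) x)
   (\sum_x u s x * ((1 - k) * mean (H s) x * psum (g s) x)).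
Proof.
move=> hu sT hg.
have h := @dv_weighted k u s (fun r x => psum (g r) x) _ hu sT
  (fun x => @dv_psum s g (fun s y => H s y * g s y - lam s * gen_apply (L s) (g s) y) x hg).
apply: (dv_ext _ _ h) => //; apply: eq_bigr => x _; congr (_ * _).
rewrite (particle_generator_psum _ (L_gen sT))// pairing_empirical.
have -> : psum (fun y => H s y * g s y - lam s * gen_apply (L s) (g s) y) x =
  psum (fun y => H s y * g s y) x - lam s * psum (gen_apply (L s) (g s)) x.
  by rewrite /psum mulr_sumr -sumrB.
ring.
Qed.

Variables (u1 u2 : R -> config -> R).
Hypothesis u1_forward : weighted_forward 1 u1.
Hypothesis u2_forward : weighted_forward 2 u2.
Hypothesis u1_init : forall x, u1 0 x = product_law (mu 0) x.
Hypothesis u2_init : forall x, u2 0 x = product_law (mu 0) x.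
Hypothesis u2_ge0 : forall s x, 0 <= s <= T -> 0 <= u2 s x.
Hypothesis second_moment_ge0 : forall s (f : S -> R) c, 0 <= s <= T ->
  0 <= \sum_x u2 s x * mean f x ^+ 2 - 2 * c * (\sum_x u1 s x * mean f x) + c ^+ 2.

Let NR0 : (N%:R : R) != 0. Proof. by rewrite pnatr_eq0 -lt0n. Qed.
Let NRgt0 : 0 < (N%:R : R). Proof. by rewrite ltr0n. Qed.

Lemma weighted_mean (u : config -> R) (f : S -> R) :
  \sum_x u x * mean f x = N%:R^-1 * \sum_x u x * psum f x.
Proof. by rewrite mulr_sumr; apply: eq_bigr => x _; rewrite pairing_empirical; ring. Qed.

Lemma unbiased s (f : S -> R) : 0 <= s <= T ->
  \sum_x u1 s x * mean f x = pairing f (mu s).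
Proof.
move=> sT; have /andP[s0 sT'] := sT.
have [g hg gs] := backward_exists H_cont L_cont lam_cont f sT.
have rT r : 0 <= r <= s -> 0 <= r <= T by move=> /andP[h1 h2]; apply/andP; split; lra.
have d r : 0 <= r <= s -> is_derive r 1 (fun r => \sum_x u1 r x * psum (g r) x) 0.
  move=> rs; apply: (dv_ext _ _ (dv_weighted_psum u1_forward (rT r rs) (fun y => hg r y rs))) => //.
  by rewrite big1// => x _; rewrite subrr !mul0r mulr0.
have T00 : 0 <= (0 : R) <= T by rewrite lexx (le_trans s0).
have e : \sum_x u1 s x * psum (g s) x = \sum_x u1 0 x * psum (g 0) x.
  apply/eqP; rewrite eq_le (le_of_derive_ge0 s0 d)// andbT -lerN2.
  by apply: (le_of_derive_ge0 s0 (fun r h => dvN (d r h))) => r _; rewrite oppr0.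
rewrite weighted_mean -gs e; under eq_bigr do rewrite u1_init.
rewrite product_law_psum; last by have [] := mu_prob T00.
by rewrite mulKf// (backward_mass dmu L_gen L_rev (lexx 0) s0 sT' hg).
Qed.

Lemma weighted_growth a b g : 0 <= a -> a <= b -> b <= T -> backward a b g ->
  (forall s x, a <= s <= b -> 0 <= g s x) ->
  \sum_x u2 b x * mean (g b) x <= expR (w * (b - a)) * \sum_x u2 a x * mean (g a) x.
Proof.
move=> a0 ab bT hg g0; rewrite !weighted_mean mulrCA ler_wpM2l ?invr_ge0//.
have sT s : a <= s <= b -> 0 <= s <= T.
  by move=> /andP[h1 h2]; apply/andP; split; lra.
apply: (gronwall ab (fun s h => dv_weighted_psum u2_forward (sT s h) (fun y => hg s y h))).
move=> s /andP[/ltW s1 /ltW s2]; have sab : a <= s <= b by rewrite s1.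
rewrite mulr_sumr; apply: ler_sum => x _; rewrite [leRHS]mulrCA ler_wpM2l ?u2_ge0 ?sT//.
have h0 : 0 <= psum (g s) x by apply: sumr_ge0 => i _; exact: g0.
rewrite ler_wpM2r//.
have -> : (1 - 2) * mean (H s) x = - mean (H s) x by ring.
rewrite pairing_empirical lerNl ler_pdivlMl// -[_ * - w]/(N%:R * - w).
rewrite -[N in N%:R * _]card_ord mulr_natl -sumr_const; apply: ler_sum => i _.
by have := H_norm_le mu_prob H_mean H_osc (x i) (sT s sab); rewrite ler_norml => /andP[].
Qed.

Variables (p q r al eps t : R).
Hypothesis tT : 0 <= t <= T.
Hypothesis p_gt4 : 4 < p.
Hypothesis pq : p <= q.
Hypothesis r_gt0 : 0 < r.
Hypothesis pqr : p^-1 = q^-1 + r^-1.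
Hypothesis al_half : p - 1 <= (p / 2 - 1) * expR al.
Hypothesis al_2r : 2 * r - 1 <= (p - 1) * expR al.
Hypothesis poincare : forall s (h : S -> R), 0 <= s <= T -> pairing h (mu s) = 0 ->
  - (p / 4) * pairing (fun x => H s x * h x ^+ 2) (mu s) +
  p * (p + 3) / 4 * T * pairing (fun x => H s x * h x) (mu s) ^+ 2
  <= lam s * dirichlet (mu s) (L s) h.
Hypothesis log_sobolev : forall s (h : S -> R), 0 <= s <= T ->
  pairing (fun x => h x ^+ 2) (mu s) = 1 ->
  17 / 4 * al * w * pairing (fun x => h x ^+ 2 * ln `|h x|) (mu s)
  <= lam s * dirichlet (mu s) (L s) h.
Hypothesis eps_ge0 : 0 <= eps.
Hypothesis eps_bound : forall s (f : S -> R), 0 <= s <= t ->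
  \sum_x u2 s x * mean f x ^+ 2 - pairing f (mu s) ^+ 2 <= eps * Lp_norm p (mu s) f ^+ 2.

Let sT s : 0 <= s <= t -> 0 <= s <= T.
Proof. by move=> /andP[h1 h2]; case/andP: tT => _ h3; rewrite h1 (le_trans h2 h3). Qed.

Let p_gt0 : 0 < p. Proof. exact: lt_trans p_gt4. Qed.
Let p_ge2 : 2 <= p. Proof. by have p4 := p_gt4; lra. Qed.
Let p_ge4 : 2 * 2 <= p. Proof. by have p4 := p_gt4; lra. Qed.
Let p_half : 0 < p / 2. Proof. by rewrite divr_gt0. Qed.

(** One hypercontractive time step back, or time 0 if it is closer; there the law is the product
    law, and means are explicit. *)
Lemma back_step s : 0 <= s -> exists a, [/\ 0 <= a <= s, w * (s - a) <= 2 / 17 &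
  a = 0 \/ 0 < w /\ w * (s - a) = 2 / 17].
Proof.
move=> s0; have [h|h] := leP (w * s) (2 / 17).
  by exists 0; split; [rewrite lexx|rewrite subr0|left].
have w0 : 0 < w.
  rewrite lt_neqAle w_ge0 andbT; apply/eqP => w0; move: h; rewrite -w0 mul0r.
  by rewrite ltNge divr_ge0.
have wK : w * (2 / 17 / w) = 2 / 17 by rewrite mulrC divfK ?gt_eqF.
have e : s - (s - 2 / 17 / w) = 2 / 17 / w by ring.
exists (s - 2 / 17 / w); rewrite e wK; split=> //; last by right.
have d1 : 2 / 17 / w <= s by rewrite ler_pdivrMr// (mulrC s) ltW.
have d0 : 0 <= 2 / 17 / w by rewrite divr_ge0 ?(ltW w0).
by rewrite subr_ge0 d1 lerBlDr lerDl.
Qed.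

Lemma expR_back a s : w * (s - a) <= 2 / 17 -> expR (w * (s - a)) <= 17 / 15.
Proof.
move=> h; apply: (@le_trans _ _ (expR (2 / 17))); first by rewrite ler_expR.
have := @expR_ge1Dx R (- (2 / 17)); rewrite expRN => h2.
rewrite -[leLHS]invrK (_ : 17 / 15 = (1 + - (2 / 17))^-1); last by field.
by rewrite lef_pV2 ?posrE ?invr_gt0 ?expR_gt0//; lra.
Qed.

Lemma hyper_back (p1 p2 : R) a b g : 0 <= a -> a <= b -> b <= T -> 0 < w ->
  w * (b - a) = 2 / 17 -> 1 < p1 -> 0 < p2 -> p2 - 1 <= (p1 - 1) * expR al ->
  backward a b g -> Lp_norm p2 (mu a) (g a) <= 17 / 15 * Lp_norm p1 (mu b) (g b).
Proof.
move=> a0 ab bT w0 wab p11 p20 hp hg.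
have e : 2 * (17 / 4 * al * w) * (b - a) = al.
  rewrite (_ : _ * _ = 17 / 2 * al * (w * (b - a))); last by field.
  by rewrite wab; field.
have h := backward_hyper mu_prob dmu H_mean L_gen L_rev lam_ge0 H_osc
  H_cont L_cont lam_cont log_sobolev a0 ab bT p11 p20.
rewrite e in h; apply: (le_trans (h _ hp hg)).
by rewrite ler_wpM2r ?Lp_norm_ge0// expR_back// wab.
Qed.

(** Polarisation: the variance of <f, nu> / |f|_p - <g, nu> / |g|_p is nonnegative, and each of its
    two diagonal terms is at most eps. A function of norm zero vanishes and is treated apart. *)
Lemma covariance_le s (f g : S -> R) : 0 <= s <= t ->
  \sum_x u2 s x * (mean f x * mean g x) <=
  pairing f (mu s) * pairing g (mu s) + eps * (Lp_norm p (mu s) f * Lp_norm p (mu s) g).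
Proof.
move=> st; have pr := mu_prob (sT st).
have mean0 x : mean (fun=> 0) x = 0 :> R.
  by rewrite pairing_empirical /psum big1 ?mulr0.
have [fz|fz] := eqVneq (Lp_norm p (mu s) f) 0.
  rewrite fz mul0r mulr0 addr0 (Lp_norm_eq0 pr fz) (pairing_cst pr) mul0r.
  by rewrite big1// => x _; rewrite mean0 mul0r mulr0.
have [gz|gz] := eqVneq (Lp_norm p (mu s) g) 0.
  rewrite gz mulr0 mulr0 addr0 (Lp_norm_eq0 pr gz) (pairing_cst pr) mulr0.
  by rewrite big1// => x _; rewrite mean0 mulr0 mulr0.
have X0 : 0 < Lp_norm p (mu s) f by rewrite lt_neqAle eq_sym fz Lp_norm_ge0.
have Y0 : 0 < Lp_norm p (mu s) g by rewrite lt_neqAle eq_sym gz Lp_norm_ge0.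
have hf := eps_bound f st; have hg := eps_bound g st.
move: (Lp_norm p (mu s) f) (Lp_norm p (mu s) g) X0 Y0 hf hg {fz gz} => X Y X0 Y0 hf hg.
pose F y := X^-1 * f y + - Y^-1 * g y.
have FE nu : pairing F nu = X^-1 * pairing f nu + - Y^-1 * pairing g nu.
  by rewrite /F pairingD !pairingZ.
have := second_moment_ge0 F (pairing F (mu s)) (sT st).
rewrite (unbiased F (sT st)).
have -> : \sum_x u2 s x * mean F x ^+ 2 =
    X^-1 ^+ 2 * (\sum_x u2 s x * mean f x ^+ 2)
  - 2 * X^-1 * Y^-1 * (\sum_x u2 s x * (mean f x * mean g x))
  + Y^-1 ^+ 2 * (\sum_x u2 s x * mean g x ^+ 2).
  rewrite !mulr_sumr -sumrB -big_split; apply: eq_bigr => x _ /=; rewrite FE; ring.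
rewrite FE.
move: (\sum_x _ * (_ * _)) (\sum_x _ * mean f x ^+ 2) (\sum_x _ * mean g x ^+ 2) hf hg.
move: (pairing f (mu s)) (pairing g (mu s)) => m n C A B hf hg h.
have h1 : X^-1 ^+ 2 * (A - m ^+ 2) <= eps.
  by rewrite exprVn ler_pdivrMl ?exprn_gt0// mulrC.
have h2 : Y^-1 ^+ 2 * (B - n ^+ 2) <= eps.
  by rewrite exprVn ler_pdivrMl ?exprn_gt0// mulrC.
have h3 : X^-1 * Y^-1 * (C - m * n) <= eps.
  have e : X^-1 ^+ 2 * A - 2 * X^-1 * Y^-1 * C + Y^-1 ^+ 2 * B -
    2 * (X^-1 * m + - Y^-1 * n) * (X^-1 * m + - Y^-1 * n) + (X^-1 * m + - Y^-1 * n) ^+ 2 =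
    X^-1 ^+ 2 * (A - m ^+ 2) + Y^-1 ^+ 2 * (B - n ^+ 2) - 2 * (X^-1 * Y^-1 * (C - m * n)) by ring.
  rewrite e in h; lra.
by rewrite -lerBlDl (mulrC eps); move: h3; rewrite -invfM ler_pdivrMl ?mulr_gt0.
Qed.

Lemma mean1 (x : config) : mean (fun=> 1) x = 1 :> R.
Proof.
by rewrite pairing_empirical /psum sumr_const card_ord mulVf.
Qed.

(** A single mean under the squared weight is a covariance with the constant 1, because <1, eta> =
    1. *)
Lemma weighted_mean_le s (f : S -> R) : 0 <= s <= t ->
  \sum_x u2 s x * mean f x <= pairing f (mu s) + eps * Lp_norm p (mu s) f.
Proof.
move=> st; have := covariance_le f (fun=> 1) st; have pr := mu_prob (sT st).
rewrite (pairing_cst pr) (Lp_norm_cst pr) ?normr1//.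
by under eq_bigr do rewrite mean1 mulr1; rewrite !mulr1.
Qed.

(* Applied to functions which are only in L^(p/2): going back in time for a while
   makes them p-integrable. *)
Lemma weighted_mean_back s (f : S -> R) : 0 <= s <= t -> (forall x, 0 <= f x) ->
  \sum_x u2 s x * mean f x <=
  17 / 15 * (pairing f (mu s) + 17 / 15 * eps * Lp_norm (p / 2) (mu s) f).
Proof.
move=> st f0; have hs := sT st; have /andP[s0 sT'] := hs.
have [a [/andP[a0 as'] wa hor]] := back_step s0.
have [g hg gs] := backward_exists H_cont L_cont lam_cont f hs.
have {}hg : backward a s g by exact: backward_sub hg.
have g0 := backward_ge0 mu_prob dmu H_mean L_gen L_rev lam_ge0 H_osc a0 as' sT' hg.
have {}g0 : forall u x, a <= u <= s -> 0 <= g u x by apply: g0 => x; rewrite gs.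
have h1 := weighted_growth a0 as' sT' hg g0.
have at' : 0 <= a <= t by rewrite a0 (le_trans as')//; case/andP: st.
have aT := sT at'.
have m := backward_mass dmu L_gen L_rev a0 as' sT' hg.
have h2 : \sum_x u2 a x * mean (g a) x <=
    pairing f (mu s) + 17 / 15 * eps * Lp_norm (p / 2) (mu s) f.
  case: hor => [az|[w0 wE]].
    subst a; rewrite weighted_mean; under eq_bigr do rewrite u2_init.
    rewrite product_law_psum; last exact: (mu_prob aT).2.
    rewrite mulKf// m gs lerDl; apply: mulr_ge0; last exact: Lp_norm_ge0.
    by rewrite mulr_ge0// divr_ge0.
  apply: (le_trans (weighted_mean_le (g a) at')); rewrite m gs lerD2l.
  rewrite -mulrA mulrCA ler_wpM2l// -gs.
  (* The step from L^(p/2) at time s to L^p at time a, allowed by [al_half]. *)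
  have p4 := p_gt4; apply: hyper_back => //; lra.
rewrite -[in X in X <= _]gs; apply: (le_trans h1).
apply: (@le_trans _ _ (17 / 15 * \sum_x u2 a x * mean (g a) x)); last first.
  by rewrite ler_wpM2l// divr_ge0.
rewrite ler_wpM2r ?expR_back//; apply: sumr_ge0 => x _.
rewrite mulr_ge0 ?u2_ge0// pairing_empirical mulr_ge0 ?invr_ge0//.
by apply: sumr_ge0 => i _; apply: g0; rewrite lexx.
Qed.

(** Since beta h - h = 2 |h| and H has mean zero, the mean of beta is 2 <|H|, mu>; the pointwise
    bound [beta_le] would give the factor 3. *)
Lemma pairing_beta_le s : 0 <= s <= T ->
  pairing (beta (H s)) (mu s) <= 2 * Lp_norm 2 (mu s) (H s).
Proof.
move=> hs; have pr := mu_prob hs.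
have -> : pairing (beta (H s)) (mu s) = 2 * pairing (fun x => `|H s x|) (mu s).
  rewrite -[LHS]subr0 -(H_mean hs) -pairingZ -sumrB; apply: eq_bigr => x _.
  rewrite -mulrBl /beta; congr (_ * _).
  have [h|h] := ler0P (H s x).
    by rewrite max_l ?oppr_ge0//; ring.
  by rewrite max_r ?oppr_le0 ?ltW//; ring.
rewrite ler_wpM2l//; apply: (pairing_norm_le pr); lra.
Qed.

Let max_norm (z : R) : [/\ Num.max z 0 + Num.max (- z) 0 = `|z|,
  0 <= Num.max z 0 & 0 <= Num.max (- z) 0].
Proof.
split; [|by rewrite le_max lexx orbT|by rewrite le_max lexx orbT].
case/orP: (le_total 0 z) => k.
  by rewrite max_l// max_r ?oppr_le0// addr0 ger0_norm.
by rewrite max_r// max_l ?oppr_ge0// add0r ler0_norm.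
Qed.

Lemma alpha_ge0 (h : S -> R) x : 0 <= alpha h x.
Proof. by rewrite addr_ge0// ?mulr_ge0// le_max lexx orbT. Qed.

Lemma alpha_le (h : S -> R) x : alpha h x <= 3 * `|h x|.
Proof.
by rewrite /alpha; have [<- h1 h2] := max_norm (h x); lra.
Qed.

Lemma beta_ge0 (h : S -> R) x : 0 <= beta h x.
Proof. by rewrite addr_ge0// ?mulr_ge0// le_max lexx orbT. Qed.

Lemma beta_le (h : S -> R) x : beta h x <= 3 * `|h x|.
Proof.
by rewrite /beta; have [<- h1 h2] := max_norm (h x); lra.
Qed.

Lemma Lp_norm_le3 (v : R) s (h k : S -> R) : 0 < v -> 0 <= s <= T ->
  (forall x, 0 <= h x <= 3 * `|k x|) -> Lp_norm v (mu s) h <= 3 * Lp_norm v (mu s) k.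
Proof.
move=> v0 hs hk; have pr := mu_prob hs.
have n3 : `|3 : R| = 3 by rewrite ger0_norm.
have e := Lp_normZ pr 3 k v0; rewrite n3 in e; rewrite -e.
apply: (Lp_norm_le pr v0) => x; have /andP[h0 h1] := hk x.
by rewrite (ger0_norm h0) normrM n3.
Qed.

(** For times close to t: the rate is bounded by w, and f^2, which is only controlled in L^(p/2), is
    handled by [weighted_mean_back]. *)
Lemma resampling_short s (f : S -> R) : 0 <= s <= t -> Lp_norm p (mu s) f ^+ 2 <= 14 / 11 ->
  \sum_x u2 s x * resampling_defect (H s) f x <=
  4 * N%:R * (17 / 15 * (14 / 11 * (1 + 17 / 15 * eps))) * w.
Proof.
move=> st hf; have pr := mu_prob (sT st).
have h1 : \sum_x u2 s x * resampling_defect (H s) f x <=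
    4 * w * N%:R * \sum_x u2 s x * mean (fun y => f y ^+ 2) x.
  rewrite mulr_sumr; apply: ler_sum => x _; rewrite [leRHS]mulrCA.
  rewrite ler_wpM2l ?u2_ge0 ?sT// pairing_empirical.
  rewrite (_ : 4 * w * N%:R * _ = 4 * w * psum (fun y => f y ^+ 2) x); last by field.
  by apply: resampling_defect_le_osc => // y z; exact: H_osc (sT st).
apply: (le_trans h1).
have h2 := weighted_mean_back (f := fun y => f y ^+ 2) st (fun y => sqr_ge0 _).
rewrite (Lp_norm_sqr_half (mu s) f p_gt0) in h2.
have h3 := le_trans (pairing_sqr_le pr f p_ge2) hf.
move: hf h2 h3; move: (Lp_norm p (mu s) f ^+ 2) (pairing _ (mu s)) (\sum_x _) => X Y Z.
move=> hX hZ hY.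
have h4 : Y + 17 / 15 * eps * X <= 14 / 11 * (1 + 17 / 15 * eps).
  have : eps * X <= eps * (14 / 11) by rewrite ler_wpM2l.
  lra.
have h5 : Z <= 17 / 15 * (14 / 11 * (1 + 17 / 15 * eps)).
  by apply: (le_trans hZ); rewrite ler_wpM2l// divr_ge0.
rewrite [leRHS](_ : _ = 4 * w * N%:R * (17 / 15 * (14 / 11 * (1 + 17 / 15 * eps)))); last by ring.
by rewrite ler_wpM2l// !mulr_ge0.
Qed.

(** For earlier times: with f in L^(2r), the product alpha f^2 is in L^p by Hoelder's inequality for
    1/p = 1/q + 1/r, and norms of H replace its oscillation. Here 70/11 = (3 + 2) 14/11 and 84/11 =
    (3 + 3) 14/11, the summands coming from alpha and beta. *)
Lemma resampling_long s (f : S -> R) : 0 <= s <= t -> Lp_norm p (mu s) f ^+ 2 <= 14 / 11 ->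
  Lp_norm (2 * r) (mu s) f ^+ 2 <= (17 / 15) ^+ 2 * (14 / 11) ->
  \sum_x u2 s x * resampling_defect (H s) f x <=
  N%:R * (70 / 11 * Lp_norm 2 (mu s) (H s)
    + (17 / 15) ^+ 2 * (84 / 11) * eps * Lp_norm q (mu s) (H s)).
Proof.
move=> st hf hf2; have hs := sT st; have pr := mu_prob hs.
have q0 : 0 < q by exact: lt_le_trans pq.
have rp : p <= r.
  rewrite -lef_pV2 ?posrE// pqr lerDr invr_ge0 ltW//.
pose f2 y := f y ^+ 2.
have f20 y : 0 <= f2 y by exact: sqr_ge0.
have h1 : \sum_x u2 s x * resampling_defect (H s) f x <= N%:R *
   (\sum_x u2 s x * mean (fun y => alpha (H s) y * f2 y) x +
    \sum_x u2 s x * (mean (beta (H s)) x * mean f2 x)).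
  rewrite -big_split mulr_sumr; apply: ler_sum => x _ /=.
  rewrite -mulrDr [leRHS]mulrCA ler_wpM2l ?u2_ge0// !pairing_empirical.
  apply: (le_trans (resampling_defect_le_alpha_beta (H s) f x N_gt0)).
  rewrite -/f2 mulrDr mulVKf// lerD2l.
  by rewrite (_ : N%:R * _ = N%:R^-1 * (psum (beta (H s)) x * psum f2 x))//; field.
apply: (le_trans h1); rewrite ler_wpM2l//.
have ha := weighted_mean_le (fun y => alpha (H s) y * f2 y) st.
have hb := covariance_le (beta (H s)) f2 st.
have c1 : pairing (fun y => alpha (H s) y * f2 y) (mu s) <=
    3 * Lp_norm 2 (mu s) (H s) * (14 / 11).
  apply: (le_trans (pairing_cauchy_schwarz pr _ _)); apply: ler_pM.
  - exact: Lp_norm_ge0.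
  - exact: Lp_norm_ge0.
  - by apply: Lp_norm_le3 => // y; rewrite alpha_ge0 alpha_le.
  - exact: le_trans (Lp_norm_sqr_le pr f (ltr0Sn _ 1) p_ge4) hf.
have c2 : Lp_norm p (mu s) (fun y => alpha (H s) y * f2 y) <=
    3 * Lp_norm q (mu s) (H s) * ((17 / 15) ^+ 2 * (14 / 11)).
  apply: (le_trans (Lp_normM pr _ _ p_gt0 q0 r_gt0 pqr)); apply: ler_pM.
  - exact: Lp_norm_ge0.
  - exact: Lp_norm_ge0.
  - by apply: Lp_norm_le3 => // y; rewrite alpha_ge0 alpha_le.
  - by rewrite (Lp_norm_sqr (mu s) f r_gt0).
have c3 : pairing f2 (mu s) <= 14 / 11 := le_trans (pairing_sqr_le pr f p_ge2) hf.
have c4 : pairing (beta (H s)) (mu s) * pairing f2 (mu s) <=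
    2 * Lp_norm 2 (mu s) (H s) * (14 / 11).
  apply: ler_pM => //; last exact: pairing_beta_le.
  - by apply: (pairing_ge0 pr) => y; exact: beta_ge0.
  - exact: (pairing_ge0 pr).
have c5 : Lp_norm p (mu s) (beta (H s)) * Lp_norm p (mu s) f2 <=
    3 * Lp_norm q (mu s) (H s) * ((17 / 15) ^+ 2 * (14 / 11)).
  apply: ler_pM.
  - exact: Lp_norm_ge0.
  - exact: Lp_norm_ge0.
  - apply: (@le_trans _ _ (3 * Lp_norm p (mu s) (H s))).
      by apply: Lp_norm_le3 => // y; rewrite beta_ge0 beta_le.
    exact: (ler_wpM2l (ler0n R 3) (Lp_norm_mono pr (H s) p_gt0 pq)).
  - by apply: le_trans hf2; apply: (Lp_norm_sqr_le pr f p_gt0); rewrite ler_pM2l.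
move: ha hb c1 c2 c4 c5 => {hf hf2 h1 c3}.
move: (\sum_x _) (\sum_x _) => Za Zb.
move: (Lp_norm p (mu s) (fun y => alpha (H s) y * f2 y)) => La.
move: (_ * Lp_norm p (mu s) f2) => Lb.
move: (pairing (fun y => _ * _) (mu s)) => Pa.
move: (_ * pairing f2 (mu s)) => Pb.
move: (Lp_norm 2 _ _) (Lp_norm q _ _) => H2 Hq ha hb c1 c2 c4 c5.
have d1 : eps * La <= eps * (3 * Hq * ((17 / 15) ^+ 2 * (14 / 11))) by rewrite ler_wpM2l.
have d2 : eps * Lb <= eps * (3 * Hq * ((17 / 15) ^+ 2 * (14 / 11))) by rewrite ler_wpM2l.
rewrite [leRHS](_ : _ = 3 * H2 * (14 / 11) + 2 * H2 * (14 / 11)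
  + 2 * (eps * (3 * Hq * ((17 / 15) ^+ 2 * (14 / 11))))); last by field.
lra.
Qed.

Variables K2 Kq : R -> R.
Hypothesis dK2 : forall s, 0 <= s <= T -> is_derive s 1 K2 (Lp_norm 2 (mu s) (H s)).
Hypothesis dKq : forall s, 0 <= s <= T -> is_derive s 1 Kq (Lp_norm q (mu s) (H s)).
Hypothesis K20 : K2 0 = 0.
Hypothesis Kq0 : Kq 0 = 0.

(** The drift of the weighted pair sum F is integrated with [resampling_long] up to t1 and
    [resampling_short] from t1 to t. The diagonal terms missing from F cost 17/15 (1 + 17/15 eps),
    and the last stretch costs 4 (2/17) (14/11) = 112/187 times as much; this adds up to the factor
    299/187. *)
Lemma variance_recursion (f : S -> R) : Lp_norm p (mu t) f <= 1 ->
  N%:R * (\sum_x u2 t x * mean f x ^+ 2 - pairing f (mu t) ^+ 2) <=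
  17 / 15 * (1 + 17 / 15 * eps) * (299 / 187)
  + 70 / 11 * K2 t + (17 / 15) ^+ 2 * (84 / 11) * eps * Kq t.
Proof.
move=> f1; have /andP[t0 tT'] := tT.
have T00 : 0 <= (0 : R) <= T by rewrite lexx (le_trans t0).
have prt := mu_prob tT.
have f1' : Lp_norm p (mu t) f ^+ 2 <= 1 by rewrite expr_le1 ?Lp_norm_ge0.
have [g hg gt] := backward_exists H_cont L_cont lam_cont f tT.
have gp s : 0 <= s <= t -> Lp_norm p (mu s) (g s) ^+ 2 <= 14 / 11.
  move=> /andP[s0 st].
  have h := backward_Lp_stable mu_prob dmu H_mean L_gen L_rev lam_ge0 H_osc H_cont
    L_cont lam_cont (ltW p_gt4) poincare s0 st tT' (backward_sub s0 (lexx t) hg).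
  apply: (le_trans h); rewrite gt -[leRHS]mulr1 ler_wpM2l// divr_ge0//.
pose F s := \sum_x u2 s x * pair_sum (g s) x.
have dF s : 0 <= s <= t ->
    is_derive s 1 F (\sum_x u2 s x * resampling_defect (H s) (g s) x).
  move=> st; pose dg y := H s y * g s y - lam s * gen_apply (L s) (g s) y.
  have hphi (x : config) : is_derive s 1 (fun r => pair_sum (g r) x)
      (2 * psum (g s) x * psum dg x - psum (fun y => 2 * g s y * dg y) x).
    have h1 : is_derive s 1 (fun r => psum (g r) x) (psum dg x).
      by apply: (@dv_psum s g (fun _ => dg)) => y; exact: hg.
    have h2 : is_derive s 1 (fun r => psum (fun y => g r y ^+ 2) x)
        (psum (fun y => 2 * g s y * dg y) x).
      apply: (@dv_psum s (fun r y => g r y ^+ 2) (fun s y => 2 * g s y * dg y)) => y.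
      exact: (dv_sqr (hg s y st)).
    exact: (dvB (dv_sqr h1) h2).
  apply: (dv_ext _ _ (dv_weighted u2_forward (sT st) hphi)) => //.
  apply: eq_bigr => x _; congr (_ * _).
  by rewrite pairing_empirical pair_sum_balance//; exact: L_gen (sT st).
have [t1 [/andP[t10 t1t] wt1 hor]] := back_step t0.
pose B := 17 / 15 * (14 / 11 * (1 + 17 / 15 * eps)).
have F1 : F t - F t1 <= 4 * N%:R * B * (2 / 17).
  apply: (@le_trans _ _ (4 * N%:R * B * w * t - 4 * N%:R * B * w * t1)).
    have dF1 s : t1 <= s <= t -> is_derive s 1 F
        (\sum_x u2 s x * resampling_defect (H s) (g s) x).
      by move=> /andP[s1 s2]; apply: dF; rewrite s2 (le_trans t10).
    apply: (le_of_derive_le t1t dF1 (fun s _ => dvZ (4 * N%:R * B * w) (dv_id s))) => s.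
    move=> /andP[/ltW s1 /ltW s2]; rewrite mulr1.
    have st : 0 <= s <= t by rewrite s2 (le_trans t10).
    exact: resampling_short st (gp s st).
  rewrite -mulrBr -[leLHS]mulrA ler_wpM2l// /B !mulr_ge0// ?divr_ge0//.
  by rewrite addr_ge0// mulr_ge0// divr_ge0.
have K2mono : K2 t1 <= K2 t.
  have d s : t1 <= s <= t -> is_derive s 1 K2 (Lp_norm 2 (mu s) (H s)).
    by move=> /andP[s1 s2]; apply: dK2; apply: sT; rewrite s2 (le_trans t10).
  by apply: (le_of_derive_ge0 t1t d) => s _; exact: Lp_norm_ge0.
have Kqmono : Kq t1 <= Kq t.
  have d s : t1 <= s <= t -> is_derive s 1 Kq (Lp_norm q (mu s) (H s)).
    by move=> /andP[s1 s2]; apply: dKq; apply: sT; rewrite s2 (le_trans t10).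
  by apply: (le_of_derive_ge0 t1t d) => s _; exact: Lp_norm_ge0.
have F2 : F t1 - F 0 <= N%:R * (70 / 11 * K2 t1 + (17 / 15) ^+ 2 * (84 / 11) * eps * Kq t1).
  case: hor => [->|[w0 wE]]; first by rewrite subrr K20 Kq0 !mulr0 addr0 mulr0.
  rewrite -[leRHS]subr0 -{2}[0](_ : N%:R * (70 / 11 * K2 0
      + (17 / 15) ^+ 2 * (84 / 11) * eps * Kq 0) = 0); last first.
    by rewrite K20 Kq0 !mulr0 addr0 mulr0.
  have dF1 s : 0 <= s <= t1 -> is_derive s 1 F
      (\sum_x u2 s x * resampling_defect (H s) (g s) x).
    by move=> /andP[s1 s2]; apply: dF; rewrite s1 (le_trans s2).
  have dK s : 0 <= s <= t1 -> is_derive s 1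
    (fun s => N%:R * (70 / 11 * K2 s + (17 / 15) ^+ 2 * (84 / 11) * eps * Kq s))
    (N%:R * (70 / 11 * Lp_norm 2 (mu s) (H s)
       + (17 / 15) ^+ 2 * (84 / 11) * eps * Lp_norm q (mu s) (H s))).
    move=> /andP[s1 s2]; have hs : 0 <= s <= T by apply: sT; rewrite s1 (le_trans s2).
    exact: (dvZ N%:R (dvD (dvZ (70 / 11) (dK2 hs)) (dvZ _ (dKq hs)))).
  apply: (le_of_derive_le t10 dF1 dK) => s.
  - move=> /andP[/ltW s1 /ltW s2].
    have st : 0 <= s <= t by rewrite s1 (le_trans s2).
    apply: (resampling_long st (gp s st)).
    (* b lies exactly one hypercontractive step after s, so L^p stability at b gives an L^(2r) bound
       at s. *)
    pose b := s + (t - t1).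
    have sb : s <= b by rewrite lerDl subr_ge0.
    have bt : b <= t by rewrite /b addrCA gerDl subr_le0.
    have b0 : 0 <= b <= t by rewrite bt (le_trans s1).
    have e : w * (b - s) = 2 / 17 by rewrite -wE; congr (_ * _); rewrite /b; ring.
    have r2 : 0 < 2 * r by rewrite mulr_gt0.
    have p1 : 1 < p := lt_le_trans (ltr1n _ 2) p_ge2.
    have h := hyper_back s1 sb (le_trans bt tT') w0 e p1 r2 al_2r (backward_sub s1 bt hg).
    apply: (@le_trans _ _ ((17 / 15 * Lp_norm p (mu b) (g b)) ^+ 2)).
      by rewrite lerXn2r// nnegrE ?Lp_norm_ge0// mulr_ge0 ?Lp_norm_ge0// divr_ge0.
    by rewrite exprMn ler_wpM2l ?sqr_ge0//; exact: gp.
have F0 : F 0 = N%:R * (N%:R - 1) * pairing f (mu t) ^+ 2.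
  rewrite /F; under eq_bigr do rewrite u2_init.
  rewrite product_law_pair_sum; last exact: (mu_prob T00).2.
  by rewrite (backward_mass dmu L_gen L_rev (lexx 0) t0 tT' hg) gt.
have Ft : F t = N%:R ^+ 2 * (\sum_x u2 t x * mean f x ^+ 2)
    - N%:R * (\sum_x u2 t x * mean (fun y => f y ^+ 2) x).
  rewrite /F gt !mulr_sumr -sumrB; apply: eq_bigr => x _.
  by rewrite /pair_sum !pairing_empirical; field.
have tt : 0 <= t <= t by rewrite t0 lexx.
have h2 := weighted_mean_back (f := fun y => f y ^+ 2) tt (fun y => sqr_ge0 _).
rewrite (Lp_norm_sqr_half (mu t) f p_gt0) in h2.
have h3 := le_trans (pairing_sqr_le prt f p_ge2) f1'.
have h4 : pairing (fun y => f y ^+ 2) (mu t) + 17 / 15 * eps * Lp_norm p (mu t) f ^+ 2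
    <= 1 + 17 / 15 * eps.
  rewrite lerD// -[leRHS]mulr1 ler_wpM2l// mulr_ge0// divr_ge0//.
have {h2 h4}h5 : \sum_x u2 t x * mean (fun y => f y ^+ 2) x <= 17 / 15 * (1 + 17 / 15 * eps).
  by apply: (le_trans h2); rewrite ler_wpM2l// divr_ge0.
move: F1 F2; rewrite {}F0 {}Ft.
move: (\sum_x _ * mean f x ^+ 2) (\sum_x _) h5 => Z Y h5.
have m0 : 0 <= pairing f (mu t) ^+ 2 by exact: sqr_ge0.
move: (pairing f (mu t) ^+ 2) m0 => m m0 F1 F2.
have k0 : 0 <= (17 / 15) ^+ 2 * (84 / 11) * eps by rewrite !mulr_ge0// divr_ge0.
have F2' : F t1 - N%:R * (N%:R - 1) * m <= N%:R *
    (70 / 11 * K2 t + (17 / 15) ^+ 2 * (84 / 11) * eps * Kq t).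
  apply: (le_trans F2); rewrite ler_wpM2l// lerD// ler_wpM2l// divr_ge0//.
move: (F t1) F1 F2' => G F1 F2'.
rewrite -(ler_pM2l NRgt0).
have h6 : N%:R * Y <= N%:R * (17 / 15 * (1 + 17 / 15 * eps)) by rewrite ler_wpM2l.
(* The initial value N (N - 1) m falls short of N^2 m by N m, which has the favourable sign and is
   dropped. *)
have h7 : 0 <= N%:R * m by rewrite mulr_ge0.
have := lerD (lerD F1 F2') h6; rewrite /B.
move: (N%:R : R) (K2 t) (Kq t) h7 => n k2 kq h7 h.
rewrite -subr_ge0; rewrite -subr_ge0 in h.
apply: (le_trans (addr_ge0 h h7)); rewrite le_eqVlt; apply/orP; left; apply/eqP.
by field.
Qed.

End VarianceRecursion.

(** * One-sided derivatives *)

Section OneSidedDerivatives.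
Variable R : realType.
Implicit Types (f : R -> R) (a t T : R).

Lemma has_derivative_withinP (D : set R) f t (l : R) :
  has_derivative_within D f t l <->
  forall e : R, 0 < e -> \forall s \near t,
    s != t -> D s -> `|l - (f s - f t) / (s - t)| < e.
Proof.
by split=> [/cvgrPdist_lt h e /h|h]; [|apply/cvgrPdist_lt => e /h];
  rewrite !near_withinE; apply: filterS => s hs.
Qed.

Lemma is_derive_of_quotient f t (l : R) :
  (forall e : R, 0 < e -> \forall s \near t, s != t ->
    `|l - (f s - f t) / (s - t)| < e) -> is_derive t 1 f l.
Proof.
move=> h; apply/is_derive1_caratheodory.
exists (fun s => if s == t then l else (f s - f t) / (s - t)); split => //=.
- move=> z; have [->|zt] := eqVneq z t; first by rewrite !subrr mulr0.
  by rewrite divfK// subr_eq0.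
- apply/cvgrPdist_lt => e e0; rewrite eqxx; have := h e e0; apply: filterS => s hs.
  by have [_|/hs//] := eqVneq s t; rewrite subrr normr0.
- by rewrite eqxx.
Qed.

Lemma quotient_of_is_derive f t (l : R) : is_derive t 1 f l ->
  forall e : R, 0 < e -> \forall s \near t, s != t ->
    `|l - (f s - f t) / (s - t)| < e.
Proof.
move=> /is_derive1_caratheodory [g [hg cg gt]] e e0.
have /cvgrPdist_lt /(_ _ e0) := cg; apply: filterS => s; rewrite gt => hs st.
by rewrite hg mulfK// subr_eq0.
Qed.

(** To the left of a the function is continued by its tangent line. *)
Lemma extend_derivative a f (f' : R -> R) :
  (forall t, a <= t -> has_derivative_within `[a, +oo[ f t (f' t)) ->
  exists2 F : R -> R, (forall t, a <= t -> F t = f t) &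
    forall t, a <= t -> is_derive t 1 F (f' t).
Proof.
move=> h; pose F t := if t < a then f a + (t - a) * f' a else f t.
have FE t : a <= t -> F t = f t by rewrite /F ltNge => ->.
exists F => // t at_; apply: is_derive_of_quotient => e e0.
have /has_derivative_withinP /(_ _ e0) := h t at_.
rewrite le_eqVlt in at_; case/predU1P: at_ => [<-|at_].
  apply: filterS => s hs sa; rewrite (FE a)//; have [las|lsa] := leP a s.
    by rewrite FE//; apply: hs => //=; rewrite in_itv/= las.
  have -> : F s - f a = (s - a) * f' a by rewrite /F lsa; ring.
  by rewrite mulrAC mulfV ?mul1r ?subrr ?normr0// subr_eq0.
have := lt_nbhsr at_ => hn; apply: filterS2 hn => s las hs st.
by rewrite !FE ?(ltW at_) ?(ltW las)//; apply: hs => //=; rewrite in_itv/= ltW.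
Qed.

(** Continuous induction: the times up to which f s - f 0 <= c s form an interval which contains its
    supremum by continuity and which hf extends to the right, so it reaches T. Then c tends to 0. *)
Lemma le_of_right_derivative f T : 0 <= T ->
  (forall t, 0 <= t <= T -> {for t, continuous f}) ->
  (forall t (e : R), 0 <= t < T -> 0 < e ->
     exists2 d : R, 0 < d & forall s, t < s -> s < t + d -> f s - f t <= e * (s - t)) ->
  f T <= f 0.
Proof.
move=> T0 cf hf; apply/ler_addgt0Pr => e e0.
pose c := e / (T + 1).
have T1 : 0 < T + 1 by rewrite ltr_wpDl.
have c0 : 0 < c by rewrite divr_gt0.
suff: f T - f 0 <= c * T.
  move=> h; have : c * T <= e.
    rewrite /c mulrAC ler_pdivrMr// ler_wpM2l ?ltW//; lra.
  lra.
pose A := [set t | 0 <= t <= T /\ forall s, 0 <= s <= t -> f s - f 0 <= c * s].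
have A0 : A 0.
  split; first by rewrite lexx.
  by move=> s s0; have -> : s = 0; [lra|rewrite subrr mulr0].
have hs : has_sup A by split; [exists 0|exists T => t [/andP[]]].
pose tau := sup A.
have tauT : tau <= T by apply: ge_sup => //; [exists 0|move=> t [/andP[]]].
have tau0 : 0 <= tau by apply: ub_le_sup => //; case: hs.
have below s : 0 <= s -> s < tau -> f s - f 0 <= c * s.
  move=> s0 st; have ts : 0 < tau - s by rewrite subr_gt0.
  have [t At lt] := sup_adherent ts hs.
  rewrite subKr in lt; apply: At.2; rewrite s0 ltW//.
have attau : f tau - f 0 <= c * tau.
  have [tz|tpos] := eqVneq tau 0; first by rewrite tz subrr mulr0.
  have tp : 0 < tau by rewrite lt_neqAle eq_sym tpos.
  have cg : {for tau, continuous (fun s => f s - f 0 - c * s)}.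
    have hc : {for tau, continuous f} by apply: cf; rewrite tau0.
    apply: continuousB; first by apply: continuousB => //; exact: cst_continuous.
    by apply: continuousM => //; exact: cst_continuous.
  rewrite -subr_le0 leNgt; apply/negP => gt0.
  have /cvgrPdist_lt /(_ _ gt0) hn := cg.
  have : \forall s \near tau, 0 < s by exact: lt_nbhsr.
  move=> hpos; have [d /= d0 hd] := filterI hn hpos.
  pose s := Num.max (tau - d / 2) (tau / 2).
  have st : s < tau by rewrite gt_max; apply/andP; split; lra.
  have sd : tau - d / 2 <= s by rewrite le_max lexx.
  have s0 : 0 <= s by rewrite le_max; apply/orP; right; lra.
  have [|h1 _] := hd s; first by rewrite /ball /= gtr0_norm; lra.
  have := below s s0 st; move: h1; rewrite ltr_norml => /andP[h1 h2] h3.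
  lra.
have Atau : A tau.
  split; first by rewrite tau0.
  by move=> s /andP[s0]; rewrite le_eqVlt => /predU1P[->//|]; exact: below.
have [tlt|tge] := ltP tau T; last first.
  by have -> : T = tau by lra.
have htau : 0 <= tau < T by rewrite tau0.
have [d d0 hd] := hf tau c htau c0.
pose s := Num.min (tau + d / 2) T.
have st : tau < s by rewrite lt_min tlt andbT; lra.
have sT : s <= T by rewrite ge_min lexx orbT.
have sd : s <= tau + d / 2 by rewrite ge_min lexx.
have As : A s.
  split; first by rewrite sT andbT; lra.
  move=> v /andP[v0 vs]; have [vt|tv] := leP v tau; first by apply: Atau.2; rewrite v0.
  have := hd v tv _; have -> : v < tau + d by lra.
  move=> /(_ isT); lra.
have : s <= tau by apply: ub_le_sup => //; case: hs.
by rewrite leNgt st.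
Qed.

End OneSidedDerivatives.

(** * Weighted laws of a Markov process *)

Section BoundedExpectation.
Context {R : realType} {d : measure_display} {Omega : measurableType d}.
Variable P : probability Omega R.
Implicit Types (Y Z : Omega -> R).

Definition bounded_rv Y := measurable_fun setT Y /\ exists M : R, forall w, `|Y w| <= M.

Definition mean_rv Y : R := \int[P]_w Y w.

Lemma bounded_rv_integrable Y : bounded_rv Y -> P.-integrable setT (EFin \o Y).
Proof.
move=> [mY [M hM]]; apply: measurable_bounded_integrable => //.
  by apply: (le_lt_trans (probability_le1 P measurableT)); rewrite ltry.
exists M; split; first exact: num_real.
by move=> x Mx w _ /=; apply: (le_trans (hM w)); exact: ltW.
Qed.

Lemma bounded_rvD Y Z : bounded_rv Y -> bounded_rv Z -> bounded_rv (fun w => Y w + Z w).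
Proof.
move=> [mY [M hM]] [mZ [M' hM']]; split; first exact: measurable_funD.
by exists (M + M') => w; rewrite (le_trans (ler_normD _ _))// lerD.
Qed.

Lemma bounded_rvM Y Z : bounded_rv Y -> bounded_rv Z -> bounded_rv (fun w => Y w * Z w).
Proof.
move=> [mY [M hM]] [mZ [M' hM']]; split; first exact: measurable_funM.
by exists (M * M') => w; rewrite normrM ler_pM.
Qed.

Lemma bounded_rv_cst (c : R) : bounded_rv (fun=> c).
Proof. by split; [exact: measurable_cst|exists `|c|]. Qed.

Lemma bounded_rvZ (c : R) Y : bounded_rv Y -> bounded_rv (fun w => c * Y w).
Proof. by move=> h; apply: bounded_rvM => //; exact: bounded_rv_cst. Qed.

Lemma bounded_rvB Y Z : bounded_rv Y -> bounded_rv Z -> bounded_rv (fun w => Y w - Z w).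
Proof.
move=> hY hZ; have := bounded_rvD hY (bounded_rvZ (-1) hZ).
by under [X in bounded_rv X -> _]eq_fun do rewrite mulN1r.
Qed.

Lemma bounded_rv_sum (I : Type) (r : seq I) (Q : pred I) (F : I -> Omega -> R) :
  (forall i, bounded_rv (F i)) -> bounded_rv (fun w => \sum_(i <- r | Q i) F i w).
Proof.
move=> hF; elim: r => [|i r IH].
  by under [X in bounded_rv X]eq_fun do rewrite big_nil; exact: bounded_rv_cst.
under [X in bounded_rv X]eq_fun do rewrite big_cons.
by case: (Q i) => //; exact: bounded_rvD.
Qed.

Lemma bounded_rv_indic (A : set Omega) : measurable A -> bounded_rv (\1_A).
Proof.
move=> mA; split; first exact: measurable_indic.
by exists 1 => w; rewrite indicE; case: (w \in A); rewrite ?normr1 ?normr0.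
Qed.

Lemma mean_rvD Y Z : bounded_rv Y -> bounded_rv Z ->
  mean_rv (fun w => Y w + Z w) = mean_rv Y + mean_rv Z.
Proof. by move=> hY hZ; apply: RintegralD => //; exact: bounded_rv_integrable. Qed.

Lemma mean_rvZ (c : R) Y : bounded_rv Y -> mean_rv (fun w => c * Y w) = c * mean_rv Y.
Proof. by move=> hY; apply: RintegralZl => //; exact: bounded_rv_integrable. Qed.

Lemma mean_rv_cst (c : R) : mean_rv (fun=> c) = c.
Proof. by rewrite /mean_rv Rintegral_cst// [X in fine X](probability_setT P) mulr1. Qed.

Lemma mean_rvB Y Z : bounded_rv Y -> bounded_rv Z ->
  mean_rv (fun w => Y w - Z w) = mean_rv Y - mean_rv Z.
Proof. by move=> hY hZ; apply: RintegralB => //; exact: bounded_rv_integrable. Qed.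

Lemma mean_rv_sum (I : Type) (r : seq I) (Q : pred I) (F : I -> Omega -> R) :
  (forall i, bounded_rv (F i)) ->
  mean_rv (fun w => \sum_(i <- r | Q i) F i w) = \sum_(i <- r | Q i) mean_rv (F i).
Proof.
move=> hF; elim: r => [|i r IH].
  by under [X in mean_rv X]eq_fun do rewrite big_nil; rewrite big_nil mean_rv_cst.
under [X in mean_rv X]eq_fun do rewrite big_cons.
rewrite big_cons; case: (Q i) => //; rewrite mean_rvD ?IH//; exact: bounded_rv_sum.
Qed.

Lemma mean_rv_indic (A : set Omega) : measurable A -> mean_rv (\1_A) = fine (P A).
Proof. by move=> mA; rewrite /mean_rv /Rintegral integral_indic// setIT. Qed.

Lemma mean_rv_ge0 Y : (forall w, 0 <= Y w) -> 0 <= mean_rv Y.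
Proof. by move=> h; apply: Rintegral_ge0. Qed.

Lemma mean_rv_le Y Z : bounded_rv Y -> bounded_rv Z -> (forall w, Y w <= Z w) ->
  mean_rv Y <= mean_rv Z.
Proof.
move=> hY hZ h; rewrite -subr_ge0 -mean_rvB//.
by apply: mean_rv_ge0 => w; rewrite subr_ge0.
Qed.

Lemma mean_rv_norm_le Y (M : R) : bounded_rv Y -> (forall w, `|Y w| <= M) ->
  `|mean_rv Y| <= M.
Proof.
move=> hY h; rewrite ler_norml -(mean_rv_cst M) -mulN1r.
rewrite -(mean_rvZ (-1) (bounded_rv_cst M)); apply/andP; split; apply: mean_rv_le => //.
- exact: bounded_rvZ (bounded_rv_cst M).
- by move=> w; rewrite mulN1r; have := h w; rewrite ler_norml => /andP[].
- exact: bounded_rv_cst.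
- by move=> w; have := h w; rewrite ler_norml => /andP[].
Qed.

Lemma expectation_mean_rv Y : bounded_rv Y -> expectation P Y = (mean_rv Y)%:E.
Proof.
move=> hY; rewrite expectation.unlock /mean_rv /Rintegral fineK//.
exact: integrable_fin_num (bounded_rv_integrable hY).
Qed.

Lemma mean_rv_cvg (Yn : (Omega -> R)^nat) Y (M : R) :
  (forall n, bounded_rv (Yn n)) -> bounded_rv Y ->
  (forall n w, `|Yn n w| <= M) -> (forall w, Yn ^~ w @ \oo --> Y w) ->
  mean_rv (Yn n) @[n --> \oo] --> mean_rv Y.
Proof.
move=> hn hY hM hc.
have := @dominated_cvg d Omega R P setT measurableT
  (fun n => EFin \o Yn n) (EFin \o Y) (EFin \o cst M).
move=> H; apply: fine_cvg; rewrite fineK; last first.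
  exact: integrable_fin_num (bounded_rv_integrable hY).
apply: H => //.
- by move=> n; apply/measurable_EFinP; case: (hn n).
- by move=> w _; apply/cvg_EFin; [exact: nearW|exact: hc].
- exact: bounded_rv_integrable (bounded_rv_cst M).
- by move=> n w _ /=; rewrite lee_fin.
Qed.

(* Approximation by level sets, through which the Markov property passes from
   events to bounded variables. *)
Lemma layer_approximation (y M : R) (n K : nat) : (0 < n)%N -> 0 <= y -> y <= M ->
  n%:R * M < K%:R ->
  `|y - n%:R^-1 * \sum_(k < K) ((k.+1)%:R / n%:R <= y)%R%:R| <= n%:R^-1.
Proof.
move=> n0 y0 yM hK; have nR : 0 < (n%:R : R) by rewrite ltr0n.
have ny0 : 0 <= n%:R * y by rewrite mulr_ge0// ltW.
pose m := Num.truncn (n%:R * y).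
have /andP[m1 m2] : m%:R <= n%:R * y < m.+1%:R by exact: truncn_itv.
have -> : \sum_(k < K) ((k.+1)%:R / n%:R <= y)%R%:R = m%:R :> R.
  have mK : (m <= K)%N.
    rewrite -(ler_nat R) (le_trans m1)// (le_trans _ (ltW hK))// ler_wpM2l// ltW.
  rewrite (eq_bigr (fun k : 'I_K => ((k < m)%N)%:R)).
    rewrite -(big_mkord xpredT (fun k => ((k < m)%N)%:R : R)) (big_cat_nat _ mK)//=.
    rewrite [X in X + _](eq_big_nat _ _ (F2 := fun=> 1)); last by move=> k /andP[_ ->].
    rewrite [X in _ + X]big_nat_cond [X in _ + X]big1 ?addr0; last first.
      by move=> k /andP[/andP[mk _] _]; rewrite ltnNge mk.
    by rewrite sumr_const_nat subn0.
  move=> k _; congr (_%:R); rewrite ler_pdivrMr// mulrC.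
  have -> : (k.+1%:R <= n%:R * y) = (k.+1 <= m)%N by rewrite /m truncn_ge_nat.
  by [].
rewrite -natr1 in m2.
have -> : y - n%:R^-1 * m%:R = n%:R^-1 * (n%:R * y - m%:R) by field; rewrite gt_eqF.
rewrite normrM gtr0_norm ?invr_gt0// -[leRHS]mulr1 ler_wpM2l ?invr_ge0 ?ltW//.
rewrite ger0_norm ?subr_ge0//; lra.
Qed.

End BoundedExpectation.

(** * Joint measurability of paths and their time integrals *)

Section PathIntegral.
Context {R : realType} (E : finType) {d : measure_display} {Omega : measurableType d}.
Variables (X : R -> Omega -> E) (h : R -> E -> R).
Implicit Types (t s r : R) (w : Omega) (z : E).
Hypothesis X_meas : forall t z, 0 <= t -> measurable (X t @^-1` [set z]).
Hypothesis X_rc : forall w t, 0 <= t -> \forall s \near t^'+, X s w = X t w.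
Hypothesis h_cont : forall z, continuous (fun t => h t z).
Local Notation leb := (@lebesgue_measure R).

Definition past_events t : set (set Omega) :=
  [set A | exists u z, [/\ 0 <= u, u <= t & A = X u @^-1` [set z] ] ].
(** Omega with the past as its own measurable structure, so that results on product measurability
    yield measurability with respect to the past. *)
Definition past_space t := g_sigma_algebraType (past_events t).

Lemma past_measurable t (A : set Omega) : natural_filtration X t A -> measurable A.
Proof.
apply: smallest_sub.
  by split => [|B mB|B mB]; [exact: measurable0|rewrite setTD; exact: measurableC|
    exact: bigcup_measurable].
by move=> B [u [z [u0 _ ->]]]; exact: X_meas.
Qed.

Lemma right_constant w t : 0 <= t -> exists2 e : R, 0 < e &
  forall s, t <= s -> s < t + e -> X s w = X t w.
Proof.
move=> t0; have := X_rc w t0; rewrite near_withinE => -[e /= e0 he].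
exists e => // s; rewrite le_eqVlt => /predU1P[->//|ts] se.
by apply: he => //; rewrite /ball /= distrC gtr0_norm ?subr_gt0//; lra.
Qed.

Definition visits t z : set (past_space t * R) :=
  [set wr | 0 <= wr.2 <= t /\ X wr.2 wr.1 = z].

Arguments visits : clear implicits.

(** The right end of the k-th cell, because paths are right-continuous, cut at t so that the state
    there is an event of the past of t. *)
Let grid t (n k : nat) : R := Num.min (k.+1%:R / n.+1%:R) t.

Definition grid_visits t z (n : nat) : set (past_space t * R) :=
  \bigcup_k ((X (grid t n k) @^-1` [set z] : set (past_space t)) `*`
     (`[k%:R / n.+1%:R, k.+1%:R / n.+1%:R[ `&` `[0, t])).

Arguments grid_visits : clear implicits.

Lemma grid_visits_measurable t z n : 0 <= t -> measurable (grid_visits t z n).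
Proof.
move=> t0; apply: bigcup_measurable => k _; apply: measurableX.
  apply: sub_sigma_algebra; exists (grid t n k), z; split => //.
    by rewrite le_min t0 andbT divr_ge0.
  by rewrite ge_min lexx orbT.
exact: measurableI.
Qed.

Lemma grid_visitsP t z n w r : 0 <= r <= t ->
  grid_visits t z n (w, r) <-> X (grid t n (Num.truncn (r * n.+1%:R))) w = z.
Proof.
move=> rt; have /andP[r0 _] := rt.
have n0 : 0 < (n.+1%:R : R) by rewrite ltr0n.
have rn : 0 <= r * n.+1%:R by rewrite mulr_ge0// ltW.
split=> [[k _ [/= hX [hk _]]]|hX].
  have -> // : Num.truncn (r * n.+1%:R) = k.
  move: hk; rewrite /= in_itv/= ler_pdivrMr// ltr_pdivlMr// => /andP[k1 k2].
  by apply/eqP; rewrite truncn_eq ?k1 ?k2.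
exists (Num.truncn (r * n.+1%:R)) => //; split=> //=; split; last by rewrite /= in_itv.
by rewrite /= in_itv/= ler_pdivrMr// ltr_pdivlMr// truncn_itv.
Qed.

(** Progressive measurability: on a grid the visits form a countable union of rectangles, and by
    right-continuity their indicators are eventually constant at each point. *)
Lemma visits_measurable t z : 0 <= t -> measurable (visits t z).
Proof.
move=> t0; have mf : measurable_fun setT (\1_(visits t z) : past_space t * R -> R).
  apply: (@measurable_fun_cvg _ _ R setT (fun n => \1_(grid_visits t z n))).
    by move=> n; apply: measurable_indic; exact: grid_visits_measurable.
  move=> [w r] _; have [rt|rt] := boolP (0 <= r <= t); last first.
    have e n : \1_(grid_visits t z n) (w, r) = 0 :> R.
      rewrite indicE memNset// => -[k _ [/= _ [_]]]; rewrite /= in_itv/=.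
      by rewrite (negPf rt).
    rewrite indicE memNset => [|[/= h']]; last by rewrite h' in rt.
    by under eq_fun do rewrite e; exact: cvg_cst.
  have /andP[r0 r_le] := rt; have [e e0 he] := right_constant w r0.
  apply: cvg_near_cst.
  have hinf : \forall n \near \oo, (n.+1%:R : R)^-1 < e by exact: near_infty_natSinv_lt (PosNum e0).
  apply: filterS hinf => n hn.
  have n0 : 0 < (n.+1%:R : R) by rewrite ltr0n.
  have key : X (grid t n (Num.truncn (r * n.+1%:R))) w = X r w.
    have rn : 0 <= r * n.+1%:R by rewrite mulr_ge0// ltW.
    have /andP[m1 m2] := truncn_itv rn.
    apply: he.
      by rewrite le_min r_le andbT ler_pdivlMr// ltW.
    rewrite gt_min; apply/orP; left; rewrite ltr_pdivrMr// -natr1 mulrDl.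
    apply: ler_ltD => //; rewrite -ltr_pdivrMr// mul1r//.
  rewrite !indicE; congr (_%:R); congr nat_of_bool.
  apply/idP/idP; rewrite !inE => hh.
    by split=> //=; rewrite -key; apply/grid_visitsP.
  by apply/grid_visitsP => //; rewrite key; case: hh.
have := mf measurableT [set 1]; rewrite setTI => /(_ (measurable_set1 1)).
rewrite (_ : _ @^-1` _ = visits t z)//; apply/seteqP; split=> [x|x hx] /=.
  rewrite indicE; case: (boolP (x \in _)) => [|_ /eqP]; first by rewrite inE.
  by rewrite eq_sym oner_eq0.
by rewrite indicE mem_set.
Qed.

Definition running t (wr : past_space t * R) : R :=
  \sum_z h wr.2 z * \1_(visits t z) wr.

Lemma runningE t w r : running (t := t) (w, r) = if 0 <= r <= t then h r (X r w) else 0.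
Proof.
rewrite /running; case: ifP => rt.
  rewrite (bigD1 (X r w))//= indicE mem_set ?mulr1//= big1 ?addr0// => z zX.
  by rewrite indicE memNset ?mulr0// => -[_ /= h']; rewrite h' eqxx in zX.
by rewrite big1// => z _; rewrite indicE memNset ?mulr0// => -[/=]; rewrite rt.
Qed.

Lemma running_measurable t : 0 <= t -> measurable_fun setT (@running t).
Proof.
move=> t0; apply: measurable_sum => z; apply: measurable_funM.
  apply: (measurableT_comp (continuous_measurable_fun (@h_cont z))).
  exact: measurable_snd.
by apply: measurable_indic; exact: visits_measurable.
Qed.

Definition path_integral t w : R := \int[leb]_(r in `[0, t]) h r (X r w).

(** Split into positive and negative parts, because Tonelli's theorem provides measurable fibre
    integrals of nonnegative functions. *)
Lemma path_integralE t w : path_integral t w =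
  fine (\int[leb]_r ((EFin \o @running t)^\+ (w, r)) -
        \int[leb]_r ((EFin \o @running t)^\- (w, r)))%E.
Proof.
rewrite /path_integral /Rintegral integral_mkcond integralE.
congr (fine (_ - _)%E); apply: eq_integral => r _; rewrite unlock /= runningE patchE;
  by rewrite mem_setE in_itv/=; case: ifP.
Qed.

Lemma path_integral_past_measurable t : 0 <= t ->
  measurable_fun setT (path_integral t : past_space t -> R).
Proof.
move=> t0; have mr : measurable_fun setT (EFin \o @running t).
  by apply/measurable_EFinP; exact: running_measurable.
rewrite (_ : path_integral t = (fun w : past_space t => fine (
   \int[leb]_r ((EFin \o @running t)^\+ (w, r)) -
   \int[leb]_r ((EFin \o @running t)^\- (w, r)))%E)); last first.
  by apply/funext => w; exact: path_integralE.
apply: (measurableT_comp (fine_measurable measurableT)).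
apply: emeasurable_funB.
  exact: (measurable_fun_fubini_tonelli_F (m2 := leb) _ (measurable_funepos mr)
    (fun x => funepos_ge0 _ x)).
exact: (measurable_fun_fubini_tonelli_F (m2 := leb) _ (measurable_funeneg mr)
  (fun x => funeneg_ge0 _ x)).
Qed.

Variables (T c : R).
Hypothesis c_bound : forall r z, 0 <= r <= T -> `|h r z| <= c.

Lemma path_integrable t w : 0 <= t <= T ->
  leb.-integrable `[0, t] (EFin \o (fun r => h r (X r w))).
Proof.
move=> /andP[t0 tT]; apply: measurable_bounded_integrable => //.
- by rewrite /= lebesgue_measure_itv/=; case: ifP; rewrite ?ltry.
- apply: (eq_measurable_fun (fun r => running (t := t) (w, r))).
    by move=> r; rewrite inE/= in_itv/= => rt; rewrite runningE rt.
  apply: measurable_funTS.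
  exact: (measurable_fun_pair2 (w : past_space t) (running_measurable t0)).
- exists c; split; first exact: num_real.
  move=> x cx r /=; rewrite in_itv/= => /andP[r0 rt].
  by apply: (le_trans (c_bound _ _)); [rewrite r0 (le_trans rt)|exact: ltW].
Qed.

Lemma path_integral_split t s w : 0 <= t -> t <= s -> s <= T ->
  path_integral s w = path_integral t w + \int[leb]_(r in `]t, s]) h r (X r w).
Proof.
move=> t0 ts sT.
have sT' : 0 <= s <= T by rewrite (le_trans t0).
have := @Rintegral_itvB R (fun r => h r (X r w)) (BLeft 0) (BRight s) t
  (path_integrable w sT').
by rewrite !bnd_simp => /(_ t0 ts) <-; rewrite addrC subrK.
Qed.

Lemma path_integral_lip t s w : 0 <= t -> t <= s -> s <= T ->
  `|path_integral s w - path_integral t w| <= c * (s - t).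
Proof.
move=> t0 ts sT; rewrite (path_integral_split w t0 ts sT) addrC addKr.
have sT' : 0 <= s <= T by rewrite (le_trans t0).
have sub : `]t, s] `<=` `[0, s].
  move=> r /=; rewrite !in_itv/= => /andP[h1 ->]; rewrite andbT.
  by rewrite (le_trans t0) ?ltW.
have hi : leb.-integrable `]t, s] (EFin \o (fun r => h r (X r w))).
  exact: integrableS (path_integrable w sT').
apply: (le_trans (le_normr_Rintegral _ hi)) => //.
have fin : (leb `]t, s] < +oo)%E.
  by rewrite /= lebesgue_measure_itv/=; case: ifP; rewrite ?ltry.
apply: (@le_trans _ _ (\int[leb]_(r in `]t, s]) c)).
  apply: le_Rintegral => //.
  - exact: (integrable_norm hi).
  - apply/integrableP; split; first exact/measurable_EFinP.
    by rewrite integral_cst//= lte_mul_pinfty// ?lee_fin.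
  - move=> r /=; rewrite in_itv/= => /andP[h1 h2]; apply: c_bound.
    by rewrite (le_trans t0 (ltW h1)) (le_trans h2).
rewrite Rintegral_cst//= lebesgue_measure_itv/= lte_fin.
case: ltP => [_|st]; first by rewrite -EFinD.
by have -> : t = s; [lra|rewrite subrr].
Qed.

(** The path stays at X t w for a while, during which the integrand is a continuous function of
    time. *)
Lemma path_integral_local t w : 0 <= t < T -> exists2 e : R, 0 < e &
  forall s, t <= s -> s < t + e -> s <= T ->
  path_integral s w = path_integral t w +
    (primitive (fun r => h r (X t w)) s - primitive (fun r => h r (X t w)) t).
Proof.
move=> /andP[t0 tT]; have [e e0 he] := right_constant w t0.
exists e => // s ts se sT; rewrite (path_integral_split w t0 ts sT); congr (_ + _).
have cz := @h_cont (X t w).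
rewrite !primitiveE ?(le_trans t0 ts)// (@Rintegral_split R _ 0 t s)// addrC addKr.
rewrite -Rintegral_itv_obnd_cbnd; last first.
  apply: (integrableS _ _ _ (continuous_integrable_itv t s cz)) => //.
  exact: subset_itv_oc_cc.
apply: eq_Rintegral => r; rewrite inE/= in_itv/= => /andP[r1 r2].
by rewrite he ?(ltW r1)// (le_lt_trans r2).
Qed.

End PathIntegral.

(** * The forward equation of the weighted laws *)

Section WeightedLaw.
Context {R : realType} (E : finType) {d : measure_display} {Omega : measurableType d}.
Variables (P : probability Omega R) (X : R -> Omega -> E) (h : R -> E -> R).
Variables (G : R -> (E -> R) -> E -> R) (p : R -> R -> E -> E -> R) (k : R).
Implicit Types (t s r : R) (w : Omega) (x y z : E) (phi : E -> R).
Hypothesis X_meas : forall t z, 0 <= t -> measurable (X t @^-1` [set z]).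
Hypothesis X_rc : forall w t, 0 <= t -> \forall s \near t^'+, X s w = X t w.
Hypothesis h_cont : forall z, continuous (fun t => h t z).
Hypothesis trans : transition_function G p.
Hypothesis markov : forall s t A y, 0 <= s -> s <= t -> natural_filtration X s A ->
  P (A `&` X t @^-1` [set y]) =
  (\sum_x (p s t x y)%:E * P (A `&` X s @^-1` [set x]))%E.
Hypothesis G_cont : forall phi x, exists2 g : R -> R, continuous g &
  forall t, 0 <= t -> g t = G t phi x.
Hypothesis k_ge0 : 0 <= k.

Definition weight t w : R := expR (- k * path_integral X h t w).

Definition at_state t y w : R := (X t w == y)%:R.

Definition weighted_law t y : R := mean_rv P (fun w => weight t w * at_state t y w).

Lemma at_stateE t y : at_state t y = \1_(X t @^-1` [set y]).
Proof. by apply/funext => w; rewrite indicE; congr (_%:R); congr nat_of_bool; apply/eqP/idP; rewrite inE. Qed.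

Lemma bounded_at_state t y : 0 <= t -> bounded_rv (at_state t y).
Proof. by move=> t0; rewrite at_stateE; apply: bounded_rv_indic; exact: X_meas. Qed.

Lemma state_expand t phi w : phi (X t w) = \sum_y phi y * at_state t y w.
Proof.
rewrite (bigD1 (X t w))//= /at_state eqxx mulr1 big1 ?addr0// => y.
by rewrite eq_sym => /negPf ->; rewrite mulr0.
Qed.

Lemma bounded_state t phi : 0 <= t -> bounded_rv (fun w => phi (X t w)).
Proof.
move=> t0; under [X in bounded_rv X]eq_fun do rewrite state_expand.
by apply: bounded_rv_sum => y; apply: bounded_rvZ; exact: bounded_at_state.
Qed.

Lemma transition_le1 s t x y : 0 <= s -> s <= t -> p s t x y <= 1.
Proof.
move=> s0 st; case: trans => p0 p1 _ _ _; rewrite -(p1 s t x s0 st) (bigD1 y)//=.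
by rewrite lerDl; apply: sumr_ge0 => z _; exact: p0.
Qed.

Lemma markov_indic s t (A : set Omega) y : 0 <= s -> s <= t ->
  natural_filtration X s A ->
  mean_rv P (fun w => \1_A w * at_state t y w) =
  \sum_x p s t x y * mean_rv P (fun w => \1_A w * at_state s x w).
Proof.
move=> s0 st FA; have mA := past_measurable X_meas FA.
have e r z : 0 <= r -> mean_rv P (fun w => \1_A w * at_state r z w) =
    fine (P (A `&` X r @^-1` [set z])).
  move=> r0; rewrite -mean_rv_indic; last exact: measurableI mA (X_meas z r0).
  by congr (mean_rv P _); apply/funext => w; rewrite at_stateE indicI.
rewrite e ?(le_trans s0)// (markov y s0 st FA).
rewrite (_ : (\sum_x _)%E = (\sum_x p s t x y * fine (P (A `&` X s @^-1` [set x])))%:E).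
  by rewrite /=; apply: eq_bigr => x _; rewrite e.
rewrite -sumEFin; apply: eq_bigr => x _; rewrite EFinM fineK//.
by apply: fin_num_measure; exact: measurableI mA (X_meas x s0).
Qed.

(** Both sides are linear in Y and agree on indicators of past events. A layer sum Z within 1/n of Y
    makes their difference D Y at most (1 + #|E|) / n. *)
Lemma markov_bounded s t (Y : Omega -> R) (M : R) y : 0 <= s -> s <= t ->
  measurable_fun setT (Y : past_space X s -> R) -> (forall w, 0 <= Y w <= M) ->
  mean_rv P (fun w => Y w * at_state t y w) =
  \sum_x p s t x y * mean_rv P (fun w => Y w * at_state s x w).
Proof.
move=> s0 st mY YM; have t0 := le_trans s0 st.
have FY (B : set R) : measurable B -> natural_filtration X s (Y @^-1` B).
  by move=> mB; have := mY measurableT B mB; rewrite setTI.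
have bY : bounded_rv Y.
  split; last by exists M => w; have /andP[Y0 YM'] := YM w; rewrite ger0_norm.
  move=> _ B mB; rewrite setTI; apply: (past_measurable X_meas).
  exact: FY.
pose D (Z : Omega -> R) := mean_rv P (fun w => Z w * at_state t y w) -
  \sum_x p s t x y * mean_rv P (fun w => Z w * at_state s x w).
suff: `|D Y| <= 0 by rewrite normr_le0 subr_eq0 => /eqP.
have bound n : (0 < n)%N -> `|D Y| <= (1 + #|E|%:R) * n%:R^-1.
  move=> n0; have nR : 0 < (n%:R : R) by rewrite ltr0n.
  pose K := (Num.truncn (n%:R * M)).+1.
  have hK : n%:R * M < K%:R by exact: truncnS_gt.
  pose A (j : 'I_K) := Y @^-1` `[j.+1%:R / n%:R, +oo[%classic.
  have FA j : natural_filtration X s (A j) by exact: FY.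
  have mA j : measurable (A j) := past_measurable X_meas (FA j).
  pose Z w : R := n%:R^-1 * \sum_(j < K) \1_(A j) w.
  have bZ : bounded_rv Z.
    apply: bounded_rvZ; apply: bounded_rv_sum => j; exact: bounded_rv_indic.
  have YZ w : `|Y w - Z w| <= n%:R^-1.
    have /andP[Y0 YM'] := YM w; have := layer_approximation n0 Y0 YM' hK.
    rewrite /Z; congr (`|_ - _ * _| <= _); apply: eq_bigr => j _.
    rewrite indicE; congr (_%:R); congr nat_of_bool; apply/idP/idP.
      by move=> hj; rewrite inE /A /= in_itv/= hj.
    by rewrite inE /A /= in_itv/= andbT.
  have ZE r x : 0 <= r -> mean_rv P (fun w => Z w * at_state r x w) =
      n%:R^-1 * \sum_(j < K) mean_rv P (fun w => \1_(A j) w * at_state r x w).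
    move=> r0; rewrite -mean_rv_sum; last first.
      by move=> j; apply: bounded_rvM; [exact: bounded_rv_indic|exact: bounded_at_state].
    rewrite -mean_rvZ; last first.
      apply: bounded_rv_sum => j.
      by apply: bounded_rvM; [exact: bounded_rv_indic|exact: bounded_at_state].
    by congr (mean_rv P _); apply/funext => w; rewrite /Z -mulrA mulr_suml.
  have DZ : D Z = 0.
    rewrite /D ZE//; apply/eqP; rewrite subr_eq0; apply/eqP.
    under [RHS]eq_bigr do rewrite ZE// mulrCA mulr_sumr.
    rewrite -mulr_sumr exchange_big; congr (_ * _); apply: eq_bigr => j _.
    exact: markov_indic.
  have dm r x : 0 <= r -> `|mean_rv P (fun w => Y w * at_state r x w) -
      mean_rv P (fun w => Z w * at_state r x w)| <= n%:R^-1.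
    move=> r0; have b1 := bounded_rvM bY (bounded_at_state x r0).
    have b2 := bounded_rvM bZ (bounded_at_state x r0).
    rewrite -mean_rvB//; apply: mean_rv_norm_le; first exact: bounded_rvB.
    move=> w; rewrite -mulrBl normrM -[leRHS]mulr1; apply: ler_pM => //.
    by rewrite /at_state; case: (_ == _); rewrite ?normr1 ?normr0.
  have -> : D Y = (mean_rv P (fun w => Y w * at_state t y w) -
      mean_rv P (fun w => Z w * at_state t y w)) +
     (\sum_x p s t x y * mean_rv P (fun w => Z w * at_state s x w) -
      \sum_x p s t x y * mean_rv P (fun w => Y w * at_state s x w)).
    have /eqP := DZ; rewrite /D subr_eq0 => /eqP <-.
    by rewrite addrA subrK.
  rewrite (le_trans (ler_normD _ _))// mulrDl mul1r lerD ?dm//.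
  rewrite -sumrB (le_trans (ler_norm_sum _ _ _))//.
  rewrite [leRHS](_ : _ = \sum_(x : E) n%:R^-1); last by rewrite sumr_const mulr_natl.
  apply: ler_sum => x _.
  rewrite -mulrBr normrM; case: trans => p0 _ _ _ _.
  rewrite ger0_norm ?p0// -[leRHS]mul1r ler_pM ?p0 ?transition_le1//.
  by rewrite distrC dm.
have lim0 : (1 + #|E|%:R) * (n.+1%:R)^-1 @[n --> \oo] --> (1 + #|E|%:R) * (0 : R).
  by apply: cvgMr; exact: cvg_harmonic.
rewrite mulr0 in lim0.
by apply: (ler_cvg_to (cvg_cst _) lim0); apply: nearW => n; exact: bound.
Qed.

Section Bounds.
Variables (T c : R).
Hypothesis c_ge0 : 0 <= c.
Hypothesis c_bound : forall r z, 0 <= r <= T -> `|h r z| <= c.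

Lemma path_integral_norm t w : 0 <= t <= T -> `|path_integral X h t w| <= c * T.
Proof.
move=> /andP[t0 tT]; have e0 : path_integral X h 0 w = 0.
  by rewrite /path_integral set_itv1 Rintegral_set1.
have := path_integral_lip X_rc h_cont c_bound w (lexx 0) t0 tT.
by rewrite e0 !subr0 => /le_trans; apply; rewrite ler_wpM2l.
Qed.

Lemma weight_le t w : 0 <= t <= T -> 0 <= weight t w <= expR (k * (c * T)).
Proof.
move=> tT; rewrite expR_ge0 ler_expR mulNr -mulrN ler_wpM2l//.
have := path_integral_norm w tT; rewrite ler_norml => /andP[h1 _]; lra.
Qed.

Lemma weight_past t : 0 <= t -> measurable_fun setT (weight t : past_space X t -> R).
Proof.
move=> t0; have h1 : measurable_fun setT
    ((fun w => - k * path_integral X h t w) : past_space X t -> R).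
  apply: measurable_funM; first exact: measurable_cst.
  exact: path_integral_past_measurable.
exact: (measurableT_comp (@measurable_expR R) h1).
Qed.

Lemma bounded_weight t : 0 <= t <= T -> bounded_rv (weight t).
Proof.
move=> tT; have /andP[t0 _] := tT; split.
  move=> _ B mB; rewrite setTI; apply: (past_measurable X_meas (t := t)).
  by have := weight_past t0 measurableT mB; rewrite setTI.
exists (expR (k * (c * T))) => w; have /andP[h0 h1] := weight_le w tT.
by rewrite ger0_norm.
Qed.

(** [markov_bounded] applied to the weight, which depends on the path up to time s only. *)
Lemma weighted_law_markov s t phi : 0 <= s <= T -> s <= t ->
  mean_rv P (fun w => weight s w * phi (X t w)) =
  \sum_x weighted_law s x * \sum_y p s t x y * phi y.
Proof.
move=> sT st; have /andP[s0 _] := sT; have t0 := le_trans s0 st.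
have bw := bounded_weight sT.
have b y : bounded_rv (fun w => weight s w * at_state t y w).
  exact: bounded_rvM bw (bounded_at_state y t0).
have -> : mean_rv P (fun w => weight s w * phi (X t w)) =
    \sum_y phi y * mean_rv P (fun w => weight s w * at_state t y w).
  under [RHS]eq_bigr do rewrite -mean_rvZ//.
  rewrite -mean_rv_sum; last by move=> y; exact: bounded_rvZ.
  congr (mean_rv P _); apply/funext => w; rewrite (state_expand t) mulr_sumr.
  by apply: eq_bigr => y _; ring.
under eq_bigr => y _ do rewrite (markov_bounded y s0 st (weight_past s0)
  (fun w => weight_le w sT)) mulr_sumr.
rewrite exchange_big; apply: eq_bigr => x _; rewrite mulr_sumr.
by apply: eq_bigr => y _; rewrite /weighted_law; ring.
Qed.

Lemma weighted_lawE t phi : 0 <= t <= T ->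
  mean_rv P (fun w => weight t w * phi (X t w)) = \sum_x weighted_law t x * phi x.
Proof.
move=> tT; have /andP[t0 _] := tT; rewrite (weighted_law_markov phi tT (lexx t)).
apply: eq_bigr => x _; congr (_ * _); case: trans => _ _ p_id _ _.
rewrite (bigD1 x)//= p_id// eqxx mul1r big1 ?addr0// => y.
by rewrite p_id// eq_sym => /negPf ->; rewrite mul0r.
Qed.

Lemma weighted_law_ge0 t y : 0 <= weighted_law t y.
Proof. by apply: mean_rv_ge0 => w; rewrite mulr_ge0 ?expR_ge0. Qed.

Lemma weight_lip t s w : 0 <= t -> t <= s -> s <= T ->
  `|weight s w - weight t w| <= expR (k * (c * T)) * (k * c) * (s - t).
Proof.
move=> t0 ts sT.
have hl := path_integral_lip X_rc h_cont c_bound w t0 ts sT.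
have st : 0 <= s <= T by rewrite (le_trans t0).
have tt : 0 <= t <= T by rewrite t0 (le_trans ts).
have /andP[ws ws'] := weight_le w st; have /andP[wt wt'] := weight_le w tt.
apply: (le_trans (expR_lip ws' wt')).
rewrite -mulrBr normrM normrN (ger0_norm k_ge0) -[leRHS]mulrA ler_wpM2l ?expR_ge0//.
by rewrite -[leRHS]mulrA ler_wpM2l.
Qed.

End Bounds.

Lemma generator_bound (T : R) phi : exists2 C : R, 0 <= C &
  forall r y, 0 <= r <= T -> `|G r phi y| <= C.
Proof.
have [g hg] : exists g : E -> R -> R, forall y, continuous (g y) /\
    forall r, 0 <= r -> g y r = G r phi y.
  exists (fun y => projT1 (cid2 (G_cont phi y))) => y.
  by case: (cid2 (G_cont phi y)).
have cg : continuous (fun r => \sum_y `|g y r|).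
  by apply: cont_sum => y; apply: cont_norm; case: (hg y).
have [C C0 hC] := continuous_bounded_itv 0 T cg.
exists C => // r y rT; have /andP[r0 _] := rT; have [_ <-//] := hg y.
apply: le_trans (hC r rT); rewrite [leRHS]ger0_norm ?sumr_ge0//.
by rewrite (bigD1 y)//= lerDl sumr_ge0.
Qed.

Lemma potential_bound (T : R) : exists2 c : R, 0 <= c &
  forall r z, 0 <= r <= T -> `|h r z| <= c.
Proof.
have ch : continuous (fun r => \sum_y `|h r y|).
  by apply: cont_sum => y; apply: cont_norm; exact: h_cont.
have [C C0 hC] := continuous_bounded_itv 0 T ch.
exists C => // r y rT; apply: le_trans (hC r rT); rewrite [leRHS]ger0_norm ?sumr_ge0//.
by rewrite (bigD1 y)//= lerDl sumr_ge0.
Qed.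

Lemma transition_lip (T : R) phi : exists2 C : R, 0 <= C &
  forall s t x, 0 <= s -> s <= t -> t <= T ->
  `|\sum_y p s t x y * phi y - phi x| <= C * (t - s).
Proof.
have [C C0 hC] := generator_bound T phi; exists C => // s t x s0 st tT.
case: trans => p0 p1 p_id _ p_fwd.
have [F hF dF] := extend_derivative (fun r sr => p_fwd phi s r x s0 sr).
have h1 r : s <= r <= t -> is_derive r 1 F (\sum_y p s r x y * G r phi y).
  by move=> /andP[sr _]; exact: dF.
have := norm_diff_le_of_derive st h1 (fun r _ => dvZ C (dv_id r)).
rewrite !hF// -mulrBr mulr1.
have -> : \sum_y p s s x y * phi y = phi x.
  rewrite (bigD1 x)//= p_id// eqxx mul1r big1 ?addr0// => y yx.
  by rewrite p_id// eq_sym (negPf yx) mul0r.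
apply=> r /andP[sr rt]; apply: (le_trans (ler_norm_sum _ _ _)).
apply: (@le_trans _ _ (\sum_y p s r x y * C)); last by rewrite -mulr_suml p1 ?mul1r ?mulr1 // ltW.
apply: ler_sum => y _; have p_ge0 := p0 s r x y s0 (ltW sr).
rewrite normrM (ger0_norm p_ge0) ler_wpM2l// hC// (le_trans s0 (ltW sr))/=.
exact: le_trans (ltW rt) tT.
Qed.

(** The mean of weight t times phi (X s) is inserted, to separate the motion of the state from the
    change of the weight. *)
Lemma weighted_law_diff (T c : R) t s phi : 0 <= c ->
  (forall r z, 0 <= r <= T -> `|h r z| <= c) -> 0 <= t -> t <= s -> s <= T ->
  \sum_x weighted_law s x * phi x - \sum_x weighted_law t x * phi x =
  \sum_x weighted_law t x * (\sum_y p t s x y * phi y - phi x) +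
  mean_rv P (fun w => (weight s w - weight t w) * phi (X s w)).
Proof.
move=> c0 hc t0 ts sT.
have s0 := le_trans t0 ts.
have st' : 0 <= s <= T by rewrite s0.
have tt' : 0 <= t <= T by rewrite t0 (le_trans ts).
rewrite -(weighted_lawE c0 hc phi st').
under [X in _ = X + _]eq_bigr do rewrite mulrBr.
rewrite sumrB -(weighted_law_markov c0 hc phi tt' ts).
have -> : mean_rv P (fun w => (weight s w - weight t w) * phi (X s w)) =
   mean_rv P (fun w => weight s w * phi (X s w)) -
   mean_rv P (fun w => weight t w * phi (X s w)).
  rewrite -mean_rvB.
  - by congr (mean_rv P _); apply/funext => w; rewrite mulrBl.
  - exact: bounded_rvM (bounded_weight c0 hc st') (bounded_state phi s0).
  - exact: bounded_rvM (bounded_weight c0 hc tt') (bounded_state phi s0).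
by rewrite [RHS]addrC addrA subrK.
Qed.

Lemma state_norm_le phi s w : `|phi (X s w)| <= \sum_z `|phi z|.
Proof. by rewrite [leRHS](bigD1 (X s w))//= lerDl sumr_ge0. Qed.

Lemma weighted_law_lip (T : R) phi : exists2 C : R, 0 <= C &
  forall t s, 0 <= t -> t <= s -> s <= T ->
  `|\sum_x weighted_law s x * phi x - \sum_x weighted_law t x * phi x| <= C * (s - t).
Proof.
have [c c0 hc] := potential_bound T; have [C C0 hC] := transition_lip T phi.
pose B := \sum_z `|phi z|; have B0 : 0 <= B by exact: sumr_ge0.
pose M := expR (k * (c * T)); have M0 : 0 <= M by exact: expR_ge0.
exists (\sum_(x : E) M * C + M * (k * c) * B).
  by rewrite addr_ge0 ?sumr_ge0// => *; rewrite !mulr_ge0.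
move=> t s t0 ts sT; rewrite (weighted_law_diff phi c0 hc t0 ts sT).
have s0 := le_trans t0 ts; have st' : 0 <= s <= T by rewrite s0.
have tt' : 0 <= t <= T by rewrite t0 (le_trans ts).
rewrite (le_trans (ler_normD _ _))// mulrDl lerD//.
  rewrite (le_trans (ler_norm_sum _ _ _))// mulr_suml; apply: ler_sum => x _.
  rewrite normrM -mulrA; apply: ler_pM => //; last exact: hC.
  apply: mean_rv_norm_le.
    exact: bounded_rvM (bounded_weight c0 hc tt') (bounded_at_state x t0).
  move=> w; have /andP[w0 w1] := weight_le c0 hc w tt'.
  rewrite /at_state; case: (_ == _); rewrite ?mulr1 ?mulr0 ?normr0//.
  by rewrite ger0_norm.
apply: mean_rv_norm_le.
  apply: bounded_rvM (bounded_state phi s0).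
  exact: bounded_rvB (bounded_weight c0 hc st') (bounded_weight c0 hc tt').
move=> w; rewrite normrM mulrAC; apply: ler_pM => //; last exact: state_norm_le.
exact: weight_lip.
Qed.

Definition law_drift t phi : R :=
  \sum_x weighted_law t x * (G t phi x - k * h t x * phi x).

(** Just after t the path is constant, so the weight coincides with the explicit differentiable
    function f. *)
Lemma weight_quotient t w phi : 0 <= t ->
  (weight s w - weight t w) / (s - t) * phi (X s w) @[s --> t^'+] -->
  - (k * h t (X t w)) * weight t w * phi (X t w).
Proof.
move=> t0; pose z := X t w.
pose f s := expR (- k * (path_integral X h t w +
  (primitive (fun r => h r z) s - primitive (fun r => h r z) t))).
have t1 : -1 < t by apply: lt_le_trans t0; rewrite ltrN10.
have df : is_derive t 1 f (f t * (- k * h t z)).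
  apply: (dv_ext _ _ (dv_exp (dvZ (- k) (dvD (dv_cst (path_integral X h t w) t)
    (dvB (dv_primitive (@h_cont z) t1) (dv_cst _ t)))))) => //.
  by rewrite add0r subr0.
have ft : f t = weight t w by rewrite /f subrr addr0.
have tT : 0 <= t < t + 1 by rewrite t0 ltrDl ltr01.
have [c c0 hc] := potential_bound (t + 1).
have [e e0 he] := path_integral_local X_rc h_cont hc w tT.
have [e1 e10 he1] := right_constant X_rc w t0.
have q : (f s - f t) / (s - t) @[s --> t^'+] --> f t * (- k * h t z).
  apply/cvgrPdist_lt => a a0; rewrite near_withinE.
  apply: filterS (quotient_of_is_derive df a0) => s hs ts; apply: hs.
  by rewrite gt_eqF.
have -> : - (k * h t z) * weight t w * phi (X t w) = f t * (- k * h t z) * phi z.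
  by rewrite ft /z; ring.
have q2 : (f s - f t) / (s - t) * phi z @[s --> t^'+] -->
    f t * (- k * h t z) * phi z by apply: cvgM q _; exact: cvg_cst.
apply: (cvg_trans _ q2); apply: near_eq_cvg; rewrite near_withinE.
have e2 : 0 < Num.min e (Num.min e1 1) by rewrite !lt_min e0 e10 ltr01.
exists (Num.min e (Num.min e1 1)) => // s /= hs ts.
have : s < t + Num.min e (Num.min e1 1).
  by move: hs; rewrite distrC gtr0_norm ?subr_gt0// ltrBlDl.
rewrite -ltrBlDl !lt_min !ltrBlDl => /and3P[h1 h2 h3].
rewrite (he1 s (ltW ts) h2) -/z; congr (_ / _ * _).
by rewrite {1}/weight (he s (ltW ts) h1 (ltW h3)) ft.
Qed.

Lemma within_ray_right (f : R -> R) t (l : R) :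
  has_derivative_within `[t, +oo[ f t l ->
  (f s - f t) / (s - t) @[s --> t^'+] --> l.
Proof.
move=> /has_derivative_withinP hf; apply/cvgrPdist_lt => e e0.
rewrite near_withinE; apply: filterS (hf e e0) => s hs ts; apply: hs.
  by rewrite gt_eqF.
by rewrite /= in_itv/= (ltW ts).
Qed.

Lemma weighted_law_right_derivative t phi : 0 <= t ->
  (\sum_x weighted_law s x * phi x - \sum_x weighted_law t x * phi x) / (s - t)
    @[s --> t^'+] --> law_drift t phi.
Proof.
move=> t0; pose T := t + 1; have [c c0 hc] := potential_bound T.
have tT : t <= T by rewrite lerDl.
have tt' : 0 <= t <= T by rewrite t0.
case: trans => p0 p1 p_id _ p_fwd.
have pt (g : E -> R) x : \sum_y p t t x y * g y = g x.
  rewrite (bigD1 x)//= p_id// eqxx mul1r big1 ?addr0// => y yx.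
  by rewrite p_id// eq_sym (negPf yx) mul0r.
have h1 : (\sum_x weighted_law t x *
   ((\sum_y p t s x y * phi y - phi x) / (s - t))) @[s --> t^'+] -->
   \sum_x weighted_law t x * G t phi x.
  apply: cvg_big => [|x _]; first exact: add_continuous.
  apply: cvgM; first exact: cvg_cst.
  have := within_ray_right (p_fwd phi t t x t0 (lexx t)); by rewrite !pt.
(* Cut off outside ]t, T], the quotient is bounded by M for every s, and dominated convergence
   applies along any sequence. *)
pose q s w := if t < s <= T then (weight s w - weight t w) / (s - t) * phi (X s w) else 0.
have bphi := bounded_state phi t0.
have bwt := bounded_weight c0 hc tt'.
have sT s : t < s <= T -> 0 <= s <= T by move=> /andP[/ltW ts ->]; rewrite (le_trans t0 ts).
have bq s : bounded_rv (q s).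
  rewrite /q; case: (boolP (t < s <= T)) => [hs|_]; last exact: bounded_rv_cst.
  have [s0 _] := andP (sT s hs).
  have := bounded_rvZ (s - t)^-1 (bounded_rvM (bounded_rvB (bounded_weight c0 hc (sT s hs)) bwt)
     (bounded_state phi s0)).
  by congr bounded_rv; apply/funext => w; rewrite mulrCA mulrA.
pose B := \sum_z `|phi z|.
pose M := expR (k * (c * T)) * (k * c) * B.
have B0 : 0 <= B by apply: sumr_ge0.
have qM s w : `|q s w| <= M.
  rewrite /q; case: ifP => [/andP[ts sT']|_]; last first.
    by rewrite normr0 !mulr_ge0 ?expR_ge0.
  rewrite normrM; apply: ler_pM => //; last exact: state_norm_le.
  rewrite normrM normfV [`|s - t|]gtr0_norm ?subr_gt0// ler_pdivrMr ?subr_gt0//.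
  exact: (weight_lip c0 hc _ t0 (ltW ts) sT').
pose Y w := - (k * h t (X t w)) * weight t w * phi (X t w).
have YE w : Y w = weight t w * (- (k * h t (X t w)) * phi (X t w)) by rewrite /Y; ring.
have bY : bounded_rv Y.
  rewrite (funext YE); apply: bounded_rvM => //.
  exact: (bounded_state (fun z => - (k * h t z) * phi z)).
have nT : \forall s \near t^'+, t < s <= T.
  rewrite near_withinE; exists (1 : R) => [|s /= hs ts]; first exact: ltr01.
  rewrite ts /=.
  by move: hs; rewrite distrC gtr0_norm ?subr_gt0// ltrBlDl => /ltW.
have h2 : mean_rv P (q s) @[s --> t^'+] --> mean_rv P Y.
  apply/cvg_at_rightP => u [ut uc].
  apply: (mean_rv_cvg (M := M)) => // w.
  have hq : q s w @[s --> t^'+] --> Y w.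
    apply: (cvg_trans _ (@weight_quotient t w phi t0)); apply: near_eq_cvg.
    by apply: filterS nT => s hs; rewrite /q hs.
  by have /cvg_at_rightP /(_ u (conj ut uc)) := hq.
have -> : law_drift t phi = \sum_x weighted_law t x * G t phi x + mean_rv P Y.
  rewrite (funext YE) (weighted_lawE c0 hc (fun z => - (k * h t z) * phi z) tt').
  rewrite -big_split; apply: eq_bigr => x _ /=; ring.
apply: (cvg_trans _ (cvgD h1 h2)); apply: near_eq_cvg; apply: filterS nT => s hs.
have /andP[ts sT'] := hs.
rewrite (weighted_law_diff phi c0 hc t0 (ltW ts) sT') mulrDl mulr_suml; congr (_ + _).
  by apply: eq_bigr => x _; rewrite mulrA.
rewrite mulrC -mean_rvZ.
  by congr (mean_rv P _); apply/funext => w; rewrite /q hs mulrCA mulrA.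
have [s0 _] := andP (sT s hs).
exact: (bounded_rvM (bounded_rvB (bounded_weight c0 hc (sT s hs)) bwt)
     (bounded_state phi s0)).
Qed.

(** Lipschitz continuity on compact intervals, composed with the positive part of time because
    [primitive] wants a function continuous on R. *)
Lemma weighted_law_continuous phi :
  continuous (fun t => \sum_x weighted_law (Num.max t 0) x * phi x).
Proof.
move=> t; pose m s : R := Num.max s 0.
have m0 s : 0 <= m s by rewrite le_max lexx orbT.
have mlip a b : a <= b -> m a <= m b /\ m b - m a <= b - a.
  move=> ab; split; first by rewrite /m ge_max !le_max ab lexx !orbT.
  rewrite lerBlDr ge_max; apply/andP; split.
    by rewrite -[leLHS](subrK a) lerD2l le_max lexx.
  by rewrite addr_ge0 ?subr_ge0.
have [C C0 hC] := weighted_law_lip (m t + 1) phi.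
have key a b : a <= b -> m b <= m t + 1 ->
    `|\sum_x weighted_law (m b) x * phi x - \sum_x weighted_law (m a) x * phi x|
    <= C * (b - a).
  move=> ab hb; have [h1 h2] := mlip a b ab.
  by apply: (le_trans (hC _ _ (m0 a) h1 hb)); rewrite ler_wpM2l.
apply/cvgrPdist_lt => e e0.
have d0 : 0 < Num.min 1 (e / (C + 1)).
  by rewrite lt_min ltr01 divr_gt0// ltr_wpDl.
exists (Num.min 1 (e / (C + 1))) => // s /= hs.
have hs1 : `|t - s| < 1 by apply: lt_le_trans hs _; rewrite ge_min lexx.
have hs2 : C * `|t - s| < e.
  have : `|t - s| < e / (C + 1) by apply: lt_le_trans hs _; rewrite ge_min lexx orbT.
  rewrite ltr_pdivlMr ?ltr_wpDl// => hs3; apply: le_lt_trans hs3.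
  by rewrite mulrC ler_wpM2l ?normr_ge0// lerDl.
apply: le_lt_trans hs2; case/orP: (le_total s t) => st.
  by rewrite [`|t - s|]ger0_norm ?subr_ge0//; apply: key => //; rewrite lerDl.
rewrite distrC (distrC t) [`|s - t|]ger0_norm ?subr_ge0//; apply: key => //.
have [_ h2] := mlip t s st; rewrite -lerBlDl; apply: (le_trans h2).
by move: hs1; rewrite distrC ger0_norm ?subr_ge0// => /ltW.
Qed.

Lemma law_drift_continuous phi : continuous (fun t => law_drift (Num.max t 0) phi).
Proof.
apply: cont_sum => x.
have [g cg hg] := @G_cont phi x.
have cm : continuous (fun t : R => Num.max t 0).
  exact: cont_max (@cont_id R) (@cont_cst R 0).
apply: contM.
  rewrite (_ : (fun t => _) = (fun t : R => \sum_y weighted_law (Num.max t 0) y * (y == x)%:R)).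
    exact: weighted_law_continuous.
  apply/funext => t.
  rewrite (bigD1 x)//= eqxx mulr1 big1 ?addr0// => y /negPf ->.
  by rewrite mulr0.
have -> : (fun t => G (Num.max t 0) phi x - k * h (Num.max t 0) x * phi x) =
   (fun t => g (Num.max t 0) - k * h (Num.max t 0) x * phi x).
  by apply/funext => t; rewrite hg// le_max lexx orbT.
apply: contB; first exact: (cont_comp cg cm).
apply: contM; last exact: cont_cst.
apply: contM; first exact: cont_cst.
exact: (@cont_comp R (fun t => h t x) _ (@h_cont x) cm).
Qed.

Definition law_primitive phi t : R :=
  \sum_x weighted_law 0 x * phi x + primitive (fun r => law_drift (Num.max r 0) phi) t.

Lemma dv_law_primitive phi t : 0 <= t ->
  is_derive t 1 (law_primitive phi) (law_drift t phi).
Proof.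
move=> t0; have t1 : -1 < t by apply: lt_le_trans t0; rewrite ltrN10.
have := dv_primitive (@law_drift_continuous phi) t1.
rewrite (max_l t0) => h1.
by apply: (dv_ext _ _ (dvD (dv_cst (\sum_x weighted_law 0 x * phi x) t) h1)); rewrite ?add0r.
Qed.

(** The two sides are continuous, with the same value at 0 and the same right derivatives;
    [le_of_right_derivative] is applied to their difference and to its opposite. *)
Lemma weighted_law_primitive phi T : 0 <= T ->
  \sum_x weighted_law T x * phi x = law_primitive phi T.
Proof.
move=> T0.
pose U t := \sum_x weighted_law (Num.max t 0) x * phi x.
have UE t : 0 <= t -> U t = \sum_x weighted_law t x * phi x by move=> t0; rewrite /U max_l.
have hr t (e : R) : 0 <= t < T -> 0 < e -> exists2 a : R, 0 < a &
    forall s, t < s -> s < t + a ->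
    `|(U s - law_primitive phi s) - (U t - law_primitive phi t)| <= e * (s - t).
  move=> /andP[t0 tT] e0; have e2 : 0 < e / 2 by rewrite divr_gt0.
  have /cvgrPdist_lt /(_ _ e2) := @weighted_law_right_derivative t phi t0.
  rewrite near_withinE => h1.
  have h2 := quotient_of_is_derive (@dv_law_primitive phi t t0) e2.
  have [a /= a0 ha] := filterI h1 h2; exists a => // s ts sa.
  have [|h3 h4] := ha s; first by rewrite /ball /= distrC gtr0_norm ?subr_gt0//; lra.
  have {}h3 := h3 ts; have {}h4 := h4 (negbT (gt_eqF ts)).
  rewrite !UE ?(le_trans t0 (ltW ts))//.
  have st0 : 0 < s - t by rewrite subr_gt0.
  move: h3 h4.
  set A := \sum_x weighted_law s x * phi x; set A' := \sum_x weighted_law t x * phi x.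
  set V := law_drift t phi; set b := law_primitive phi s; set b' := law_primitive phi t.
  move=> h3 h4.
  have -> : A - b - (A' - b') = (s - t) * ((V - (b - b') / (s - t)) - (V - (A - A') / (s - t))).
    by field; rewrite gt_eqF.
  rewrite normrM gtr0_norm// mulrC ler_wpM2r ?(ltW st0)//.
  apply: (le_trans (ler_normB _ _)); apply: ltW.
  by rewrite [ltRHS]splitr ltrD.
have cf t : 0 <= t <= T -> {for t, continuous (fun s => U s - law_primitive phi s)}.
  move=> /andP[t0 _].
  apply: (@continuousB R R R U (law_primitive phi) t).
    exact: weighted_law_continuous.
  exact: is_derive_continuous (@dv_law_primitive phi t t0).
have U0 : U 0 - law_primitive phi 0 = 0.
  by rewrite UE// /law_primitive primitive0 addr0 subrr.
apply/eqP; rewrite -subr_eq0 -(UE T T0) eq_le; apply/andP; split.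
  rewrite -[leRHS]U0; apply: (le_of_right_derivative T0 cf) => t e tT e0.
  have [a a0 ha] := hr t e tT e0; exists a => // s ts sa.
  exact: le_trans (ler_norm _) (ha s ts sa).
rewrite -oppr_le0 -[leRHS]oppr0 -[X in _ <= - X]U0.
apply: (@le_of_right_derivative R (fun s => - (U s - law_primitive phi s)) T T0).
  by move=> t tT; apply: (@continuousN R R R _ t); exact: cf.
move=> t e tT e0; have [a a0 ha] := hr t e tT e0; exists a => // s ts sa.
by rewrite -opprD; apply: le_trans (ha s ts sa); rewrite -normrN ler_norm.
Qed.

(** Serves to identify the drift of phi with a combination of drifts of indicators, at time 0 as
    well: the corresponding functions are compared at nonnegative times only. *)
Lemma is_derive_right_unique (f g : R -> R) t (l m : R) :
  is_derive t 1 f l -> is_derive t 1 g m -> (forall s, t <= s -> f s = g s) -> l = m.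
Proof.
move=> hf hg fg; apply/eqP; rewrite -subr_eq0 -normr_le0; apply/ler_addgt0Pr => e e0.
have e2 : 0 < e / 2 by rewrite divr_gt0.
have [a /= a0 ha] := filterI (quotient_of_is_derive hf e2) (quotient_of_is_derive hg e2).
have ts : t < t + a / 2 by rewrite ltrDl divr_gt0.
have [|h1 h2] := ha (t + a / 2).
  rewrite /ball /= opprD addrA subrr sub0r normrN gtr0_norm ?divr_gt0//; lra.
have {}h1 := h1 (negbT (gt_eqF ts)); have {}h2 := h2 (negbT (gt_eqF ts)).
rewrite -!fg ?(ltW ts)// in h2.
rewrite add0r (_ : l - m = (l - (f (t + a / 2) - f t) / (t + a / 2 - t)) -
   (m - (f (t + a / 2) - f t) / (t + a / 2 - t))); last by ring.
by apply: (le_trans (ler_normB _ _)); apply: ltW; rewrite [ltRHS]splitr ltrD.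
Qed.

(* The forward equation only gives right derivatives of the law; the law is
   replaced by an extension to negative times which is differentiable on both
   sides at every t >= 0. *)
Lemma weighted_law_forward : exists u : R -> E -> R,
  (forall t x, 0 <= t -> u t x = weighted_law t x) /\
  forall t phi, 0 <= t -> is_derive t 1 (fun r => \sum_x u r x * phi x)
    (\sum_x u t x * (G t phi x - k * h t x * phi x)).
Proof.
pose delta x : E -> R := fun y => (y == x)%:R.
pose u t x := law_primitive (delta x) t.
have uE t x : 0 <= t -> u t x = weighted_law t x.
  move=> t0; rewrite /u -weighted_law_primitive// (bigD1 x)//= /delta eqxx mulr1.
  by rewrite big1 ?addr0// => y /negPf ->; rewrite mulr0.
exists u; split=> // t phi t0.
have h1 : is_derive t 1 (fun r => \sum_x u r x * phi x)
    (\sum_x law_drift t (delta x) * phi x).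
  apply: (@dv_sum R E (index_enum E) predT (fun x r => u r x * phi x)
    (fun x r => law_drift r (delta x) * phi x) t) => x.
  apply: (dv_ext _ _ (dvM (dv_law_primitive (delta x) t0) (dv_cst (phi x) t))) => //.
  by rewrite mulr0 addr0.
have e := is_derive_right_unique h1 (@dv_law_primitive phi t t0) _.
have {}e : \sum_x law_drift t (delta x) * phi x = law_drift t phi.
  apply: e => s ts; have s0 := le_trans t0 ts.
  by rewrite -weighted_law_primitive//; apply: eq_bigr => x _; rewrite uE.
rewrite e in h1; apply: (dv_ext _ _ h1) => //.
by apply: eq_bigr => x _; rewrite uE.
Qed.

End WeightedLaw.

(** * The flow of Gibbs measures *)

Section HalfLine.
Variable R : realType.
Implicit Types (f : R -> R) (t s : R).

Lemma max0_ge0 t : 0 <= Num.max t 0.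
Proof. by rewrite le_max lexx orbT. Qed.

Lemma cont_max0 : continuous (fun t : R => Num.max t 0).
Proof. exact: cont_max (@cont_id R) (@cont_cst R 0). Qed.

Lemma cont_comp_max0 f : (forall t : R, 0 <= t -> {for t, continuous f}) ->
  continuous (fun t : R => f (Num.max t 0)).
Proof.
move=> cf t; apply: (@continuous_comp _ _ _ (fun t : R => Num.max t 0) f).
  exact: cont_max0.
exact/cf/max0_ge0.
Qed.

Lemma within_cont_comp_max0 f : {within `[0, +oo[, continuous f} ->
  continuous (fun t : R => f (Num.max t 0)).
Proof.
move=> /subspace_continuousP cf t; apply/cvgrPdist_lt => e e0.
have t0 : [set` `[0, +oo[ ] (Num.max t 0) by rewrite /= in_itv/= max0_ge0.
have /cvgrPdist_lt /(_ e e0) := cf _ t0; rewrite near_withinE => h.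
have hn : \forall s \near t, `[0, +oo[%classic (Num.max s 0) ->
    `|f (Num.max t 0) - f (Num.max s 0)| < e := @cont_max0 t _ h.
apply: filterS hn => s; apply.
by rewrite /= in_itv/= max0_ge0.
Qed.

(** [derivative_within] is a [lim], and limits are unique along proper filters; every t >= 0 has
    points of the ray to its right. *)
Lemma within_ray_proper t : 0 <= t -> ProperFilter (within [set` `[0, +oo[ ] t^').
Proof.
move=> t0; apply: Build_ProperFilter_ex => A hA.
have {}hA : \forall s \near t, s != t -> s \in `[0, +oo[ -> A s := hA.
have : \forall s \near t^'+, A s.
  rewrite near_withinE; near=> s => ts.
  have : s != t -> s \in `[0, +oo[ -> A s by near: s.
  apply; first by rewrite gt_eqF.
  by rewrite in_itv/= (le_trans t0 (ltW ts)).
by move=> /(@filter_ex _ _ _ _).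
Unshelve. all: by end_near. Qed.

Lemma derivative_withinE f t (l : R) : 0 <= t ->
  has_derivative_within `[0, +oo[ f t l -> derivative_within `[0, +oo[ f t = l.
Proof.
move=> t0 h; have pf := within_ray_proper t0.
by apply: cvg_lim => //; exact: norm_hausdorff.
Qed.

Lemma has_derivative_within_of_is_derive f (F : R -> R) t (l : R) : 0 <= t ->
  (forall s, 0 <= s -> F s = f s) -> is_derive t 1 F l ->
  has_derivative_within `[0, +oo[ f t l.
Proof.
move=> t0 Ff /quotient_of_is_derive h; apply/has_derivative_withinP => e /h.
apply: filterS => s hs st /=; rewrite in_itv/= andbT => s0.
by rewrite -!Ff//; exact: hs.
Qed.

End HalfLine.

Section GibbsFlow.
Variables (R : realType) (S : finType) (mu U : R -> S -> R) (Z : R -> R).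
Hypothesis mu_prob : forall t : R, 0 <= t -> strictly_positive_probability (mu t).
Hypothesis mu_eq : forall t x, 0 <= t -> mu t x = (Z t)^-1 * expR (- U t x) * mu 0 x.
Hypothesis U_C1 : forall x, C1_nonneg (fun t => U t x).

(* nu extends the flow to a neighbourhood of [0, +oo[, so that it is
   differentiable on both sides at 0. *)
Lemma gibbs_flow_regular : exists nu H : R -> S -> R,
  [/\ forall t : R, 0 <= t -> nu t = mu t,
      forall t : R, 0 <= t -> Hfun mu t = H t,
      forall x, continuous (fun t : R => H t x),
      forall x, continuous (fun t : R => nu (Num.max t 0) x) &
      forall (t : R) x, 0 <= t -> is_derive t 1 (fun s => nu s x) (- H t x * nu t x)] /\
  forall t : R, 0 <= t -> pairing (H t) (mu t) = 0.
Proof.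
have hV x : exists VD : (R -> R) * (R -> R), [/\ forall t : R, 0 <= t -> VD.1 t = U t x,
    forall t : R, 0 <= t -> is_derive t 1 VD.1 (VD.2 t) &
    continuous (fun t : R => VD.2 (Num.max t 0))].
  have [u' hu cu] := U_C1 x.
  have [V VU dV] := extend_derivative hu.
  by exists (V, u'); split=> //; exact: within_cont_comp_max0.
have [VD hVD] := choice hV; pose V x := (VD x).1; pose D x := (VD x).2.
have VU x (t : R) : 0 <= t -> V x t = U t x by have [h _ _] := hVD x; exact: h.
have dV x (t : R) : 0 <= t -> is_derive t 1 (V x) (D x t).
  by have [_ h _] := hVD x; exact: h.
have cD x : continuous (fun t : R => D x (Num.max t 0)) by have [_ _ h] := hVD x; exact: h.
have [mu0_gt0 mu0_sum] := mu_prob (lexx 0).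
(* The normalising constant rebuilt from the extended potentials, hence differentiable for t >= 0;
   there the unit mass of [mu t] identifies it with [Z t]. *)
pose W t := \sum_y expR (- V y t) * mu 0 y.
have W_gt0 t : 0 < W t.
  have [x _] : exists x : S, true.
    have : \sum_x mu 0 x != 0 by rewrite mu0_sum oner_eq0.
    case: (pickP (@predT S)) => [x _ _|S0]; first by exists x.
    by rewrite big1 ?eqxx// => x; have := S0 x.
  rewrite /W (bigD1 x)//= ltr_pwDl ?mulr_gt0 ?expR_gt0//.
  by apply: sumr_ge0 => y _; rewrite mulr_ge0 ?expR_ge0// ltW.
pose nu t x := (W t)^-1 * expR (- V x t) * mu 0 x.
have nuE (t : R) : 0 <= t -> nu t = mu t.
  move=> t0; apply/funext => x; rewrite (mu_eq x t0) /nu VU//; congr (_ * _ * _).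
  have [_ mt1] := mu_prob t0.
  have : (Z t)^-1 * W t = 1.
    rewrite -mt1 /W mulr_sumr; apply: eq_bigr => y _.
    by rewrite (mu_eq y t0) VU// mulrA.
  by move=> ZW; apply: (mulIf (lt0r_neq0 (W_gt0 t))); rewrite ZW mulVf ?lt0r_neq0.
have nu_gt0 t x : 0 < nu t x by rewrite /nu !mulr_gt0 ?invr_gt0 ?expR_gt0.
pose m t := \sum_y D y t * nu t y.
have dW (t : R) : 0 <= t -> is_derive t 1 W (- (m t * W t)).
  move=> t0.
  have h : is_derive t 1 W (\sum_y expR (- V y t) * - D y t * mu 0 y).
    apply: (@dv_sum R S (index_enum S) predT (fun y s => expR (- V y s) * mu 0 y)
      (fun y s => expR (- V y s) * - D y s * mu 0 y) t) => y.
    apply: (dv_ext _ _ (dvM (dv_exp (dvN (dV y t t0))) (dv_cst (mu 0 y) t))) => //.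
    by rewrite mulr0 addr0.
  apply: (dv_ext _ _ h) => //; rewrite /m mulr_suml -sumrN; apply: eq_bigr => y _.
  by rewrite /nu; field; exact: lt0r_neq0.
have dnu (t : R) x : 0 <= t -> is_derive t 1 (fun s => nu s x) (- (D x t - m t) * nu t x).
  move=> t0; have Wt := lt0r_neq0 (W_gt0 t).
  apply: (dv_ext _ _ (dvM (dvM (dv_inv Wt (dW t t0)) (dv_exp (dvN (dV x t t0))))
    (dv_cst (mu 0 x) t))) => //.
  by rewrite /nu; field.
have cnu x : continuous (fun t : R => nu (Num.max t 0) x).
  by apply: (@cont_comp_max0 _ (fun t => nu t x)) => t /(dnu t x) /is_derive_continuous.
pose H t x := D x (Num.max t 0) - m (Num.max t 0).
have HE t x : 0 <= t -> H t x = D x t - m t by move=> t0; rewrite /H max_l.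
exists nu, H; split; first split=> //.
- move=> t t0; apply/funext => x; rewrite /Hfun HE//; apply/eqP; rewrite eqr_oppLR; apply/eqP.
  have hd : is_derive t 1 (fun s => ln (nu s x)) (- (D x t - m t)).
    apply: (dv_ext _ _ (@dv_ln R (fun s => nu s x) t _ (nu_gt0 t x) (dnu t x t0))) => //.
    by rewrite mulfK// lt0r_neq0.
  apply: derivative_withinE => //.
  apply: (@has_derivative_within_of_is_derive R _ _ t _ t0 _ hd).
  by move=> s s0; rewrite nuE.
- move=> x; apply: contB; first exact: cD.
  apply: cont_sum => y; apply: contM; first exact: cD.
  exact: cnu.
- by move=> t x t0; rewrite HE//; exact: dnu.
move=> t t0; rewrite /pairing; under eq_bigr do rewrite HE// mulrBl.
have [_ mt1] := mu_prob t0.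
rewrite sumrB -mulr_sumr mt1 mulr1 /m; apply/eqP; rewrite subr_eq0; apply/eqP.
by apply: eq_bigr => x _; rewrite nuE.
Qed.

End GibbsFlow.

(** * Consequences of the bound on lambda *)

Section SupQuotient.
Variables (R : realType) (S : finType).
Implicit Types (D : set (S -> R)) (num den : (S -> R) -> R) (f : S -> R) (c : R).

(** A zero denominator forces [num f <= 0], since a positive numerator would put +oo among the
    quotients. This also covers the empty supremum, where every denominator is zero. *)
Lemma le_sup_quotient D num den c f : D f -> 0 <= den f ->
  (sup_quotient D num den <= c%:E)%E -> num f <= c * den f.
Proof.
move=> Df d0; rewrite /sup_quotient; case: asboolP => [q0 _|_ le_c].
  have [d_eq|d_neq] := eqVneq (den f) 0.
    rewrite d_eq mulr0 leNgt; apply/negP => n0.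
    suff : quotients D num den +oo%E by rewrite q0.
    by exists f => //; right.
  suff : quotients D num den (num f / den f)%:E by rewrite q0.
  by exists f => //; left.
have [d_eq|d_neq] := eqVneq (den f) 0.
  rewrite d_eq mulr0 leNgt; apply/negP => n0.
  have : (+oo <= c%:E)%E; last by rewrite leNgt ltry.
  by apply: le_trans le_c; apply: ereal_sup_ubound; exists f => //; right.
rewrite -ler_pdivrMr ?lt_neqAle 1?eq_sym ?d_neq// -lee_fin.
by apply: le_trans le_c; apply: ereal_sup_ubound; exists f => //; left.
Qed.

Lemma sup_quotient_gtNy D num den : (-oo < sup_quotient D num den)%E.
Proof.
rewrite /sup_quotient; case: asboolP => [_|]; first by rewrite ltNyr.
move=> /eqP /set0P [v Dv]; apply: lt_le_trans (ereal_sup_ubound Dv).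
by case: Dv => f _ [[_ ->]|[_ _ ->]]; rewrite ?ltNyr.
Qed.

Lemma sup_quotient_ge0 D num den : (forall f, D f -> 0 <= num f) ->
  (forall f, D f -> 0 <= den f) -> (0 <= sup_quotient D num den)%E.
Proof.
move=> num0 den0; rewrite /sup_quotient; case: asboolP => [_//|].
move=> /eqP /set0P [v Dv]; apply: le_trans (ereal_sup_ubound Dv).
by case: Dv => f Df [[_ ->]|[_ _ ->]]; rewrite ?leey// lee_fin divr_ge0 ?num0 ?den0.
Qed.

End SupQuotient.

Section LambdaBound.
Variables (R : realType) (S : finType) (nu : S -> R) (Q : S -> S -> R) (h : S -> R).
Variables (lam : R).
Hypothesis nu_prob : strictly_positive_probability nu.
Hypothesis Q_gen : Qmatrix Q.
Hypothesis Q_rev : detailed_balance nu Q.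

Let den_ge0 f : 0 <= dirichlet nu Q f.
Proof. exact: dirichlet_ge0. Qed.

(** Because A > -oo and B >= 0, an infinite term would make the extended sum +oo, against the real
    bound lam; the two suprema can then be used separately. *)
Lemma weighted_poincare (a b : R) f : 0 < a -> 0 <= b ->
  (a%:E * constA nu Q h + b%:E * constB nu Q h <= lam%:E)%E ->
  pairing f nu = 0 ->
  - a * pairing (fun x => h x * f x ^+ 2) nu +
    b * pairing (fun x => h x * f x) nu ^+ 2 <= lam * dirichlet nu Q f.
Proof.
move=> a0 b0 le_lam f0.
have [fE|fN] := pselect (f = cst 0).
  have p0 (g : S -> R) : (forall x, g x = 0) -> pairing g nu = 0.
    by move=> g0; rewrite /pairing big1// => x _; rewrite g0 mul0r.
  rewrite fE !p0; try by move=> x; rewrite /= ?expr0n ?mulr0.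
  rewrite (_ : dirichlet _ _ _ = 0) ?expr0n ?mulr0 ?addr0//.
  by rewrite /dirichlet p0 ?oppr0// => x; rewrite mul0r.
have Sf : S0 nu f by [].
have ANy : (-oo < constA nu Q h)%E by exact: sup_quotient_gtNy.
have B_ge0 : (0 <= constB nu Q h)%E.
  by apply: sup_quotient_ge0 => // g _; rewrite exprn_ge0.
have hA c := @le_sup_quotient R S (S0 nu) (fun f => - pairing (fun x => h x * f x ^+ 2) nu)
  (dirichlet nu Q) c f Sf (den_ge0 f).
have hB c := @le_sup_quotient R S (S0 nu) (fun f => `|pairing (fun x => h x * f x) nu| ^+ 2)
  (dirichlet nu Q) c f Sf (den_ge0 f).
rewrite -/(constA nu Q h) in hA; rewrite -/(constB nu Q h) in hB.
move: ANy B_ge0 le_lam hA hB (den_ge0 f).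
move: (constA nu Q h) (constB nu Q h) => A B.
rewrite real_normK ?num_real//.
move: (pairing (fun x => h x * f x ^+ 2) nu) (pairing (fun x => h x * f x) nu) => u v.
move: (dirichlet nu Q f) => D.
case: A => [A| |]//; last first.
  move=> _ B0; rewrite gt0_muley ?lte_fin//.
  have bB0 : (0 <= b%:E * B)%E by rewrite mule_ge0// lee_fin.
  by move: bB0; case: (b%:E * B)%E => [x| |]//=.
move=> _ B0 le_lam hA hB D0; have {}hA := hA A (lexx _).
(* For b = 0, which is the case t0 = 0, the product b B is 0 even if B = +oo, so nothing can be
   inferred on B. *)
have [b_eq|b_neq] := eqVneq b 0.
  move: le_lam; rewrite b_eq mul0e adde0 mul0r addr0 -EFinM lee_fin => h1.
  have h2 : a * - u <= a * (A * D) by rewrite ler_wpM2l// ltW.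
  have h3 : a * A * D <= lam * D by rewrite ler_wpM2r.
  by rewrite mulNr -mulrN (le_trans h2)// mulrA.
have b_gt0 : 0 < b by rewrite lt_neqAle eq_sym b_neq.
case: B B0 hB le_lam => [B| |]//.
  move=> B0 hB; have {}hB := hB B (lexx _).
  rewrite -!EFinM -EFinD lee_fin => h1.
  have h2 : a * - u <= a * (A * D) by rewrite ler_wpM2l// ltW.
  have h3 : (a * A + b * B) * D <= lam * D by rewrite ler_wpM2r.
  have h4 : b * v ^+ 2 <= b * (B * D) by rewrite ler_wpM2l.
  rewrite (le_trans _ h3)// mulrDl mulNr -mulrN -!mulrA; exact: lerD.
by rewrite gt0_muley ?lte_fin// -EFinM.
Qed.

Lemma weighted_log_sobolev (c : R) f : 0 <= c -> 0 <= lam ->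
  (c%:E * const_gamma nu Q <= lam%:E)%E -> pairing (fun x => f x ^+ 2) nu = 1 ->
  c * pairing (fun x => f x ^+ 2 * ln `|f x|) nu <= lam * dirichlet nu Q f.
Proof.
move=> c0 lam0 le_lam f1.
have rhs0 : 0 <= lam * dirichlet nu Q f by rewrite mulr_ge0.
(* The constant 1 does not belong to [S1]; for it the entropy vanishes and the right-hand side is
   nonnegative. *)
have [fE|fN] := pselect (f = cst 1).
  rewrite fE in rhs0 *.
  by rewrite /pairing big1 ?mulr0// => x _; rewrite normr1 ln1 mulr0 mul0r.
have Sf : S1 nu f by [].
have gNy : (-oo < const_gamma nu Q)%E by exact: sup_quotient_gtNy.
have hg k := @le_sup_quotient R S (S1 nu) (fun f => pairing (fun x => f x ^+ 2 * ln `|f x|) nu)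
  (dirichlet nu Q) k f Sf (den_ge0 f).
rewrite -/(const_gamma nu Q) in hg.
move: gNy le_lam hg (den_ge0 f) rhs0; move: (const_gamma nu Q) => g.
move: (pairing _ nu) (dirichlet nu Q f) => u D.
have [->|c_neq] := eqVneq c 0; first by rewrite mul0r.
have c_gt0 : 0 < c by rewrite lt_neqAle eq_sym c_neq.
case: g => [g| |]//; last by rewrite gt0_muley ?lte_fin.
rewrite -EFinM lee_fin => _ h1 /(_ g (lexx _)) h2 D0 _.
have h3 : c * u <= c * (g * D) by rewrite ler_wpM2l.
by rewrite (le_trans h3)// mulrA ler_wpM2r.
Qed.

End LambdaBound.

Section Oscillation.
Variables (R : realType) (S : finType).
Implicit Types (g : S -> R) (x y : S).

Lemma range_has_sup g x : has_sup (range g) /\ has_inf (range g).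
Proof.
have b y : `|g y| <= \sum_z `|g z| by rewrite (bigD1 y)//= lerDl sumr_ge0.
split; (split; first by exists (g x); exists x).
  by exists (\sum_z `|g z|) => _ [y _ <-]; exact: le_trans (ler_norm _) (b y).
by exists (- \sum_z `|g z|) => _ [y _ <-]; rewrite lerNl (le_trans _ (b y))// -normrN ler_norm.
Qed.

Lemma diff_le_osc g x y : g x - g y <= osc g.
Proof.
have [[_ us] [_ ui]] := range_has_sup g x.
apply: lerB; first by apply: ub_le_sup => //; exists x.
by apply: ge_inf => //; exists y.
Qed.

Lemma osc_le g x (c : R) : (forall y, `|g y| <= c) -> osc g <= 2 * c.
Proof.
move=> gc; rewrite mulr2n mulrDl mul1r -{2}(opprK c); apply: lerB.
  by apply: ge_sup => [|_ [y _ <-]]; [exists (g x); exists x|exact: le_trans (ler_norm _) (gc y)].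
apply: lb_le_inf => [|_ [y _ <-]]; first by exists (g x); exists x.
by rewrite lerNl (le_trans _ (gc y))// -normrN ler_norm.
Qed.

(** A real [sup] is an upper bound only of a bounded set; boundedness comes from the continuity of H
    on the compact time interval. *)
Lemma diff_le_sup_osc (mu H : R -> S -> R) (t0 : R) :
  (forall t, 0 <= t -> Hfun mu t = H t) -> (forall x, continuous (fun t : R => H t x)) ->
  forall s x y, 0 <= s <= t0 -> H s x - H s y <= sup_osc mu t0.
Proof.
move=> HE cH s x y st; have [C C0 hC] := potential_bound cH t0.
have /andP[s0 _] := st.
apply: le_trans (diff_le_osc _ _ _) _; rewrite -HE//; apply: ub_le_sup; last by exists s.
exists (2 * C) => _ [t /= tt0 <-]; have /andP[t_ge0 _] : 0 <= t <= t0 by [].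
by rewrite HE//; apply: (osc_le x) => z; exact: hC.
Qed.

End Oscillation.

(** The first two entries of the maximum are the ratios (p_2 - 1) / (p_1 - 1) for the steps from p
    to 2r and from p/2 to p; the latter exceeds 1. *)
Lemma a_const_bounds (R : realType) (p ptilde r : R) : 2 < p ->
  [/\ 0 < a_const p ptilde r, p - 1 <= (p / 2 - 1) * expR (a_const p ptilde r) &
      2 * r - 1 <= (p - 1) * expR (a_const p ptilde r)].
Proof.
move=> p2; rewrite /a_const; set m := Num.max _ _.
have m1 : (2 * r - 1) / (p - 1) <= m by rewrite le_max lexx.
have m2 : (2 * p - 2) / (p - 2) <= m by rewrite /m !le_max lexx !orbT.
have m_gt1 : 1 < m.
  by apply: lt_le_trans m2; rewrite ltr_pdivlMr ?subr_gt0//; lra.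
have m_gt0 : 0 < m by exact: lt_trans m_gt1.
clearbody m; rewrite lnK ?posrE//; split; first exact: ln_gt0 m_gt1.
  by move: m2; rewrite ler_pdivrMr ?subr_gt0//; lra.
by move: m1; rewrite ler_pdivrMr ?subr_gt0 ?(lt_trans _ p2)//; lra.
Qed.

(** * The particle system *)

Lemma pairing_empirical_norm_le (R : realType) (S : finType) (N : nat) (f : S -> R) (c : R)
    (x : {ffun 'I_N -> S}) : (0 < N)%N -> (forall y, `|f y| <= c) ->
  `|pairing f (empirical R x)| <= c.
Proof.
move=> N0 fc; have NR : 0 < (N%:R : R) by rewrite ltr0n.
rewrite pairing_empirical normrM ger0_norm ?invr_ge0 ?(ltW NR)//.
rewrite mulrC ler_pdivrMr// (le_trans (ler_norm_sum _ _ _))//.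
have := @ler_sum R 'I_N (index_enum _) predT (fun i => `|f (x i)|) (fun=> c) (fun i _ => fc (x i)).
by move=> /le_trans; apply; rewrite sumr_const card_ord mulr_natr.
Qed.

Lemma particle_generator_continuous (R : realType) (S : finType) (N : nat)
    (lam : R -> R) (L : R -> S -> S -> R) (H : R -> S -> R)
    (phi : {ffun 'I_N -> S} -> R) x :
  continuous lam -> (forall y z, continuous (fun t : R => L t y z)) ->
  (forall y, continuous (fun t : R => H t y)) ->
  continuous (fun t : R => particle_generator (lam t) (L t) (H t) phi x).
Proof.
move=> clam cL cH; rewrite /particle_generator /gen_component /gen_apply.
apply: contD.
  apply: contM => //; apply: cont_sum => i; apply: cont_sum => y.
  by apply: contM; [exact: cL|exact: cont_cst].
apply: contM; first exact: cont_cst.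
apply: cont_sum => i; apply: cont_sum => j.
apply: contM; last exact: cont_cst.
by apply: cont_max; [apply: contB; exact: cH|exact: cont_cst].
Qed.

Lemma Lp_norm_continuous (R : realType) (S : finType) (p : R) (nu f : R -> S -> R) :
  0 < p -> (forall t x, 0 <= nu t x) ->
  (forall x, continuous (fun t : R => nu t x)) ->
  (forall x, continuous (fun t : R => f t x)) ->
  continuous (fun t : R => Lp_norm p (nu t) (f t)).
Proof.
move=> p0 nu0 cnu cf.
rewrite (_ : (fun t => _) = fun t =>
    `|pairing (fun x => `|f t x| `^ p) (nu t)| `^ p^-1); last first.
  apply/funext => t; rewrite ger0_norm//; apply: sumr_ge0 => x _.
  by rewrite mulr_ge0 ?powR_ge0.
have pV0 : 0 < p^-1 by rewrite invr_gt0.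
apply: (cont_comp (continuous_norm_powR pV0)); apply: cont_sum => x.
by apply: contM (cnu x); exact: cont_comp (continuous_norm_powR p0) (@cf x).
Qed.

Section ParticleMoments.
Context {R : realType} (S : finType) (N : nat) {d : measure_display} {Omega : measurableType d}.
Local Notation config := {ffun 'I_N -> S}.
Local Notation mean f x := (pairing f (empirical R x)).
Variables (P : probability Omega R) (X : R -> Omega -> config) (H : R -> S -> R).
Variables (G : R -> (config -> R) -> config -> R) (p : R -> R -> config -> config -> R).
Hypothesis X_meas : forall t z, 0 <= t -> measurable (X t @^-1` [set z]).
Hypothesis X_rc : forall w t, 0 <= t -> \forall s \near t^'+, X s w = X t w.
Hypothesis H_cont : forall z, continuous (fun t : R => H t z).
Hypothesis trans : transition_function G p.
Hypothesis markov : forall s t A y, 0 <= s -> s <= t -> natural_filtration X s A ->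
  P (A `&` X t @^-1` [set y]) =
  (\sum_x (p s t x y)%:E * P (A `&` X s @^-1` [set x]))%E.

Definition mean_potential t (x : config) : R := mean (H t) x.

Lemma mean_potential_continuous x : continuous (fun t : R => mean_potential t x).
Proof.
by apply: cont_sum => y; apply: contM; [exact: H_cont|exact: cont_cst].
Qed.

Local Notation law k := (weighted_law P X mean_potential k).

Let deviation t f c w := weight X mean_potential 1 t w * mean f (X t w) - c.

(** Squaring doubles the exponent of the weight, which is why the laws with k = 1 and k = 2
    suffice. *)
Lemma nu_process_second_moment t (f : S -> R) c : 0 <= t ->
  bounded_rv (fun w => deviation t f c w ^+ 2) /\
  mean_rv P (fun w => deviation t f c w ^+ 2) =
  \sum_x law 2 t x * mean f x ^+ 2 - 2 * c * (\sum_x law 1 t x * mean f x) + c ^+ 2.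
Proof.
move=> t0; have tt' : 0 <= t <= t by rewrite t0 lexx.
have [b b0 hb] := potential_bound mean_potential_continuous t.
pose Y2 w := weight X mean_potential 2 t w * mean f (X t w) ^+ 2.
pose Y1 w := weight X mean_potential 1 t w * mean f (X t w).
have bw k : 0 <= k -> bounded_rv (weight X mean_potential k t).
  by move=> k0; exact: (bounded_weight X_meas X_rc mean_potential_continuous k0 b0 hb tt').
have bY2 : bounded_rv Y2.
  by apply: bounded_rvM; [exact: bw|exact: (bounded_state X_meas (fun x => mean f x ^+ 2))].
have bY1 : bounded_rv Y1.
  by apply: bounded_rvM; [exact: bw|exact: (bounded_state X_meas (fun x => mean f x))].
have -> : (fun w => deviation t f c w ^+ 2) = fun w => Y2 w - 2 * c * Y1 w + c ^+ 2.
  apply/funext => w; rewrite /deviation /Y2 /Y1 /weight.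
  rewrite (_ : expR (- 2 * _) = expR (- 1 * path_integral X mean_potential t w) ^+ 2).
    ring.
  by rewrite -expRM_natl; congr expR; ring.
have bZ := bounded_rvZ (2 * c) bY1; have bB := bounded_rvB bY2 bZ.
split; first exact: bounded_rvD bB (bounded_rv_cst _).
rewrite (mean_rvD P bB (bounded_rv_cst _)) (mean_rvB P bY2 bZ) (mean_rvZ P _ bY1) mean_rv_cst.
have k1 : 0 <= (1 : R) by []; have k2 : 0 <= (2 : R) by [].
rewrite (weighted_lawE X_meas X_rc mean_potential_continuous trans markov k2 b0 hb
  (fun x => mean f x ^+ 2) tt').
by rewrite (weighted_lawE X_meas X_rc mean_potential_continuous trans markov k1 b0 hb
  (fun x => mean f x) tt').
Qed.

Lemma nu_process_variance mu t (f : S -> R) c : 0 <= t ->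
  (forall s : R, 0 <= s -> Hfun mu s = H s) ->
  expectation P (fun w => `|pairing f (nu_process mu X t w) - c| ^+ 2) =
  (\sum_x law 2 t x * mean f x ^+ 2 - 2 * c * (\sum_x law 1 t x * mean f x) + c ^+ 2)%:E.
Proof.
move=> t0 HE; have [bY <-] := nu_process_second_moment f c t0.
rewrite -expectation_mean_rv//; congr (expectation P); apply/funext => w.
rewrite real_normK ?num_real//; congr (_ ^+ 2); congr (_ - _).
rewrite /nu_process /weight mulN1r.
have -> : \int[lebesgue_measure]_(s in `[0, t]) pairing (Hfun mu s) (empirical R (X s w)) =
    path_integral X mean_potential t w.
  apply: eq_Rintegral => s; rewrite inE /= in_itv/= => /andP[s0 _].
  by rewrite HE.
by rewrite /pairing mulr_sumr; apply: eq_bigr => y _; rewrite mulrCA.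
Qed.

Lemma weighted_law_init k x : law k 0 x = fine (P (X 0 @^-1` [set x])).
Proof.
rewrite -mean_rv_indic; last exact: X_meas.
rewrite -at_stateE; congr (mean_rv P _); apply/funext => w.
rewrite /weight (_ : path_integral _ _ 0 w = 0) ?mulr0 ?expR0 ?mul1r//.
by rewrite /path_integral set_itv1 Rintegral_set1.
Qed.

End ParticleMoments.

(** Put x = 1/n and y = k x, both at most 1/40. The recursion reads e (1 - D) <= B with D <= 21/10 x
    + 10 y and B <= 10/11 (2 + 8 k2) x, and the claim reduces to (1 + 16 y) (1 - D) >= 10/11. In
    this product 16 y outweighs 10 y and the quadratic terms. *)
Lemma variance_closure (R : realType) (n k2 k m e : R) :
  0 <= k2 -> 0 <= k -> k <= m -> 1 <= m -> 40 * m <= n -> 0 <= e ->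
  n * e <= 17 / 15 * (1 + 17 / 15 * e) * (299 / 187)
    + 70 / 11 * k2 + (17 / 15) ^+ 2 * (84 / 11) * e * k ->
  e <= (2 + 8 * k2) * n^-1 * (1 + 16 * k * n^-1).
Proof.
move=> k2_0 k0 km m1 mn e0 h; have n0 : 0 < n by lra.
have : n^-1 <= 40^-1 by rewrite lef_pV2 ?posrE//; lra.
have : n * n^-1 = 1 by rewrite mulfV ?gt_eqF.
have : 0 < n^-1 by rewrite invr_gt0.
move: (n^-1) => x x0 nx x40.
have [y yE] : exists y, y = k * x by exists (k * x).
have y0 : 0 <= y by rewrite yE mulr_ge0// ltW.
have y40 : y <= 40^-1.
  have : k * x <= n / 40 * x by rewrite ler_wpM2r ?(ltW x0)//; lra.
  by rewrite -yE mulrAC nx mul1r.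
have -> : 16 * k * x = 16 * y by rewrite yE mulrA.
have : e <= x * (17 / 15 * (299 / 187) + 70 / 11 * k2) +
    e * (17 / 15 * (17 / 15) * (299 / 187) * x + (17 / 15) ^+ 2 * (84 / 11) * y).
  have := ler_wpM2l (ltW x0) h; rewrite [leLHS]mulrA [x * n]mulrC nx mul1r => /le_trans; apply.
  by rewrite le_eqVlt yE; apply/orP; left; apply/eqP; ring.
have : 17 / 15 * (17 / 15) * (299 / 187) * x + (17 / 15) ^+ 2 * (84 / 11) * y <=
    21 / 10 * x + 10 * y.
  by apply: lerD; apply: ler_wpM2r; rewrite ?(ltW x0)//; lra.
have : x * (17 / 15 * (299 / 187) + 70 / 11 * k2) <= 10 / 11 * ((2 + 8 * k2) * x).
  by rewrite [leLHS]mulrC [leRHS]mulrA; apply: ler_wpM2r; [exact: ltW|lra].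
have : 0 <= (2 + 8 * k2) * x by rewrite mulr_ge0 ?(ltW x0)//; lra.
clear h km m1 mn n0 nx yE.
move: (17 / 15 * (17 / 15) * (299 / 187) * x + (17 / 15) ^+ 2 * (84 / 11) * y) ((2 + 8 * k2) * x) (x * _) => D A B A0 BA DE hB.
have h2 : 10 / 11 <= (1 + 16 * y) * (1 - D).
  have : (1 + 16 * y) * (1 - (21 / 10 * x + 10 * y)) <= (1 + 16 * y) * (1 - D).
    by apply: ler_wpM2l; lra.
  apply: le_trans.
  have xy : x * y <= 40^-1 * y by rewrite ler_wpM2r.
  have yy : y * y <= 40^-1 * y by rewrite ler_wpM2r.
  lra.
have D1 : 0 < 1 - D by lra.
rewrite -(ler_pM2r D1) mulrBr mulr1 lerBlDr.
apply: (le_trans hB); rewrite lerD2r; apply: (le_trans BA).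
by rewrite -[leRHS]mulrA [leLHS]mulrC; exact: ler_wpM2l.
Qed.

Lemma Kfun_primitive (R : realType) (S : finType) (mu nu H : R -> S -> R) (v : R) : 0 < v ->
  (forall s : R, 0 <= s -> strictly_positive_probability (nu s)) ->
  (forall s : R, 0 <= s -> nu s = mu s) ->
  (forall s : R, 0 <= s -> Hfun mu s = H s) ->
  (forall x, continuous (fun s : R => H s x)) ->
  (forall x, continuous (fun s : R => nu (Num.max s 0) x)) ->
  exists K : R -> R, [/\ forall s : R, 0 <= s -> is_derive s 1 K (Lp_norm v (nu s) (H s)),
    K 0 = 0, forall s : R, 0 <= s -> Kfun mu s v = K s &
    forall a b : R, 0 <= a -> a <= b -> K a <= K b].
Proof.
move=> v0 nu_prob nuE HE cH cnu.
pose g (s : R) := Lp_norm v (nu (Num.max s 0)) (H s).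
have cg : continuous g.
  apply: Lp_norm_continuous => // s x.
  by have [h0 _] := nu_prob _ (max0_ge0 s); exact/ltW/h0.
have gE (s : R) : 0 <= s -> g s = Lp_norm v (nu s) (H s) by move=> s0; rewrite /g max_l.
have dK (s : R) : 0 <= s -> is_derive s 1 (primitive g) (Lp_norm v (nu s) (H s)).
  move=> s0; have s1 : -1 < s by apply: lt_le_trans s0; rewrite ltrN10.
  by have := dv_primitive cg s1; rewrite gE.
exists (primitive g); split => //; first exact: primitive0.
  move=> s s0; rewrite (primitiveE cg s0).
  apply: eq_Rintegral => u; rewrite inE /= in_itv/= => /andP[u0 _].
  by rewrite gE// HE// nuE.
move=> a b a0 ab; apply: (le_of_derive_ge0 ab (df := fun s => Lp_norm v (nu s) (H s))).
  by move=> s /andP[as_ _]; apply: dK => //; exact: le_trans as_.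
by move=> s _; exact: Lp_norm_ge0.
Qed.

Theorem theorem2p6 (R : realType) (S : finType)
  (mu U : R -> S -> R) (Z : R -> R)
  (mu_prob : forall t, 0 <= t -> strictly_positive_probability (mu t))
  (mu_eq : forall t x, 0 <= t -> mu t x = (Z t)^-1 * expR (- U t x) * mu 0 x)
  (U_C1 : forall x, C1_nonneg (fun t => U t x))
  (L : R -> S -> S -> R)
  (L_gen : forall t, 0 <= t -> Qmatrix (L t))
  (L_cont : forall x y, {within `[0, +oo[, continuous (fun t => L t x y)})
  (L_rev : forall t, 0 <= t -> detailed_balance (mu t) (L t))
  (lambda : R -> R)
  (lambda_ge0 : forall t, 0 <= t -> 0 <= lambda t)
  (lambda_cont : {within `[0, +oo[, continuous lambda})
  (N : nat) (d : measure_display) (Omega : measurableType d)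
  (P : probability Omega R) (X : R -> Omega -> {ffun 'I_N -> S})
  (X_markov : markov_process P X
     (fun t => particle_generator (lambda t) (L t) (Hfun mu t))
     (product_law (mu 0)))
  (t0 q p ptilde r : R)
  (t0_ge0 : 0 <= t0)
  (q_gt6 : 6 < q)
  (p_gt : 4 * q / (q - 2) < p) (p_lt : p < q)
  (ptildeE : ptilde^-1 = q^-1 + 2 * p^-1)
  (rE : p^-1 = q^-1 + r^-1)
  (N_ge : 40 * Num.max (Kfun mu t0 q) 1 <= N%:R)
  (lambda_ge : forall s, 0 <= s <= t0 ->
     (maxe
        ((p / 4)%:E * constA (mu s) (L s) (Hfun mu s)
         + (p * (p + 3) / 4 * t0)%:E * constB (mu s) (L s) (Hfun mu s))
        ((17 / 4 * a_const p ptilde r * sup_osc mu t0)%:E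
         * const_gamma (mu s) (L s))
      <= (lambda s)%:E)%E) :
  forall t, 0 <= t <= t0 ->
    (epsilon mu P X t p <=
     ((2 + 8 * Kfun mu t 2) * N%:R^-1 * (1 + 16 * Kfun mu t q * N%:R^-1))%:E)%E.
Proof.
have [nu [H [[nuE HE cH cnu dnu] H_mean]]] := gibbs_flow_regular mu_prob mu_eq U_C1.
have [X_meas X_rc X_init [tp trans markov]] := X_markov.
have nu_prob s : 0 <= s -> strictly_positive_probability (nu s).
  by move=> s0; rewrite nuE//; exact: mu_prob.
(* Frozen at negative times, the coefficients become continuous on all of R. *)
pose Lm (s : R) := L (Num.max s 0); pose lamm (s : R) := lambda (Num.max s 0).
have cL x y : continuous (fun s : R => Lm s x y) by exact: (within_cont_comp_max0 (L_cont x y)).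
have clam : continuous lamm by exact: within_cont_comp_max0 lambda_cont.
have LmE (s : R) : 0 <= s -> Lm s = L s by move=> s0; rewrite /Lm max_l.
have lamE (s : R) : 0 <= s -> lamm s = lambda s by move=> s0; rewrite /lamm max_l.
pose w := sup_osc mu t0.
have H_osc s x y : 0 <= s <= t0 -> H s x - H s y <= w by exact: (diff_le_sup_osc HE cH).
have N_gt0 : (0 < N)%N.
  rewrite -(ltr0n R); apply: lt_le_trans N_ge; rewrite mulr_gt0//.
  by rewrite lt_max ltr01 orbT.
have [x0 _] : exists x : S, true.
  have [_ s1] := mu_prob 0 (lexx 0); have : \sum_x mu 0 x != 0 by rewrite s1 oner_eq0.
  case: (pickP (@predT S)) => [x _ _|S0]; first by exists x.
  by rewrite big1 ?eqxx// => x; have := S0 x.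
have T0 : 0 <= (0 : R) <= t0 by rewrite lexx.
have w_ge0 : 0 <= w by have := H_osc 0 x0 x0 T0; rewrite subrr.
have q0 : 0 < q by lra.
have q2 : 0 < q - 2 by lra.
have p4 : 4 < p by apply: lt_trans p_gt; rewrite ltr_pdivlMr//; lra.
have p0 : 0 < p by lra.
have r0 : 0 < r.
  rewrite -invr_gt0; have -> : r^-1 = p^-1 - q^-1 by rewrite rE addrC addKr.
  by rewrite subr_gt0 ltf_pV2.
have [al_gt0 al_half al_2r] := @a_const_bounds R p ptilde r (lt_trans (ltr_nat R 2 4) p4).
pose al := a_const p ptilde r; rewrite -/al in al_gt0 al_half al_2r lambda_ge.
have L_ge0 (s : R) : 0 <= s <= t0 -> 0 <= s by case/andP.
have poincare s (h : S -> R) : 0 <= s <= t0 -> pairing h (nu s) = 0 ->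
    - (p / 4) * pairing (fun x => H s x * h x ^+ 2) (nu s) +
    p * (p + 3) / 4 * t0 * pairing (fun x => H s x * h x) (nu s) ^+ 2
    <= lamm s * dirichlet (nu s) (Lm s) h.
  move=> st; have s0 := L_ge0 s st; rewrite nuE// LmE// lamE//.
  have := lambda_ge s st; rewrite ge_max HE// => /andP[h1 _].
  apply: (weighted_poincare (mu_prob s s0) (L_gen s s0) (L_rev s s0)) h1.
    by rewrite divr_gt0.
  by rewrite mulr_ge0// divr_ge0// mulr_ge0//; lra.
have log_sobolev s (h : S -> R) : 0 <= s <= t0 ->
    pairing (fun x => h x ^+ 2) (nu s) = 1 ->
    17 / 4 * al * w * pairing (fun x => h x ^+ 2 * ln `|h x|) (nu s)
    <= lamm s * dirichlet (nu s) (Lm s) h.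
  move=> st; have s0 := L_ge0 s st; rewrite nuE// LmE// lamE//.
  have := lambda_ge s st; rewrite ge_max => /andP[_ h2].
  apply: (weighted_log_sobolev (mu_prob s s0) (L_gen s s0) (L_rev s s0) _ (lambda_ge0 s s0) h2).
  by apply: mulr_ge0 => //; apply: mulr_ge0; [rewrite divr_ge0|exact: ltW].
pose G s := particle_generator (N := N) (lambda s) (L s) (Hfun mu s).
pose h := @mean_potential R S N H.
have ch := @mean_potential_continuous R S N H cH.
have G_cont phi x : exists2 g : R -> R, continuous g & forall s, 0 <= s -> g s = G s phi x.
  exists (fun s => particle_generator (lamm s) (Lm s) (H s) phi x).
    exact: particle_generator_continuous.
  by move=> s s0; rewrite /G lamE// LmE// HE.
have k1 : 0 <= (1 : R) by []; have k2 : 0 <= (2 : R) by [].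
have [u1 [u1E u1_fwd]] := weighted_law_forward X_meas X_rc ch trans markov G_cont k1.
have [u2 [u2E u2_fwd]] := weighted_law_forward X_meas X_rc ch trans markov G_cont k2.
have fwd1 : weighted_forward H Lm lamm t0 1 u1.
  move=> s phi st; have s0 := L_ge0 s st; have := u1_fwd s phi s0.
  by rewrite /G HE// lamE// LmE.
have fwd2 : weighted_forward H Lm lamm t0 2 u2.
  move=> s phi st; have s0 := L_ge0 s st; have := u2_fwd s phi s0.
  by rewrite /G HE// lamE// LmE.
have init k x : weighted_law P X h k 0 x = product_law (nu 0) x.
  by rewrite weighted_law_init// X_init nuE.
have u1_init x : u1 0 x = product_law (nu 0) x by rewrite u1E.
have u2_init x : u2 0 x = product_law (nu 0) x by rewrite u2E.
have u2_ge0 s x : 0 <= s <= t0 -> 0 <= u2 s x.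
  by move=> /L_ge0 s0; rewrite u2E//; exact: weighted_law_ge0.
have second_moment s f c : 0 <= s ->
    \sum_x u2 s x * pairing f (empirical R x) ^+ 2 -
    2 * c * (\sum_x u1 s x * pairing f (empirical R x)) + c ^+ 2 =
    \sum_x weighted_law P X h 2 s x * pairing f (empirical R x) ^+ 2 -
    2 * c * (\sum_x weighted_law P X h 1 s x * pairing f (empirical R x)) + c ^+ 2.
  move=> s0; congr (_ - 2 * c * _ + _).
    by apply: eq_bigr => x _; rewrite u2E.
  by apply: eq_bigr => x _; rewrite u1E.
have second_moment_ge0 s f c : 0 <= s <= t0 ->
    0 <= \sum_x u2 s x * pairing f (empirical R x) ^+ 2 -
    2 * c * (\sum_x u1 s x * pairing f (empirical R x)) + c ^+ 2.
  move=> /L_ge0 s0; rewrite second_moment//.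
  have [_ <-] := nu_process_second_moment X_meas X_rc cH trans markov f c s0.
  by apply: mean_rv_ge0 => o; exact: sqr_ge0.
have nu_prob' s : 0 <= s <= t0 -> strictly_positive_probability (nu s) by move=> /L_ge0 /nu_prob.
have dnu' s x : 0 <= s <= t0 -> is_derive s 1 (fun u => nu u x) (- H s x * nu s x).
  by move=> /L_ge0; exact: dnu.
have H_mean' s : 0 <= s <= t0 -> pairing (H s) (nu s) = 0.
  by move=> /L_ge0 s0; rewrite nuE// H_mean.
have L_gen' s : 0 <= s <= t0 -> Qmatrix (Lm s) by move=> /L_ge0 s0; rewrite LmE//; exact: L_gen.
have L_rev' s : 0 <= s <= t0 -> detailed_balance (nu s) (Lm s).
  by move=> /L_ge0 s0; rewrite LmE// nuE//; exact: L_rev.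
have lam_ge0' s : 0 <= s <= t0 -> 0 <= lamm s by move=> /L_ge0 s0; rewrite lamE//; exact: lambda_ge0.
have [K2 [dK2 K20 K2E K2_le]] := Kfun_primitive (ltr0Sn _ 1) nu_prob nuE HE cH cnu.
have [Kq [dKq Kq0 KqE Kq_le]] := Kfun_primitive q0 nu_prob nuE HE cH cnu.
move=> t tt0; have /andP[t_ge0 t_le] := tt0.
have st0 s : 0 <= s <= t -> 0 <= s <= t0 by move=> /andP[-> /le_trans ->].
(* By unbiasedness this is the variance of <f, nu_s>. Its supremum over A is the real number eps of
   the recursion. *)
pose vf s (f : S -> R) := \sum_x u2 s x * pairing f (empirical R x) ^+ 2 - pairing f (nu s) ^+ 2.
pose A := [set v | exists s f, [/\ 0 <= s <= t, Lp_norm p (nu s) f <= 1 & v = vf s f]].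
have A0 : A 0.
  exists 0, (fun=> 0); split; first by rewrite lexx.
    by rewrite Lp_norm_cst ?normr0//; apply: nu_prob.
  have z (m : S -> R) : pairing (fun=> 0) m = 0.
    by rewrite /pairing big1// => x _; rewrite mul0r.
  by rewrite /vf z expr0n subr0 big1// => x _; rewrite z expr0n mulr0.
(* Finiteness of eps: the norm bound gives |f y| <= 1 / nu s y, and the resulting bound B on second
   moments is continuous in s. *)
have A_bounded : exists C : R, forall s f, 0 <= s <= t -> Lp_norm p (nu s) f <= 1 -> vf s f <= C.
  pose b (s : R) := \sum_y (nu (Num.max s 0) y)^-1.
  pose B (s : R) := (\sum_x weighted_law P X h 2 (Num.max s 0) x * 1) * b s ^+ 2.
  have cb : continuous b.
    apply: cont_sum => y s; apply: (@continuousV R R (fun s => nu (Num.max s 0) y) s _ (cnu y s)).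
    by have [h0 _] := nu_prob _ (max0_ge0 s); rewrite gt_eqF.
  have cB : continuous B.
    rewrite /B; under [X in continuous X]eq_fun do rewrite expr2.
    apply: contM; last exact: contM.
    exact: (weighted_law_continuous X_meas X_rc ch trans markov G_cont k2 (phi := fun=> 1)).
  have [C _ hC] := continuous_bounded_itv 0 t cB.
  exists C => s f st f1; apply: le_trans (hC s st); apply: le_trans (ler_norm _).
  have /andP[s0 _] := st; have prs := nu_prob s s0; have [nu0 _] := prs.
  have fb y : `|f y| <= b s.
    rewrite /b max_l//; apply: (@le_trans _ _ (nu s y)^-1).
      rewrite -[leRHS]mul1r ler_pdivlMr//; apply: le_trans f1.
      apply: le_trans (pairing_norm_le prs f _); last by lra.
      by rewrite /pairing (bigD1 y)//= lerDl sumr_ge0// => z _; rewrite mulr_ge0// ltW.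
    by rewrite (bigD1 y)//= lerDl sumr_ge0// => z _; rewrite invr_ge0 ltW.
  rewrite /vf lerBlDr; apply: ler_wpDr; first exact: sqr_ge0.
  rewrite /B max_l// mulr_suml; apply: ler_sum => x _; rewrite mulr1 u2E//.
  rewrite ler_wpM2l ?weighted_law_ge0//.
  rewrite -real_normK ?num_real// ler_sqr ?nnegrE//; first exact: pairing_empirical_norm_le.
  exact: le_trans (fb x0).
have A_sup : has_sup A.
  split; first by exists 0.
  by have [C hC] := A_bounded; exists C => _ [s [f [st f1 ->]]]; exact: hC.
pose eps := sup A.
have eps_ge0 : 0 <= eps by apply: ub_le_sup => //; case: A_sup.
have vf_le s f : 0 <= s <= t -> Lp_norm p (nu s) f <= 1 -> vf s f <= eps.
  by move=> st f1; apply: ub_le_sup; [case: A_sup|exists s, f].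
(* Quadratic homogeneity carries the bound from the unit ball to all f; norm zero means f = 0. *)
have eps_bound s f : 0 <= s <= t -> vf s f <= eps * Lp_norm p (nu s) f ^+ 2.
  move=> st; have prs := nu_prob' s (st0 s st).
  have pairZ c (m g : S -> R) : pairing (fun x => c * g x) m = c * pairing g m.
    by rewrite /pairing mulr_sumr; apply: eq_bigr => x _; rewrite mulrA.
  have vfZ c : vf s (fun x => c * f x) = c ^+ 2 * vf s f.
    rewrite /vf pairZ exprMn mulrBr mulr_sumr; congr (_ - _); apply: eq_bigr => x _.
    by rewrite pairZ exprMn mulrCA.
  have [/eqP|n_neq0] := eqVneq (Lp_norm p (nu s) f) 0.
    move=> /eqP n0; have f0 := Lp_norm_eq0 prs n0.
    rewrite n0 expr0n mulr0; have := vfZ 0; rewrite expr0n mul0r.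
    by rewrite (_ : (fun x => 0 * f x) = f) => [->|]; last by apply/funext => x; rewrite f0 mul0r.
  have n_gt0 : 0 < Lp_norm p (nu s) f by rewrite lt_neqAle eq_sym n_neq0 Lp_norm_ge0.
  have := vf_le s (fun x => (Lp_norm p (nu s) f)^-1 * f x) st.
  rewrite Lp_normZ// ger0_norm ?invr_ge0 ?(ltW n_gt0)// mulVf// => /(_ (lexx _)).
  by rewrite vfZ exprVn mulrC ler_pdivrMr ?exprn_gt0.
have K2_ge0 : 0 <= K2 t by rewrite -K20 K2_le.
have Kq_ge0 : 0 <= Kq t by rewrite -Kq0 Kq_le.
have final : eps <= (2 + 8 * Kfun mu t 2) * N%:R^-1 * (1 + 16 * Kfun mu t q * N%:R^-1).
  rewrite K2E// KqE//; apply: (@variance_closure R N%:R (K2 t) (Kq t) (Num.max (Kq t0) 1)) => //.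
  - by rewrite le_max Kq_le.
  - by rewrite le_max lexx orbT.
  - by rewrite -KqE.
  have N0 : 0 < (N%:R : R) by rewrite ltr0n.
  rewrite mulrC -ler_pdivlMr//; apply: ge_sup; first by exists 0.
  move=> _ [s [f [st f1 ->]]]; rewrite ler_pdivlMr// mulrC.
  have /andP[s0 s_le] := st.
  (* The recursion runs up to s, with eps still the supremum over [0, t]; monotonicity of K2 and Kq
     then makes its bound uniform in s. *)
  have ebs a g : 0 <= a <= s -> vf a g <= eps * Lp_norm p (nu a) g ^+ 2.
    by move=> /andP[a0 /le_trans as_]; apply: eps_bound; rewrite a0 as_.
  have hrec := variance_recursion N_gt0 nu_prob' dnu' H_mean' L_gen' L_rev' lam_ge0' H_osc cH
    cL clam w_ge0 fwd1 fwd2 u1_init u2_init u2_ge0 second_moment_ge0 (st0 s st) p4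
    (ltW p_lt) r0 rE al_half al_2r poincare log_sobolev eps_ge0 ebs
    (fun a ha => dK2 a (L_ge0 a ha)) (fun a ha => dKq a (L_ge0 a ha)) K20 Kq0 f1.
  apply: (le_trans hrec); have hK2 := K2_le s t s0 s_le; have hKq := Kq_le s t s0 s_le.
  move: eps_ge0 hK2 hKq; clear; move: eps (K2 s) (K2 t) (Kq s) (Kq t) => e a a' c c' e0 aa cc.
  have : e * c <= e * c' by rewrite ler_wpM2l.
  lra.
apply: ge_ereal_sup => _ [s [f [st f1 ->]]]; have /andP[s0 _] := st.
rewrite (nu_process_variance X_meas X_rc cH trans markov f (pairing f (mu s)) s0 HE).
rewrite -second_moment// lee_fin; apply: le_trans final.
(* Unbiasedness turns the mean square error into [vf s f]. *)
have ub := unbiased N_gt0 nu_prob' dnu' L_gen' L_rev' cH cL clam fwd1 u1_init f (st0 s st).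
rewrite ub nuE//; have := vf_le s f st; rewrite /vf nuE// => /(_ f1); apply: le_trans.
by rewrite le_eqVlt; apply/orP; left; apply/eqP; ring.
Qed.
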